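(* Assume that $\widehat{\mathcal{D}}$ contains a countable family that is dense in both $Y_1$ (for $\|\cdot\|_{Y_1}$) and $Y$ (for $\|\cdot\|$), and assume (A0), (A1), (A2), (A3). Then $\widehat{\Gamma}$ is a $\mathcal{B}(Y)$-contraction regular inhomogeneous $Y$-semigroup. Further, for every countable family $\{f_k\}_{k\in\mathbb N} \subseteq Y$ and every $s \in J$, as $\epsilon\to0$ we have the weak convergence in the Skorohod topology of $D(J(s),Y^\infty)$: \[ (V_{\epsilon}(s,\cdot)f_k: k \in \mathbb{N}) \Rightarrow (\widehat{\Gamma}(s, \cdot)f_k: k \in \mathbb{N}). \]
   Context: Banach spaces: $(Y,\|\cdot\|)$ real separable, $(Y_1,\|\cdot\|_{Y_1})$ real separable continuously embedded in $Y$; $Y^\infty$ is the countable product with product topology. $J$ is $\mathbb{R}^+$ or $[0,T_\infty]$, $\Delta_J=\{(s,t)\in J^2:s\le t\}$, $J(s)=\{t\in J:t\ge s\}$; $D(J(s),E)$ is the Skorohod space of RCLL functions; $\Rightarrow$ is convergence in distribution. An inhomogeneous $Y$-semigroup is $\Gamma:\Delta_J\to\mathcal B(Y)$ with $\Gamma(t,t)=I$, $\Gamma(s,r)\Gamma(r,t)=\Gamma(s,t)$ for $s\le r\le t$; it is a $\mathcal B(Y)$-contraction if $\sup_{(s,t)}\|\Gamma(s,t)\|_{\mathcal B(Y)}\le1$. Its generator $A_\Gamma(t)f$ is the common value of $\lim_{h\downarrow0}h^{-1}(\Gamma(t,t+h)-I)f$ and $\lim_{h\downarrow0}h^{-1}(\Gamma(t-h,t)-I)f$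 on the set $\mathcal D(A_\Gamma(t))$ where both exist and agree; $\mathcal D(A_\Gamma)=\bigcap_t\mathcal D(A_\Gamma(t))$. $\Gamma$ is regular if $Y_1\subseteq\mathcal D(A_\Gamma)$, $\Gamma(s,t)Y_1\subseteq Y_1$ and $u\mapsto\Gamma(u,t)f$ is $\|\cdot\|_{Y_1}$-continuous for $f\in Y_1$, $u\mapsto\Gamma(s,u)f$ is $Y$-continuous on $J(s)$ for $f\in Y$, and $u\mapsto\Gamma(s,u)A_\Gamma(u)f$ is Bochner integrable on $[s,t]$ for $f\in Y_1$. Probabilistic setting: $(\Omega,\mathcal F,\mathbb P)$ complete; $X$ finite; $(x_n,T_n)_{n\ge0}$ an ergodic Markov renewal process ($x_n\in X$, $T_0=0<T_1<\dots$) with semi-Markov kernel $Q$ (i.e. $\mathbb P[x_{n+1}=y,T_{n+1}-T_n\le t\mid x_k,T_k,k\le n]=Q(x_n,y,t)$), whose embedded chain, with transition matrix $P(x,y)=\lim_{t\to\infty}Q(x,y,t)$, is aperiodic and uniformly ergodic with stationary distribution $\rho$ ($\|P^n-\Pi\|\to0$, $\Pi g(x)=\sum_y\rho_yg(y)$); $F(x,t)=\sum_yQ(x,y,t)$, $m_1(x)=\int_0^\infty tF(x,dt)$, $M_\rho=\sum_x\rho_xm_1(x)$. $N(t)=\sup\{n:T_n\le t\}$ (finite everywhere after restricting $\Omega$ to a full-measure event); $x(t)=x_{N(t)}$; $N_s(t)=N(t)-N(s)$, $T_0(s)=s$, $T_n(s)=T_{N(s)+n}$ ($n\ge1$), $x_n(s)=x(T_n(s))$.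 $(\Gamma_x)_{x\in X}$ inhomogeneous $Y$-semigroups with generators $A_x$, jointly measurable in $(r,t,x,f)$. $(D^\epsilon(x,y))_{x,y\in X,\epsilon\in(0,1]}\subseteq\mathcal B(Y)$ with $(x,y,f)\mapsto D^\epsilon(x,y)f$ measurable, $D^0(x,y):=I$. $\mathcal D(D_1)$: set of $f\in Y$ such that $D^\epsilon_1(x,y)f:=\lim_{h\to0,\epsilon+h\in[0,1]}h^{-1}(D^{\epsilon+h}(x,y)f-D^\epsilon(x,y)f)$ exists for all $\epsilon\in[0,1]$, $x,y$; $\mathcal D(D_2)$, $D_2^\epsilon$ the analogous second derivative; $\mathcal D(D^0_1\in Y_1)=\{f\in\mathcal D(D_1)\cap Y_1:D_1^0(x,y)f\in Y_1\ \forall x,y\}$. $A'_x(t)f$ is the $\|\cdot\|_{Y_1}$-limit of $h^{-1}(A_x(t+h)f-A_x(t)f)$, $\mathcal D(A'_x)$ the set of $f\in\mathcal D(A_x)\cap Y_1$ with $A_x(t)f\in Y_1$ for all $t$ for which this limit exists in $Y_1$ for all $t$. $\widehat{\mathcal D}:=\bigcap_x\mathcal D(A'_x)\cap\mathcal D(D_2)\cap\mathcal D(D^0_1\in Y_1)$. Rescaled random evolution: $t^{\epsilon,s}=s+\epsilon(t-s)$, $T^{\epsilon,s}_k(s)=s+\epsilon(T_k(s)-s)$, $V_\epsilon(s,t)=\big[\prod_{k=1}^{N_s(t^{1/\epsilon,s})}\Gamma_{x_{k-1}(s)}(T^{\epsilon,s}_{k-1}(s),T^{\epsilon,s}_k(s))D^\epsilon(x_{k-1}(s),x_k(s))\big]\Gamma_{x(t^{1/\epsilon,s})}(T^{\epsilon,s}_{N_s(t^{1/\epsilon,s})}(s),t)$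 (ordered left to right, empty product $I$), $\epsilon\in(0,1]$. Averaged generator: for $f\in Y_1$, $a(x,t)f:=M_\rho^{-1}(m_1(x)A_x(t)f+\sum_yP(x,y)D^0_1(x,y)f)$ and $\widehat A(t)f:=\sum_x\rho_xa(x,t)f$. (A0): (a) $Y_1\subseteq\mathcal D(D_1)$; (b) every $\Gamma_x$ regular; (c) $t\mapsto A_x(t)f$ continuous into $Y$ for $f\in Y_1$; (d) there is $\bar\tau>0$ with $Q(x,y,(\bar\tau,\infty))=0$ for all $x,y$; (e) all $\Gamma_x(s,t)$, $D^\epsilon(x,y)$ have $\mathcal B(Y)$-norm $\le1$; (f) $A_x(t)\in\mathcal B(Y_1,Y)$ and $\sup_u\|A_x(u)\|_{\mathcal B(Y_1,Y)}<\infty$; (g) $\sup_{u,x}\|A'_x(u)f\|<\infty$, $\sup_{u,x}\|A_x(u)f\|_{Y_1}<\infty$ for $f\in\bigcap_x\mathcal D(A'_x)$; (h) $\sup_{\epsilon,x,y}\|D_1^\epsilon(x,y)f\|<\infty$ for $f\in\mathcal D(D_1)$; (i) $\sup_{\epsilon,x,y}\|D^\epsilon_2(x,y)f\|<\infty$ for $f\in\mathcal D(D_2)$. (A1): for every $f\in Y_1$, $s\in J$, $\Delta\in(0,1]$, $T\in J(s)$ there is a compact $K\subseteq Y$ with $\liminf_{\epsilon\to0}\mathbb P[V_\epsilon(s,t)f\in K\ \forall t\in[s,T]]\ge1-\Delta$. (A2): for every $s\in J$, $f\in\widehat{\mathcal D}$, $\Delta\in(0,1]$, $T\in J(s)$ there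 is a compact $K\subseteq Y$ with $\liminf_{\epsilon\to0}\mathbb P[V_\epsilon(s,t)\widehat A(t)f\in K\ \forall t\in[s,T]]\ge1-\Delta$. (A3): $\widehat A$ is the generator of a regular inhomogeneous $Y$-semigroup $\widehat\Gamma$. *)

(* Defs.v *)
From HB Require Import structures.
From mathcomp Require Import all_boot all_order all_algebra.
From mathcomp Require Import all_classical all_reals all_analysis.
Set Implicit Arguments. Unset Strict Implicit. Unset Printing Implicit Defensive.
Import Order.TTheory GRing.Theory Num.Theory.
Import numFieldNormedType.Exports.
Local Open Scope classical_set_scope.
Local Open Scope ring_scope.

Section Generalities.
Context {R : realType}.

Definition separable (T : topologicalType) :=
  exists C : set T, countable C /\ closure C = setT.

Definition DeltaJ (J : set R) (s t : R) := [/\ J s, J t & s <= t].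
Definition Jfrom (J : set R) (s : R) : set R := [set t | J t /\ s <= t].

Context {Y : normedModType R}.

Definition is_bounded_op (L : Y -> Y) :=
  (forall (a : R) (u v : Y), L (a *: u + v) = a *: L u + L v) /\
  exists C : R, forall y, `|L y| <= C * `|y|.

Definition inhom_semigroup (J : set R) (G : R -> R -> Y -> Y) :=
  [/\ (forall s t, DeltaJ J s t -> is_bounded_op (G s t)),
      (forall t y, J t -> G t t y = y) &
      (forall s r t y, J s -> J r -> J t -> s <= r -> r <= t ->
         G s r (G r t y) = G s t y)].

Definition contractionB (J : set R) (G : R -> R -> Y -> Y) :=
  forall s t y, DeltaJ J s t -> `|G s t y| <= `|y|.

Definition gen_right (J : set R) (G : R -> R -> Y -> Y) t f g :=
  forall e, 0 < e -> exists d, 0 < d /\ forall h, 0 < h -> h < d -> J (t + h) ->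
    `|h^-1 *: (G t (t + h) f - f) - g| < e.
Definition gen_left (J : set R) (G : R -> R -> Y -> Y) t f g :=
  forall e, 0 < e -> exists d, 0 < d /\ forall h, 0 < h -> h < d -> J (t - h) ->
    `|h^-1 *: (G (t - h) t f - f) - g| < e.

Definition gen_dom (J : set R) (G : R -> R -> Y -> Y) t f :=
  exists g, gen_right J G t f g /\ gen_left J G t f g.
(* A_G(t) f (the common value of both limits; meaningful on D(A_G(t))) *)
Definition genop (J : set R) (G : R -> R -> Y -> Y) t f : Y :=
  xget 0 [set g | gen_right J G t f g /\ gen_left J G t f g].

Definition simple_fun (phi : R -> Y) :=
  exists (n : nat) (A : 'I_n -> set R) (v : 'I_n -> Y),
    (forall i, measurable (A i)) /\
    phi = fun u => \sum_(i < n) (\1_(A i) u) *: v i.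

Definition bochner_integrable (s t : R) (g : R -> Y) :=
  (exists phi : nat -> R -> Y, (forall n, simple_fun (phi n)) /\
     {ae (@lebesgue_measure R), forall u, [set` `[s, t]] u -> phi^~ u @ \oo --> g u}) /\
  (\int[@lebesgue_measure R]_(u in `[s, t]) (`|g u|)%:E < +oo)%E.

(* regular inhomogeneous Y-semigroup, Y1 embedded in Y via iota *)
Definition regular {Y1 : normedModType R} (J : set R) (iota : Y1 -> Y)
    (G : R -> R -> Y -> Y) :=
  [/\ (forall t (f : Y1), J t -> gen_dom J G t (iota f)),
      (forall s t (f : Y1), DeltaJ J s t -> exists g : Y1, G s t (iota f) = iota g),
      (forall t (f : Y1), J t -> exists F : R -> Y1,
          (forall u, DeltaJ J u t -> iota (F u) = G u t (iota f)) /\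
          {within [set u | DeltaJ J u t], continuous F}),
      (forall s (f : Y), J s -> {within Jfrom J s, continuous (fun u => G s u f)}) &
      (forall s t (f : Y1), DeltaJ J s t ->
          bochner_integrable s t (fun u => G s u (genop J G u (iota f))))].

End Generalities.

Section Derivatives.
Context {R : realType} {V : normedModType R}.

Definition dlim01 (phi : R -> V) (e : R) (g : V) :=
  forall eta, 0 < eta -> exists del, 0 < del /\ forall h, h != 0 -> `|h| < del ->
    0 <= e + h <= 1 -> `|h^-1 *: (phi (e + h) - phi e) - g| < eta.

Definition dlimJ (J : set R) (a : R -> V) (t : R) (g : V) :=
  forall eta, 0 < eta -> exists del, 0 < del /\ forall h, h != 0 -> `|h| < del ->
    J (t + h) -> `|h^-1 *: (a (t + h) - a t) - g| < eta.
End Derivatives.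

Section Dops.
Context {R : realType} {X : finType} {Y : normedModType R}.
Variable Dop : R -> X -> X -> Y -> Y.   (* D^eps(x,y), eps in (0,1] *)

Definition Dfull (e : R) (x y : X) : Y -> Y := if e == 0 then id else Dop e x y.

Definition inD1 (f : Y) := forall e x y, 0 <= e <= 1 ->
  exists g, dlim01 (fun e' => Dfull e' x y f) e g.
Definition D1 (e : R) (x y : X) (f : Y) : Y :=
  xget 0 [set g | dlim01 (fun e' => Dfull e' x y f) e g].
Definition inD2 (f : Y) := inD1 f /\ forall e x y, 0 <= e <= 1 ->
  exists g, dlim01 (fun e' => D1 e' x y f) e g.
Definition D2 (e : R) (x y : X) (f : Y) : Y :=
  xget 0 [set g | dlim01 (fun e' => D1 e' x y f) e g].
End Dops.

Section Aprime.
Context {R : realType} {Y Y1 : normedModType R}.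
Variables (J : set R) (iota : Y1 -> Y) (G : R -> R -> Y -> Y).

Definition inDA' (f : Y1) :=
  (forall t, J t -> gen_dom J G t (iota f)) /\
  exists a : R -> Y1, (forall t, J t -> iota (a t) = genop J G t (iota f)) /\
                      (forall t, J t -> exists g, dlimJ J a t g).
Definition isA' (f : Y1) (t : R) (g : Y1) :=
  exists a : R -> Y1, (forall u, J u -> iota (a u) = genop J G u (iota f)) /\
                      dlimJ J a t g.
End Aprime.

Section MRP.
Context {R : realType} {d : measure_display} {Omega : measurableType d}
        {X : finType}.
Variables (x : nat -> Omega -> X) (T : nat -> Omega -> R).

Definition past_sigma (n : nat) : set (set Omega) :=
  <<s [set A | exists k a, (k <= n)%N /\ A = x k @^-1` [set a]] `|`
      [set A | exists k (b : R), (k <= n)%N /\ A = [set w | T k w <= b]] >>.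

Definition markov_renewal (P : probability Omega R) (Q : X -> X -> R -> R) :=
  [/\ (forall n a, measurable (x n @^-1` [set a])),
      (forall n, measurable_fun setT (T n)),
      (forall w, T 0%N w = 0),
      (forall n w, T n w < T n.+1 w) &
      (forall n y (t : R) A, past_sigma n A ->
         P (A `&` [set w | x n.+1 w = y /\ T n.+1 w - T n w <= t]) =
         (\int[P]_(w in A) (Q (x n w) y t)%:E)%E)].

(* N(t) = sup {n : T_n <= t} (0 by convention if the sup is infinite,
   which happens only on a null event) *)
Definition Nt (t : R) (w : Omega) : nat :=
  xget 0%N [set m | T m w <= t /\ forall n, T n w <= t -> (n <= m)%N].
Definition xt (t : R) (w : Omega) : X := x (Nt t w) w.
Definition Nst (s t : R) (w : Omega) : nat := (Nt t w - Nt s w)%N.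
Definition Ts (s : R) (n : nat) (w : Omega) : R :=
  if n == 0%N then s else T (Nt s w + n)%N w.
Definition xs (s : R) (n : nat) (w : Omega) : X := xt (Ts s n w) w.
Definition Teps (eps s : R) (n : nat) (w : Omega) : R := s + eps * (Ts s n w - s).

Context {Y : normedModType R}.
Variables (G : X -> R -> R -> Y -> Y) (Dop : R -> X -> X -> Y -> Y).

Definition Vop (eps s t : R) (w : Omega) (f : Y) : Y :=
  let t' := s + eps^-1 * (t - s) in
  let M := Nst s t' w in
  foldr (fun k g => G (xs s k.-1 w) (Teps eps s k.-1 w) (Teps eps s k w)
                      (Dop eps (xs s k.-1 w) (xs s k w) g))
        (G (xt t' w) (Teps eps s M w) t f) (iota 1 M).
End MRP.

Section Averaging.
Context {R : realType} {X : finType} {Y : normedModType R}.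
Variables (Q : X -> X -> R -> R) (rho : X -> R).

Definition Fsoj (x : X) (t : R) : R := \sum_(y : X) Q x y t.
Definition Pmat (x y : X) : R := lim (Q x y t @[t --> +oo]).
Fixpoint Pn (n : nat) (x y : X) : R :=
  if n is n'.+1 then \sum_(z : X) Pn n' x z * Pmat z y else (x == y)%:R.
(* m_1(x) = int_0^oo t F(x,dt) = int_0^oo (1 - F(x,t)) dt *)
Definition m1 (x : X) : R :=
  fine (\int[@lebesgue_measure R]_(t in [set t : R | (0 <= t)%R]) (1 - Fsoj x t)%:E)%E.
Definition Mrho : R := \sum_(x : X) rho x * m1 x.

Variables (J : set R) (G : X -> R -> R -> Y -> Y) (Dop : R -> X -> X -> Y -> Y).
Definition a_op (x : X) (t : R) (f : Y) : Y :=
  Mrho^-1 *: (m1 x *: genop J (G x) t f + \sum_(y : X) Pmat x y *: D1 Dop 0 x y f).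
Definition Ahat (t : R) (f : Y) : Y := \sum_(x : X) rho x *: a_op x t f.
End Averaging.

Section Skorohod.
Context {R : realType} {Y : normedModType R}.

(* standard metric of the product topology on Y^oo = nat -> Y *)
Definition rhoinf (a b : nat -> Y) : R :=
  limn (fun n => \sum_(k < n) (((2:R) ^+ k)^-1 * Num.min 1 `|a k - b k|)).

Variables (J : set R) (s : R).

Definition rcll (z : R -> nat -> Y) :=
  forall t, Jfrom J s t ->
    (forall e, 0 < e -> exists del, 0 < del /\
       forall u, Jfrom J s u -> t <= u -> u < t + del -> rhoinf (z u) (z t) < e) /\
    (s < t -> exists l : nat -> Y, forall e, 0 < e -> exists del, 0 < del /\
       forall u, Jfrom J s u -> t - del < u -> u < t -> rhoinf (z u) l < e).

Definition time_change (lam : R -> R) :=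
  [/\ (forall t, Jfrom J s t -> Jfrom J s (lam t)),
      (forall u, Jfrom J s u -> exists t, Jfrom J s t /\ lam t = u),
      (forall t1 t2, Jfrom J s t1 -> Jfrom J s t2 -> t1 < t2 -> lam t1 < lam t2) &
      {within Jfrom J s, continuous lam}].

Definition skorohod_cvg (zn : nat -> R -> nat -> Y) (z : R -> nat -> Y) :=
  exists lam : nat -> R -> R, (forall n, time_change (lam n)) /\
    (forall e, 0 < e -> \forall n \near \oo,
        forall t, Jfrom J s t -> `|lam n t - t| < e) /\
    (forall Tm, Jfrom J s Tm -> forall e, 0 < e -> \forall n \near \oo,
        forall t, s <= t -> t <= Tm -> rhoinf (zn n (lam n t)) (z t) < e).

Definition cvg_dist_det {d : measure_display} {Omega : measurableType d}
    (P : probability Omega R) (Z : R -> Omega -> R -> nat -> Y) (z : R -> nat -> Y) :=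
  forall F : (R -> nat -> Y) -> R,
    (exists M : R, forall w, rcll w -> `|F w| <= M) ->
    (forall wn w, (forall n, rcll (wn n)) -> rcll w -> skorohod_cvg wn w ->
        F (wn n) @[n --> \oo] --> F w) ->
    forall e, 0 < e -> exists del, 0 < del /\ forall eps, 0 < eps -> eps < del -> eps <= 1 ->
      (`| \int[P]_w (F (Z eps w))%:E - (F z)%:E | < e%:E)%E.
End Skorohod.

Section Assumptions.
Context {R : realType} {Y Y1 : normedModType R} {X : finType}
        {d : measure_display} {Omega : measurableType d}.
Variables (J : set R) (iota : Y1 -> Y) (G : X -> R -> R -> Y -> Y)
          (Dop : R -> X -> X -> Y -> Y) (Q : X -> X -> R -> R).

Definition Dhat (f : Y1) :=
  [/\ (forall x, inDA' J iota (G x) f),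
      inD2 Dop (iota f) &
      inD1 Dop (iota f) /\ (forall x y, exists g : Y1, iota g = D1 Dop 0 x y (iota f))].

Definition A0 :=
  (* (a) *) (forall f : Y1, inD1 Dop (iota f)) /\
      (* (b) *) (forall x, regular J iota (G x)) /\
      (* (c) *) (forall x (f : Y1), {within J, continuous (fun t => genop J (G x) t (iota f))}) /\
      (* (d) *) (exists tau : R, 0 < tau /\ forall x y, Pmat Q x y - Q x y tau = 0) /\
      (* (e) *) (forall x, contractionB J (G x)) /\
                (forall e x y v, 0 < e <= 1 -> `|Dop e x y v| <= `|v|) /\
      (* (f) *) (forall x, exists C : R, forall u (f : Y1), J u ->
                   `|genop J (G x) u (iota f)| <= C * `|f|) /\
      (* (g) *) (forall f : Y1, (forall x, inDA' J iota (G x) f) ->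
                   (exists C : R, forall x u g, J u -> isA' J iota (G x) f u g -> `|iota g| <= C) /\
                   (exists C : R, forall x u a, J u -> iota a = genop J (G x) u (iota f) ->
                                                 `|a| <= C)) /\
      (* (h) *) (forall f : Y, inD1 Dop f -> exists C : R, forall e x y, 0 <= e <= 1 ->
                   `|D1 Dop e x y f| <= C) /\
      (* (i) *) (forall f : Y, inD2 Dop f -> exists C : R, forall e x y, 0 <= e <= 1 ->
                   `|D2 Dop e x y f| <= C).

Variables (P : probability Omega R) (x : nat -> Omega -> X) (T : nat -> Omega -> R).

Definition compact_containment (h : R -> Y) (s Del Tm : R) :=
  exists K : set Y, compact K /\
    forall eta, 0 < eta -> exists del, 0 < del /\ forall eps, 0 < eps -> eps < del -> eps <= 1 ->
      ((1 - Del - eta)%:E <=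
        P [set w | forall t : R, (s <= t)%R -> (t <= Tm)%R -> K (Vop x T G Dop eps s t w (h t))])%E.

Definition A1 := forall (f : Y1) s Del Tm, J s -> 0 < Del <= 1 -> Jfrom J s Tm ->
  compact_containment (fun _ => iota f) s Del Tm.

Variable rho : X -> R.
Definition A2 := forall s (f : Y1) Del Tm, J s -> Dhat f -> 0 < Del <= 1 -> Jfrom J s Tm ->
  compact_containment (fun t => Ahat Q rho J G Dop t (iota f)) s Del Tm.
End Assumptions.

(* Main.v *)
Require Import Defs.
From HB Require Import structures.
From mathcomp Require Import all_boot all_order all_algebra.
From mathcomp Require Import all_classical all_reals all_analysis.
From mathcomp Require Import measurable_realfun.
From mathcomp Require Import ring lra.
Import Order.TTheory GRing.Theory Num.Theory.
Import numFieldNormedType.Exports.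
Local Open Scope classical_set_scope.
Local Open Scope ring_scope.
(** By the weak law of large numbers for the Markov renewal process, over a time
    interval [[a, b]] the accelerated process spends a time close to
    [(b - a) rho_x m_1(x) / M_rho] in each state [x] and makes about
    [(b - a) rho_x P(x, y) / (eps M_rho)] jumps from [x] to [y].  Since all the
    factors of the random evolution are contractions and [Gamma_x] and [D^eps] move
    elements of [Y_1] by an amount of the order of the elapsed time and of [eps],
    the evolution [W(a, b)] over a short interval is [I + (b - a) Ahat + o(b - a)]
    on [\hat D], hence, by density, on [Y_1], outside an event of small probability.
    The interpolation [u |-> V_eps(s, u) Ghat(u, t) f] between [Ghat(s, t) f] and
    [V_eps(s, t) f] thus moves by [o(u - a)] from [a] to [u] (the left derivative of
    [u |-> Ghat(u, t) f] is [- Ahat(u) Ghat(u, t) f]), and a real induction shows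
    that its end points are close.  So [V_eps(s, .) f] converges in probability,
    uniformly on compact time sets, to the deterministic [Ghat(s, .) f]; contractivity
    of [Ghat] and the weak convergence follow, directly. *)

Set Implicit Arguments. Unset Strict Implicit. Unset Printing Implicit Defensive.

(** * Real induction and one-sided mean value estimates *)

Section RealInduction.
Context {R : realType}.
Implicit Types (a b x y : R) (S : R -> Prop).

(** The time interval cannot be cut in advance into equal pieces: the length on which the
    first-order expansion at [u] is accurate depends on [u] in an uncontrolled way, through the left
    generator of [Ghat] at [u], a mere pointwise limit, and through the element of $\widehat D$ that
    approximates [Ghat u t f]. Hence real induction, run from [t] down to [s], because the relation
    $\widehat\Gamma(a,t)=\widehat\Gamma(a,u)\widehat\Gamma(u,t)$ turns exactly the left quotient at
    [u] into an increment of the interpolation. Errors in probability must not pile up along the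
    induction. Every local estimate therefore has the form [e * (u - a) + dl], where only [e]
    restricts [u - a], and [dl] is arbitrary for fixed [a] and [u]; the induction predicate
    quantifies over all [dl], so that each step may halve it. The weak law is proved by
    orthogonality and Chebyshev for transition counts only. State frequencies follow because they
    are almost invariant under the transition matrix, and occupation times because sojourns are
    bounded by [tau] and can be sliced into finitely many layers. *)

Lemma real_induction a b S : a <= b -> S a ->
  (forall x, a <= x -> x < b -> S x ->
    exists2 d, 0 < d & forall y, x < y -> y < x + d -> y <= b -> S y) ->
  (forall x, a < x -> x <= b -> (forall y, a <= y -> y < x -> S y) -> S x) ->
  S b.
Proof.
move=> ab Sa Sr Sl.
pose A := [set x | a <= x <= b /\ forall y, a <= y -> y <= x -> S y].
have Aa : A a.
  by split; [rewrite lexx ab|move=> y ay ya; have -> : y = a by lra].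
have hA : has_sup A.
  by split; [exists a|exists b => x [/andP[]]].
set c := sup A.
have ac : a <= c by apply: ub_le_sup => //; case: hA.
have cb : c <= b by apply: ge_sup; [exists a|move=> x [/andP[]]].
have below y : a <= y -> y < c -> S y.
  move=> ay yc; have [x [_ Sx] yx] := sup_adherent (E := A) (eps := c - y) ltac:(lra) hA.
  by apply: Sx => //; rewrite -/c in yx; lra.
have Sc : S c.
  have [ac'|ca] := ltP a c; first exact: Sl.
  by have -> : c = a by lra.
have [cb'|bc] := ltP c b; last by have -> : b = c by lra.
have [d d0 Sd] := Sr c ac cb' Sc.
pose x := Num.min (c + d / 2) b.
have cx : c < x by rewrite lt_min; apply/andP; split; lra.
have xd : x <= c + d / 2 by rewrite ge_min lexx.
have xb : x <= b by rewrite ge_min lexx orbT.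
suff : x <= c by rewrite leNgt cx.
apply: ub_le_sup; first by case: hA.
split; first by apply/andP; split; lra.
move=> y ay yx; have [yc|cy] := leP y c.
  by have [/below|cy] := ltP y c; [exact|have -> : y = c by lra].
by apply: Sd; lra.
Qed.

Lemma real_induction_down a b S : a <= b -> S b ->
  (forall x, a < x -> x <= b -> S x ->
    exists2 d, 0 < d & forall y, y < x -> x - d < y -> a <= y -> S y) ->
  (forall x, a <= x -> x < b -> (forall y, y <= b -> x < y -> S y) -> S x) ->
  S a.
Proof.
move=> ab Sb Sr Sl.
rewrite -[a]opprK; apply: (@real_induction (- b) (- a) (fun x => S (- x))).
- by lra.
- by rewrite opprK.
- move=> x bx xa Sx; have [d d0 H] := Sr (- x) ltac:(lra) ltac:(lra) Sx.
  by exists d => // y *; apply: H; lra.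
- move=> x bx xa H; apply: Sl; [lra|lra|move=> y yb xy].
  by rewrite -[y]opprK; apply: H; lra.
Qed.

(** Compactness of the interval for a property that is additive under concatenation and holds on all
    short intervals around each point: real induction on the right end point [y] of [U a y]. *)
Lemma cousin a b (U : R -> R -> Prop) : a <= b ->
  (forall x y z, a <= x -> x <= y -> y <= z -> z <= b -> U x y -> U y z -> U x z) ->
  (forall u, a <= u -> u <= b -> exists2 d, 0 < d & forall x y,
     a <= x -> x <= u -> u <= y -> y <= b -> u - d < x -> y < u + d -> U x y) ->
  U a b.
Proof.
move=> ab Utr Uloc.
apply: (@real_induction a b (U a)) => //.
- by have [d d0 H] := Uloc a (lexx _) ab; apply: H; lra.
- move=> x ax xb Ux; have [d d0 H] := Uloc x ax (ltW xb).
  exists d => // y xy yd yb; apply: (Utr _ x) => //; [lra|apply: H; lra].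
- move=> x ax xb H; have [d d0 K] := Uloc x (ltW ax) xb.
  pose y := Num.max a (x - d / 2).
  have yx : y < x by rewrite gt_max; apply/andP; split; lra.
  have ay : a <= y by rewrite le_max lexx.
  have dy : x - d / 2 <= y by rewrite le_max lexx orbT.
  apply: (Utr _ y) => //; [lra|exact: H|apply: K; lra].
Qed.

Lemma within_continuousP (V : normedModType R) (A : set R) (f : R -> V) :
  {within A, continuous f} -> forall x, A x -> forall e, 0 < e ->
  exists2 d, 0 < d & forall y, A y -> `|y - x| < d -> `|f y - f x| < e.
Proof.
move=> cf x Ax e e0.
have /cvgrPdist_lt/(_ e e0)[d /= d0 H] := (subspace_continuousP A f).1 cf x Ax.
exists d => // y Ay yx; rewrite distrC; apply: H => //.
by rewrite /ball/= distrC.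
Qed.

(** With the slope enlarged to [M + e], the bound on the increment from [a] propagates to the right
    of a point by the one-sided estimate, and passes to left limits by continuity, so real induction
    applies; then [e] tends to 0. *)
Lemma right_mean_value (V : normedModType R) (xi : R -> V) a b M : a <= b ->
  (forall x, a <= x -> x <= b -> forall e, 0 < e -> exists2 d, 0 < d &
    forall y, a <= y -> y <= b -> `|y - x| < d -> `|xi y - xi x| < e) ->
  (forall x, a <= x -> x < b -> forall e, 0 < e -> exists2 d, 0 < d &
    forall h, 0 < h -> h < d -> x + h <= b -> `|xi (x + h) - xi x| <= (M + e) * h) ->
  `|xi b - xi a| <= M * (b - a).
Proof.
move=> ab cxi dxi; apply/ler_addgt0Pr => e0 e0_gt0.
pose e := e0 / (b - a + 1).
have e_gt0 : 0 < e by rewrite divr_gt0//; lra.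
have : `|xi b - xi a| <= (M + e) * (b - a).
  apply: (@real_induction a b (fun x => `|xi x - xi a| <= (M + e) * (x - a))) => //.
  - by rewrite !subrr normr0 mulr0.
  - move=> x ax xb Hx; have [d d0 Hd] := dxi x ax xb e e_gt0.
    exists d => // y xy yd yb; have := Hd (y - x) ltac:(lra) ltac:(lra) ltac:(lra).
    rewrite (addrC x) subrK => K.
    have -> : xi y - xi a = (xi y - xi x) + (xi x - xi a) by rewrite addrA subrK.
    by apply: le_trans (ler_normD _ _) _; lra.
  - move=> x ax xb H; apply/ler_addgt0Pr => e' e'0.
    (* The sign of [M + e] is unknown; [q] is a positive bound for its absolute value. *)
    pose q := `|M + e| + 1.
    have q0 : 0 < q by have := normr_ge0 (M + e); rewrite /q; lra.
    have [d d0 Hd] := cxi x (ltW ax) xb (e' / 2) ltac:(lra).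
    pose y := Num.max a (Num.max (x - d / 2) (x - e' / 2 / q)).
    have p0 : 0 < e' / 2 / q by rewrite divr_gt0//; lra.
    have yx : y < x by rewrite !gt_max; do !(apply/andP; split); lra.
    have ay : a <= y by rewrite le_max lexx.
    have dy : x - d / 2 <= y by rewrite !le_max lexx !orbT.
    have qy : x - e' / 2 / q <= y by rewrite !le_max lexx !orbT.
    have /= Ky := H y ay yx.
    have := Hd y ay ltac:(lra); rewrite distrC gtr0_norm; last by lra.
    move=> /(_ ltac:(lra)); rewrite distrC => Kx.
    have -> : xi x - xi a = (xi x - xi y) + (xi y - xi a) by rewrite addrA subrK.
    apply: le_trans (ler_normD _ _) _.
    have : (M + e) * (y - x) <= e' / 2.
      have : `|M + e| * (x - y) <= q * (e' / 2 / q).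
        by apply: ler_pM => //; [lra|rewrite /q; lra|lra].
      rewrite mulrCA divff ?mulr1; last by rewrite gt_eqF.
      apply: le_trans; rewrite -[X in X <= _]opprK -mulrN opprB.
      by rewrite lerNl -mulNr ler_wpM2r//; [lra|rewrite lerNl -normrN ler_norm].
    by lra.
move=> /le_trans; apply; rewrite mulrDl lerD2l /e.
rewrite -mulrA ger_pMr// mulrC ler_pdivrMr; lra.
Qed.

End RealInduction.

(** * Convergence in probability as a filter *)

Section InProbability.
Context {R : realType} {d : measure_display} {Omega : measurableType d}.
Variable P : probability Omega R.

(* The filter of properties of [(i, w)] that hold, as [i] follows [F], off an
   event of arbitrarily small probability; the exceptional event may depend on
   [i]. *)
Definition inprob {I : Type} (F : set_system I) : set_system (I * Omega) :=
  [set Phi | forall Dl : R, 0 < Dl -> \forall i \near F,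
     exists2 B, measurable B /\ (P B <= Dl%:E)%E & forall w, ~ B w -> Phi (i, w)].

#[global] Instance inprob_filter {I : Type} (F : set_system I) {FF : Filter F} :
  Filter (inprob F).
Proof.
split.
- move=> Dl Dl0; apply: nearW => i; exists set0 => //.
  by split => //; rewrite measure0 lee_fin ltW.
- move=> Phi Psi HPhi HPsi Dl Dl0.
  have Dl2 : 0 < Dl / 2 by rewrite divr_gt0.
  apply: filterS2 (HPhi _ Dl2) (HPsi _ Dl2) => i [B [mB PB] HB] [C [mC PC] HC].
  exists (B `|` C); last first.
    by move=> w /not_orP[nB nC]; split; [exact: HB|exact: HC].
  split; first exact: measurableU.
  apply: le_trans (measureU2 _ _ _) _ => //.
  by rewrite [X in (_ <= X%:E)%E](splitr Dl) EFinD leeD.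
- move=> Phi Psi PP HPhi Dl Dl0; apply: filterS (HPhi _ Dl0) => i [B mB HB].
  by exists B => // w /HB/PP.
Qed.

Lemma inprobS {I : Type} (F : set_system I) {FF : Filter F}
    (Phi Psi : set (I * Omega)) :
  (forall p, Phi p -> Psi p) -> inprob F Phi -> inprob F Psi.
Proof. by move=> H; exact: (@filterS _ _ (@inprob_filter I F FF) Phi Psi H). Qed.

Lemma inprobS2 {I : Type} (F : set_system I) {FF : Filter F}
    (Phi Psi Chi : set (I * Omega)) :
  (forall p, Phi p -> Psi p -> Chi p) -> inprob F Phi -> inprob F Psi -> inprob F Chi.
Proof.
move=> H HPhi HPsi.
apply: inprobS (@filterI _ _ (@inprob_filter I F FF) _ _ HPhi HPsi) => p [].
exact: H.
Qed.

Lemma inprobS3 {I : Type} (F : set_system I) {FF : Filter F}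
    (Phi Psi Chi Xi : set (I * Omega)) :
  (forall p, Phi p -> Psi p -> Chi p -> Xi p) ->
  inprob F Phi -> inprob F Psi -> inprob F Chi -> inprob F Xi.
Proof.
move=> H HPhi HPsi HChi.
apply: (@inprobS2 _ _ _ [set p | Phi p /\ Psi p] Chi) => //.
  by move=> p [hPhi hPsi]; exact: H.
by apply: inprobS2 HPhi HPsi => p.
Qed.

Lemma inprobI {I : Type} (F : set_system I) {FF : Filter F}
    (Phi Psi : set (I * Omega)) :
  inprob F Phi -> inprob F Psi -> inprob F [set p | Phi p /\ Psi p].
Proof. exact: inprobS2. Qed.

Lemma inprob_as {I : Type} (F : set_system I) {FF : Filter F} (N : set Omega)
    (Phi : set (I * Omega)) : measurable N -> P N = 0%E ->
  (forall i w, ~ N w -> Phi (i, w)) -> inprob F Phi.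
Proof.
move=> mN PN H Dl Dl0; apply: nearW => i; exists N; last exact: H.
by rewrite PN lee_fin ltW.
Qed.

Lemma inprob_det {I : Type} (F : set_system I) {FF : Filter F}
    (Phi : set (I * Omega)) :
  (\forall i \near F, forall w, Phi (i, w)) -> inprob F Phi.
Proof.
move=> H Dl Dl0; apply: filterS H => i Hi; exists set0 => //.
by split => //; rewrite measure0 lee_fin ltW.
Qed.

(** An exceptional event of probability at most 1/2 is not the whole space. This extracts one good
    path when a deterministic conclusion is wanted. *)
Lemma inprob_ex {I : Type} (F : set_system I) {FF : ProperFilter F}
    (Phi : set (I * Omega)) : inprob F Phi -> exists i w, Phi (i, w).
Proof.
move=> /(_ (1/2) ltac:(lra))/filter_ex[i [B [mB PB] HB]].
exists i; apply: contrapT => nex.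
have BT : B = setT.
  by apply/seteqP; split => // w _; apply: contrapT => nB; apply: nex; exists w; exact: HB.
by move: PB; rewrite BT probability_setT lee_fin; lra.
Qed.

Lemma inprob_comp {I I' : Type} (F : set_system I) {FF : Filter F}
    (F' : set_system I') (n : I -> I') (Phi : set (I' * Omega)) :
  n @ F --> F' -> inprob F' Phi -> inprob F [set p | Phi (n p.1, p.2)].
Proof. by move=> nF H Dl Dl0; have := nF _ (H _ Dl0). Qed.

Lemma inprob_fin {I : Type} (F : set_system I) {FF : Filter F} (K : finType)
    (Phi : K -> set (I * Omega)) : (forall k, inprob F (Phi k)) ->
  inprob F [set p | forall k, Phi k p].
Proof.
move=> H; suff K' (s : seq K) : inprob F [set p | forall k, k \in s -> Phi k p].
  by apply: inprobS (K' (enum K)) => p /= Hp k; apply: Hp; rewrite mem_enum.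
elim: s => [|k s IH].
  by apply: inprob_det; apply: nearW => i w k; rewrite in_nil.
apply: inprobS2 (H k) IH => p /= Hk Hs j; rewrite in_cons => /predU1P[->//|].
exact: Hs.
Qed.

Lemma prob_bigcup0 (B : nat -> set Omega) : (forall k, measurable (B k)) ->
  (forall k, P (B k) = 0%E) -> P (\bigcup_k B k) = 0%E.
Proof.
move=> mB B0; apply/eqP; rewrite eq_le measure_ge0 andbT.
apply: le_trans (measure_sigma_subadditive _ _ _ (@subset_refl _ _)) _ => //.
  exact: bigcup_measurable.
by rewrite eseries0// => k _ _; exact: B0.
Qed.

Lemma prob_sub0 (A B : set Omega) : measurable A -> measurable B -> A `<=` B ->
  P B = 0%E -> P A = 0%E.
Proof.
move=> mA mB AB B0; apply/eqP; rewrite eq_le measure_ge0 andbT -B0.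
by apply: le_measure; rewrite ?inE.
Qed.

(** A class closed under sums and products, on which the real-valued expectation [Ex] is linear and
    monotone without further integrability conditions. *)
Definition bdmeas (f : Omega -> R) :=
  measurable_fun setT f /\ exists C, forall w, `|f w| <= C.

Definition Ex (f : Omega -> R) : R := fine (\int[P]_w (f w)%:E)%E.

Lemma bdmeas_integrable f : bdmeas f -> P.-integrable setT (EFin \o f).
Proof.
move=> [mf [C fC]]; apply: measurable_bounded_integrable => //.
  exact: le_lt_trans (probability_le1 P measurableT) (ltry 1).
exists C; split; first by rewrite num_real.
by move=> M CM w _ /=; rewrite (le_trans (fC w))// ltW.
Qed.

Lemma bdmeasD f g : bdmeas f -> bdmeas g -> bdmeas (fun w => f w + g w).
Proof.
move=> [mf [C fC]] [mg [D gD]]; split; first exact: measurable_funD.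
by exists (C + D) => w; rewrite (le_trans (ler_normD _ _))// lerD.
Qed.

Lemma bdmeasM f g : bdmeas f -> bdmeas g -> bdmeas (fun w => f w * g w).
Proof.
move=> [mf [C fC]] [mg [D gD]]; split; first exact: measurable_funM.
by exists (C * D) => w; rewrite normrM ler_pM.
Qed.

Lemma bdmeas_cst c : bdmeas (fun=> c).
Proof. by split; [exact: measurable_cst|exists `|c|]. Qed.

Lemma bdmeas_indic (A : set Omega) : measurable A -> bdmeas (\1_A).
Proof.
move=> mA; split; first exact: measurable_indic.
by exists 1 => w; rewrite indicE; case: (_ \in _); rewrite ?normr1 ?normr0.
Qed.

Lemma bdmeas_sum n (f : nat -> Omega -> R) : (forall k, bdmeas (f k)) ->
  bdmeas (fun w => \sum_(k < n) f k w).
Proof.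
move=> H; elim: n => [|n IH].
  by under [X in bdmeas X]eq_fun do rewrite big_ord0; exact: bdmeas_cst.
by under [X in bdmeas X]eq_fun do rewrite big_ord_recr/=; exact: bdmeasD.
Qed.

Lemma ExD f g : bdmeas f -> bdmeas g -> Ex (fun w => f w + g w) = Ex f + Ex g.
Proof.
move=> bf bg; apply: (@RintegralD _ _ _ P setT f g) => //; exact: bdmeas_integrable.
Qed.

Lemma ExZ c f : bdmeas f -> Ex (fun w => c * f w) = c * Ex f.
Proof. by move=> bf; apply: (@RintegralZl _ _ _ P setT f c) => //; exact: bdmeas_integrable. Qed.

Lemma bdmeas_bigsum (K : Type) (r : seq K) (f : K -> Omega -> R) :
  (forall k, bdmeas (f k)) -> bdmeas (fun w => \sum_(k <- r) f k w).
Proof.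
move=> H; elim: r => [|k r IH].
  by under [X in bdmeas X]eq_fun do rewrite big_nil; exact: bdmeas_cst.
by under [X in bdmeas X]eq_fun do rewrite big_cons; exact: bdmeasD.
Qed.

Lemma Ex_cst c : Ex (fun=> c) = c.
Proof. by rewrite /Ex integral_cst//= probability_setT mule1. Qed.

Lemma Ex_bigsum (K : Type) (r : seq K) (f : K -> Omega -> R) :
  (forall k, bdmeas (f k)) ->
  Ex (fun w => \sum_(k <- r) f k w) = \sum_(k <- r) Ex (f k).
Proof.
move=> H; elim: r => [|k r IH].
  by under [X in Ex X]eq_fun do rewrite big_nil; rewrite big_nil Ex_cst.
under [X in Ex X]eq_fun do rewrite big_cons.
by rewrite big_cons ExD ?IH//; exact: bdmeas_bigsum.
Qed.

Lemma Ex_le f g : bdmeas f -> bdmeas g -> (forall w, f w <= g w) -> Ex f <= Ex g.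
Proof.
move=> bf bg fg; apply: fine_le; try exact: integrable_fin_num (bdmeas_integrable _).
by apply: le_integral => //; [exact: bdmeas_integrable..|move=> w _; rewrite lee_fin].
Qed.

Lemma Ex_indic A : measurable A -> Ex (\1_A) = fine (P A).
Proof. by move=> mA; rewrite /Ex integral_indic// setIT. Qed.

Lemma Ex_markov f a : bdmeas f -> (forall w, 0 <= f w) -> 0 < a ->
  measurable [set w | a <= f w] /\ (P [set w | (a <= f w)%R] <= (Ex f / a)%:E)%E.
Proof.
move=> bf f0 a0.
have mA : measurable [set w | a <= f w].
  rewrite (_ : [set _ | _] = setT `&` f @^-1` `[a, +oo[).
    by apply: (proj1 bf) => //; exact: measurable_itv.
  by apply/seteqP; split => w /=; rewrite in_itv/= andbT ?setTI//; case.
split => //; rewrite -(@fineK _ (P _)) ?fin_num_measure// lee_fin -Ex_indic//.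
rewrite mulrC -ExZ//; apply: Ex_le; [exact: bdmeas_indic| |].
  by apply: bdmeasM => //; exact: bdmeas_cst.
move=> w; rewrite indicE; case: (boolP (_ \in _)) => /=.
  by rewrite inE/= => H; rewrite mulrC ler_pdivlMr// mul1r.
by rewrite mulr_ge0// invr_ge0 ltW.
Qed.

End InProbability.

(** * The weak law of large numbers for Markov renewal processes *)

Section WeakLaw.
Context {R : realType} {d : measure_display} {Omega : measurableType d}
        {X : finType}.
Variables (P : probability Omega R) (x : nat -> Omega -> X) (T : nat -> Omega -> R)
          (Q : X -> X -> R -> R).
Hypothesis mr : markov_renewal x T P Q.

Let mx n a : measurable (x n @^-1` [set a]).
Proof. by case: mr. Qed.

Let mT n : measurable_fun setT (T n).
Proof. by case: mr. Qed.

Definition step_ev n z y (t : R) : set Omega :=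
  [set w | x n w = z /\ (x n.+1 w = y /\ T n.+1 w - T n w <= t)].

Lemma past_sigma_measurable n A : past_sigma x T n A -> measurable A.
Proof.
apply: smallest_sub; first exact: sigma_algebra_measurable.
move=> B [[k [a [_ ->]]]|[k [b [_ ->]]]]; first exact: mx.
rewrite (_ : [set _ | _] = setT `&` T k @^-1` `]-oo, b]).
  by apply: mT => //; exact: measurable_itv.
by apply/seteqP; split => w /=; rewrite in_itv/= ?setTI//; case.
Qed.

Lemma past_sigmaI n A B : past_sigma x T n A -> past_sigma x T n B ->
  past_sigma x T n (A `&` B).
Proof.
move=> mA mB.
exact: (@measurableI _ (g_sigma_algebraType (
  [set A | exists k a, (k <= n)%N /\ A = x k @^-1` [set a]] `|`
      [set A | exists k (b : R), (k <= n)%N /\ A = [set w | T k w <= b]]))).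
Qed.

Lemma past_sigma_x n k a : (k <= n)%N -> past_sigma x T n (x k @^-1` [set a]).
Proof. by move=> kn; apply: sub_gen_smallest; left; exists k, a. Qed.

Lemma past_sigma_step n k z y (t : R) : (k < n)%N -> past_sigma x T n (step_ev k z y t).
Proof.
move=> kn.
rewrite (_ : step_ev k z y t = x k @^-1` [set z] `&` (x k.+1 @^-1` [set y] `&`
   [set w | T k.+1 w - T k w <= t])); last by apply/seteqP; split.
apply: past_sigmaI; first by apply: past_sigma_x; exact: ltnW.
apply: past_sigmaI; first exact: past_sigma_x.
set Gn := ([set A | exists k a, (k <= n)%N /\ A = x k @^-1` [set a]] `|`
      [set A | exists k (b : R), (k <= n)%N /\ A = [set w | T k w <= b]]).
have mTk j : (j <= n)%N ->
    @measurable_fun _ _ (g_sigma_algebraType Gn) R setT (T j).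
  move=> jn.
  apply: (@measurability _ _ (g_sigma_algebraType Gn) _ _ _ (@RGenOInfty.G R)).
    exact: RGenOInfty.measurableE.
  move=> _ [_ [b ->] <-].
  rewrite setTI (_ : T j @^-1` `]b, +oo[%classic = ~` [set w | T j w <= b]); last first.
    by apply/seteqP; split => w /=; rewrite in_itv/= andbT ltNge => /negP.
  apply: measurableC; apply: sub_sigma_algebra; right.
  by exists j, b.
have mB : @measurable_fun _ _ (g_sigma_algebraType Gn) R setT
    (fun w => T k.+1 w - T k w).
  by apply: measurable_funB; apply: mTk => //; exact: ltnW.
rewrite (_ : [set _ | _] = setT `&`
  (fun w => T k.+1 w - T k w) @^-1` `]-oo, t]); last first.
  by apply/seteqP; split => w /=; rewrite in_itv/= ?setTI//; case.
by apply: mB => //; exact: measurable_itv.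
Qed.

Lemma step_ev_measurable k z y t : measurable (step_ev k z y t).
Proof. exact: past_sigma_measurable (past_sigma_step z y t (ltnSn k)). Qed.

(** On [A] intersected with [x n = z], itself an event of the past, the integrand of the renewal
    property is the constant [Q z y t]. *)
Lemma prob_step n z y t A : past_sigma x T n A ->
  P (A `&` step_ev n z y t) = ((Q z y t)%:E * P (A `&` x n @^-1` [set z]))%E.
Proof.
move=> pA; have pAx : past_sigma x T n (A `&` x n @^-1` [set z]).
  by apply: past_sigmaI => //; exact: past_sigma_x.
case: mr => _ _ _ _ /(_ n y t _ pAx).
rewrite (_ : _ `&` _ = A `&` step_ev n z y t); last first.
  by rewrite -setIA; congr (_ `&` _); apply/seteqP; split => w /=.
move=> ->; rewrite (eq_integral (cst (Q z y t)%:E)).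
  by rewrite integral_cst//; exact: past_sigma_measurable pAx.
by move=> w; rewrite inE => -[_ /= ->].
Qed.

(** The martingale difference of the count of transitions from [z] to [y] of duration at most
    [t]. *)
Definition mdiff z y (t : R) k (w : Omega) : R :=
  \1_(step_ev k z y t) w - Q z y t * \1_(x k @^-1` [set z]) w.

Let bd_step k z y t : bdmeas (\1_(step_ev k z y t) : Omega -> R).
Proof. exact/bdmeas_indic/step_ev_measurable. Qed.

Let bd_x k z : bdmeas (\1_(x k @^-1` [set z]) : Omega -> R).
Proof. exact/bdmeas_indic. Qed.

Lemma bdmeas_mdiff z y t k : bdmeas (mdiff z y t k).
Proof.
rewrite (_ : mdiff z y t k = (fun w => \1_(step_ev k z y t) w +
  - Q z y t * \1_(x k @^-1` [set z]) w)); last by apply/funext => w; rewrite mulNr.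
by apply: bdmeasD => //; apply: bdmeasM => //; exact: bdmeas_cst.
Qed.

Lemma mdiff_orth z y t n A : past_sigma x T n A ->
  Ex P (fun w => \1_A w * mdiff z y t n w) = 0.
Proof.
move=> pA; have mA := past_sigma_measurable pA.
rewrite (_ : (fun _ => _) = (fun w => \1_(A `&` step_ev n z y t) w +
  - Q z y t * \1_(A `&` x n @^-1` [set z]) w)); last first.
  apply/funext => w.
  have E B : \1_(A `&` B) w = \1_A w * \1_B w :> R by rewrite indicI.
  by rewrite !E /mdiff; ring.
have mI1 : measurable (A `&` step_ev n z y t) by apply: measurableI => //; exact: step_ev_measurable.
have mI2 : measurable (A `&` x n @^-1` [set z]) by exact: measurableI.
rewrite ExD; [|exact: bdmeas_indic|by apply: bdmeasM; [exact: bdmeas_cst|exact: bdmeas_indic]].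
rewrite ExZ; last exact: bdmeas_indic.
rewrite !Ex_indic// prob_step// fineM ?fin_num_measure//=.
by rewrite mulNr subrr.
Qed.

(** The past sum is a linear combination of indicators of events of [past_sigma x T n], so
    orthogonality to such indicators suffices and no conditional expectation has to be formed. *)
Lemma mdiff_sum_orth z y t n m : (m <= n)%N ->
  Ex P (fun w => (\sum_(k < m) mdiff z y t k w) * mdiff z y t n w) = 0.
Proof.
elim: m => [|m IH] mn.
  rewrite (_ : (fun _ => _) = (fun=> 0)) ?Ex_cst//.
  by apply/funext => w; rewrite big_ord0 mul0r.
have bM := bdmeas_mdiff z y t.
have bS := bdmeas_sum m bM.
rewrite (_ : (fun _ => _) = (fun w =>
   (\sum_(k < m) mdiff z y t k w) * mdiff z y t n w +
   (\1_(step_ev m z y t) w * mdiff z y t n w +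
     - Q z y t * (\1_(x m @^-1` [set z]) w * mdiff z y t n w)))); last first.
  by apply/funext => w; rewrite big_ord_recr/= {2}/mdiff; ring.
rewrite ExD; [|exact: bdmeasM|]; last first.
  apply: bdmeasD; first exact: bdmeasM.
  by apply: bdmeasM; [exact: bdmeas_cst|exact: bdmeasM].
rewrite IH; last exact: ltnW.
rewrite ExD; [|exact: bdmeasM|by apply: bdmeasM; [exact: bdmeas_cst|exact: bdmeasM]].
rewrite ExZ; last exact: bdmeasM.
rewrite mdiff_orth; last exact: past_sigma_step.
by rewrite mdiff_orth ?mulr0 ?addr0//; apply: past_sigma_x; exact: ltnW.
Qed.

(** The cross terms vanish by orthogonality and each difference is bounded by [1 + |Q z y t|]; the
    second moment thus grows only linearly in [n]. *)
Lemma mdiff_second_moment z y t n :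
  Ex P (fun w => (\sum_(k < n) mdiff z y t k w) ^+ 2) <= n%:R * (1 + `|Q z y t|) ^+ 2.
Proof.
have bM := bdmeas_mdiff z y t.
elim: n => [|n IH].
  rewrite (_ : (fun _ => _) = (fun=> 0)) ?Ex_cst ?mul0r//.
  by apply/funext => w; rewrite big_ord0 expr0n.
have bS := bdmeas_sum n bM.
rewrite (_ : (fun _ => _) = (fun w => (\sum_(k < n) mdiff z y t k w) ^+ 2 +
   (2 * ((\sum_(k < n) mdiff z y t k w) * mdiff z y t n w) + mdiff z y t n w ^+ 2))); last first.
  by apply/funext => w; rewrite big_ord_recr/=; ring.
have bsq f : bdmeas f -> bdmeas (fun w : Omega => f w ^+ 2 : R).
  by move=> bf; under [X in bdmeas X]eq_fun do rewrite expr2; exact: bdmeasM.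
have b2 : bdmeas (fun w => 2 * ((\sum_(k < n) mdiff z y t k w) * mdiff z y t n w)).
  by apply: bdmeasM; [exact: bdmeas_cst|exact: bdmeasM].
rewrite ExD; [|exact: bsq|by apply: bdmeasD => //; exact: bsq].
rewrite ExD//; last exact: bsq.
rewrite ExZ; last exact: bdmeasM.
rewrite mdiff_sum_orth// mulr0 add0r -natr1 mulrDl mul1r lerD//.
rewrite -[leRHS](Ex_cst P); apply: Ex_le; [exact: bsq|exact: bdmeas_cst|].
move=> w; rewrite -real_normK ?num_real//; apply: lerXn2r; rewrite ?nnegrE ?addr_ge0//.
rewrite /mdiff (le_trans (ler_normB _ _))// lerD//.
  by rewrite indicE; case: (_ \in _); rewrite ?normr1 ?normr0.
by rewrite normrM ler_piMr// indicE; case: (_ \in _); rewrite ?normr1 ?normr0.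
Qed.

Definition step_count n z y t w : R := \sum_(k < n) \1_(step_ev k z y t) w.
Definition visits n z w : R := \sum_(k < n) \1_(x k @^-1` [set z]) w.

Lemma weak_law_step z y t (dl : R) : 0 < dl -> inprob P \oo
  [set p | `|step_count p.1 z y t p.2 - Q z y t * visits p.1 z p.2| <= dl * p.1%:R].
Proof.
move=> dl0 Dl Dl0.
pose c : R := (1 + `|Q z y t|) ^+ 2.
(* From this [n] on, the Chebyshev bound [n * c / (dl * n) ^+ 2] is at most [Dl]. *)
pose N := (Num.truncn (c / (dl ^+ 2 * Dl))).+1.
exists N => // n /= Nn.
have n0 : (0 < n)%N by apply: leq_trans Nn.
have n0R : 0 < n%:R :> R by rewrite ltr0n.
have bM := bdmeas_mdiff z y t.
have bS := bdmeas_sum n bM.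
have a0 : 0 < (dl * n%:R) ^+ 2 by rewrite exprn_gt0// mulr_gt0.
have bS2 : bdmeas (fun w => (\sum_(k < n) mdiff z y t k w) ^+ 2).
  by under [X in bdmeas X]eq_fun do rewrite expr2; exact: bdmeasM.
have [mB PB] := Ex_markov P bS2 (fun w => sqr_ge0 _) a0.
exists [set w | (dl * n%:R) ^+ 2 <= (\sum_(k < n) mdiff z y t k w) ^+ 2].
  split => //; apply: (le_trans PB); rewrite lee_fin ler_pdivrMr//.
  apply: (le_trans (mdiff_second_moment z y t n)); rewrite -/c.
  rewrite (_ : Dl * _ = n%:R * (n%:R * (dl ^+ 2 * Dl))); last by ring.
  rewrite ler_wpM2l// -ler_pdivrMr ?mulr_gt0 ?exprn_gt0//.
  by apply: ltW; apply: (lt_le_trans (truncnS_gt _)); rewrite -/N ler_nat.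
move=> w /= /negP; rewrite -ltNge => H.
have -> : step_count n z y t w - Q z y t * visits n z w = \sum_(k < n) mdiff z y t k w.
  by rewrite /step_count /visits mulr_sumr -sumrB.
rewrite -real_normK ?num_real// in H.
by apply: ltW; move: H; rewrite ltr_pXn2r// nnegrE mulr_ge0// ltW.
Qed.

End WeakLaw.

(** * Limits of $S_n/n$ in probability *)

Section Law.
Context {R : realType} {d : measure_display} {Omega : measurableType d}.
Variable P : probability Omega R.

Definition wlaw (S : nat -> Omega -> R) (c : R) := forall dl : R, 0 < dl ->
  inprob P \oo [set p | `|S p.1 p.2 - c * p.1%:R| <= dl * p.1%:R].

Lemma wlaw_cst0 : wlaw (fun _ _ => 0) 0.
Proof.
move=> dl dl0; apply: inprob_det; apply: nearW => n w /=.
by rewrite mul0r subrr normr0 mulr_ge0// ltW.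
Qed.

Lemma wlawD S1 S2 c1 c2 : wlaw S1 c1 -> wlaw S2 c2 ->
  wlaw (fun n w => S1 n w + S2 n w) (c1 + c2).
Proof.
move=> H1 H2 dl dl0; have d2 : 0 < dl / 2 by rewrite divr_gt0.
apply: inprobS2 (H1 _ d2) (H2 _ d2) => -[n w] /= h1 h2.
rewrite (_ : _ - _ = (S1 n w - c1 * n%:R) + (S2 n w - c2 * n%:R)); last by ring.
by apply: le_trans (ler_normD _ _) _; lra.
Qed.

Lemma wlawZ a S c : wlaw S c -> wlaw (fun n w => a * S n w) (a * c).
Proof.
move=> H dl dl0; have q0 : 0 < `|a| + 1 by rewrite ltr_pwDr.
have d2 : 0 < dl / (`|a| + 1) by rewrite divr_gt0.
apply: inprobS (H _ d2) => -[n w] /= h.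
rewrite (_ : _ - _ = a * (S n w - c * n%:R)); last by ring.
rewrite normrM; apply: le_trans (ler_wpM2l (normr_ge0 a) h) _.
rewrite mulrA ler_wpM2r// mulrCA ger_pMr// ler_pdivrMr//.
by rewrite mul1r lerDl.
Qed.

Lemma wlaw_sum (K : Type) (r : seq K) (S : K -> nat -> Omega -> R) (c : K -> R) :
  (forall k, wlaw (S k) (c k)) ->
  wlaw (fun n w => \sum_(k <- r) S k n w) (\sum_(k <- r) c k).
Proof.
move=> H; elim: r => [|k r IH].
  rewrite big_nil (_ : (fun _ _ => _) = (fun _ _ => 0)); first exact: wlaw_cst0.
  by apply/funext => n; apply/funext => w; rewrite big_nil.
rewrite big_cons (_ : (fun _ _ => _) = (fun n w => S k n w + \sum_(k <- r) S k n w)).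
  exact: wlawD.
by apply/funext => n; apply/funext => w; rewrite big_cons.
Qed.

(** Meant for functionals that are not finite combinations of counts, but lie between two such
    combinations with nearly equal limits. *)
Lemma wlaw_squeeze S c :
  (forall dl : R, 0 < dl -> exists S1 S2 c1 c2, [/\ wlaw S1 c1, wlaw S2 c2,
     c - dl <= c1, c2 <= c + dl & inprob P \oo
       [set p | S1 p.1 p.2 <= S p.1 p.2 <= S2 p.1 p.2]]) -> wlaw S c.
Proof.
move=> H dl dl0; have d2 : 0 < dl / 2 by rewrite divr_gt0.
have [S1 [S2 [c1 [c2 [H1 H2 hc1 hc2 H12]]]]] := H _ d2.
apply: inprobS3 H12 (H1 _ d2) (H2 _ d2).
move=> -[n w] /= /andP[h1 h2]; rewrite !ler_norml => /andP[a1 a2] /andP[b1 b2].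
have n0 : 0 <= n%:R :> R by [].
have k1 : (c - dl / 2) * n%:R <= c1 * n%:R by rewrite ler_wpM2r.
have k2 : c2 * n%:R <= (c + dl / 2) * n%:R by rewrite ler_wpM2r.
by apply/andP; split; lra.
Qed.

Lemma wlaw_as S S' c (N : set Omega) : measurable N -> P N = 0%E ->
  (forall n w, ~ N w -> S' n w = S n w) -> wlaw S c -> wlaw S' c.
Proof.
move=> mN PN E H dl dl0.
have E' : inprob P \oo [set p | S' p.1 p.2 = S p.1 p.2] by exact: (inprob_as mN PN).
by apply: inprobS2 E' (H _ dl0) => -[n w] /= ->.
Qed.

End Law.

(** * Almost invariant distributions of the embedded chain *)

Section Ergodic.
Context {R : realType} {X : finType}.
Variables (Q : X -> X -> R -> R) (rho : X -> R).
Hypothesis Pn_cvg : forall z y, Pn Q n z y @[n --> \oo] --> rho y.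

(* A probability vector that is almost invariant under [P] is almost invariant
   under [P^m], whose rows are all close to [rho]. *)
Lemma almost_invariant (ka : R) : 0 < ka -> exists2 dl, 0 < dl &
  forall v : X -> R, (forall z, 0 <= v z) -> \sum_z v z = 1 ->
  (forall y, `|v y - \sum_z v z * Pmat Q z y| <= dl) ->
  forall y, `|v y - rho y| <= ka.
Proof.
move=> ka0.
(* [K] bounds every column sum of [|Pmat|]; neither signs nor row sums of [Pmat] are available in
   this section. *)
pose K : R := \sum_y \sum_z `|Pmat Q z y|.
have K0 : 0 <= K by do 2![apply: sumr_ge0 => ? _].
have Ky y : \sum_z `|Pmat Q z y| <= K.
  rewrite /K [leRHS](bigD1 y)//= lerDl; apply: sumr_ge0 => ? _.
  exact: sumr_ge0.
have iter m : exists2 C, 0 <= C & forall (v : X -> R) (dl : R), 0 <= dl ->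
    (forall y, `|v y - \sum_z v z * Pmat Q z y| <= dl) ->
    forall y, `|v y - \sum_z v z * Pn Q m z y| <= C * dl.
  elim: m => [|m [C C0 IH]].
    exists 0 => // v dl dl0 _ y; rewrite (bigD1 y)//= eqxx mulr1 big1 ?addr0.
      by rewrite subrr normr0 mul0r.
    by move=> z /negPf -> /=; rewrite mulr0.
  exists (1 + C * K); first by rewrite addr_ge0// mulr_ge0.
  move=> v dl dl0 Hv y.
  (* With [v] as a row vector: $v - vP^{m+1} = (v - vP) + (v - vP^m)P$. *)
  rewrite (_ : _ - _ = (v y - \sum_z v z * Pmat Q z y) +
     \sum_z (v z - \sum_u v u * Pn Q m u z) * Pmat Q z y); last first.
    under [X in _ = _ + X]eq_bigr do rewrite mulrBl.
    rewrite sumrB addrA subrK; congr (_ - _) => /=.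
    under eq_bigr do rewrite mulr_sumr.
    rewrite exchange_big /=; apply: eq_bigr => z _; rewrite mulr_suml.
    by apply: eq_bigr => u _; rewrite mulrA.
  apply: le_trans (ler_normD _ _) _; rewrite mulrDl mul1r lerD//.
  apply: le_trans (ler_norm_sum _ _ _) _.
  apply: (@le_trans _ _ (\sum_z C * dl * `|Pmat Q z y|)).
    by apply: ler_sum => z _; rewrite normrM ler_wpM2r// IH.
  by rewrite -mulr_sumr mulrAC ler_wpM2r// ler_wpM2l.
have k2 : 0 < ka / 2 by rewrite divr_gt0.
have [m Hm] : exists m, forall z y, `|Pn Q m z y - rho y| <= ka / 2.
  suff [m _ /(_ m (leqnn m)) H] : \forall m \near \oo, forall p : X * X,
      `|Pn Q m p.1 p.2 - rho p.2| <= ka / 2.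
    by exists m => z y; exact: (H (z, y)).
  apply: filter_forall => -[z y] /=.
  by have /cvgrPdistC_le/(_ _ k2) := @Pn_cvg z y.
have [C C0 HC] := iter m.
have C1 : 0 < C + 1 by rewrite ltr_wpDl.
exists (ka / 2 / (C + 1)); first by rewrite divr_gt0.
move=> v v0 v1 Hv y.
have := HC v _ (ltW (divr_gt0 k2 C1)) Hv y.
have : `|\sum_z v z * Pn Q m z y - rho y| <= ka / 2.
  rewrite (_ : _ - _ = \sum_z v z * (Pn Q m z y - rho y)); last first.
    by under [RHS]eq_bigr do rewrite mulrBr; rewrite sumrB -mulr_suml v1 mul1r.
  apply: le_trans (ler_norm_sum _ _ _) _.
  apply: (@le_trans _ _ (\sum_z v z * (ka / 2))).
    by apply: ler_sum => z _; rewrite normrM ger0_norm// ler_wpM2l.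
  by rewrite -mulr_suml v1 mul1r.
have : C * (ka / 2 / (C + 1)) <= ka / 2.
  by rewrite mulrCA ger_pMr// ler_pdivrMr// mul1r lerDl.
move=> h1 h2 h3.
rewrite (_ : v y - rho y = (v y - \sum_z v z * Pn Q m z y) +
  (\sum_z v z * Pn Q m z y - rho y)); last by ring.
by apply: le_trans (ler_normD _ _) _; lra.
Qed.

End Ergodic.

(** * Layer sums of a number and Darboux sums of a monotone tail *)

Section Riemann.
Context {R : realType}.
Implicit Types th dl : R.

Lemma sum_shift (f : nat -> R) n :
  \sum_(k < n) f k.+1 = \sum_(k < n) f k + f n - f 0%N.
Proof.
elim: n => [|n IH]; first by rewrite !big_ord0 add0r subrr.
by rewrite !big_ord_recr/= IH; ring.
Qed.

Lemma layer_le I th dl : 0 <= th -> 0 <= dl ->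
  \sum_(i < I) dl * (dl * i.+1%:R < th)%R%:R <= th.
Proof.
move=> th0 dl0.
(* The second bound carries the induction: a new layer is added only when [dl * I.+1 < th], and then
   the number of layers, not [th], controls the sum. *)
suff /andP[] : (\sum_(i < I) dl * (dl * i.+1%:R < th)%R%:R <= th) &&
   (\sum_(i < I) dl * (dl * i.+1%:R < th)%R%:R <= dl * I%:R) by [].
elim: I => [|I /andP[IH1 IH2]]; first by rewrite big_ord0 mulr0 th0 lexx.
rewrite big_ord_recr/=; case: ltP => /= H; rewrite -natr1 in H *.
  by apply/andP; split; lra.
by rewrite mulr0 addr0 IH1/=; lra.
Qed.

Lemma layer_ge I th dl : 0 <= dl -> th <= dl * I%:R ->
  th <= \sum_(i < I) dl * (dl * i%:R < th)%R%:R.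
Proof.
move=> dl0; suff: Num.min th (dl * I%:R) <= \sum_(i < I) dl * (dl * i%:R < th)%R%:R.
  by move=> + H; rewrite min_l.
elim: I => [|I IH]; first by rewrite big_ord0 mulr0 ge_min lexx orbT.
rewrite big_ord_recr/=; case: ltP => /= H; rewrite -natr1.
  by rewrite min_r in IH; [rewrite ge_min; apply/orP; right; lra|exact: ltW].
by rewrite mulr0 addr0 ge_min; apply/orP; left; rewrite min_l in IH.
Qed.

(** Darboux sums of mesh [tau / I] for a nonincreasing function that vanishes from [tau] on: both
    sums are integrals of step functions that lie below and above [h], and monotonicity provides
    measurability. *)
Lemma riemann_bounds (h : R -> R) (tau : R) (I : nat) : 0 < tau -> (0 < I)%N ->
  (forall t t', t <= t' -> h t' <= h t) -> (forall t, tau <= t -> h t = 0) ->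
  forall dl m : R, dl = tau / I%:R ->
  m = fine (\int[@lebesgue_measure R]_(t in [set t : R | (0 <= t)%R]) (h t)%:E)%E ->
  \sum_(i < I) dl * h (dl * i.+1%:R) <= m <= \sum_(i < I) dl * h (dl * i%:R).
Proof.
move=> tau0 I0 hd ht dl m dlE mE.
have I0R : 0 < I%:R :> R by rewrite ltr0n.
have dl0 : 0 < dl by rewrite dlE divr_gt0.
have h0 t : 0 <= h t.
  have [/ht ->//|/ltW tt] := leP tau t.
  by rewrite (le_trans _ (hd _ _ tt))// ht.
pose A (i : nat) : set R := `[dl * i%:R, dl * i.+1%:R[%classic.
have mA i : measurable (A i) by exact: measurable_itv.
have muA i : lebesgue_measure (A i) = dl%:E.
  rewrite /A lebesgue_measure_itv/= lte_fin ltr_pM2l// ltr_nat ltnSn.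
  by rewrite -EFinB -mulrBr -natr1 addrAC subrr add0r mulr1.
set D := [set t : R | (0 <= t)%R].
have DE : D = `[0, +oo[%classic.
  by apply/seteqP; split => t /=; rewrite in_itv/= andbT.
have mD : measurable D by rewrite DE; exact: measurable_itv.
have AD i : A i `<=` D.
  by move=> t; rewrite /A /D/= in_itv/= => /andP[+ _]; apply: le_trans; rewrite mulr_ge0// ltW.
have step (c : nat -> R) : (forall i, 0 <= c i) ->
   (\int[lebesgue_measure]_(t in D) (\sum_(i < I) (c i) * \1_(A i) t)%:E =
    (\sum_(i < I) dl * c i)%:E)%E.
  move=> c0.
  under eq_integral do rewrite -sumEFin.
  rewrite ge0_integral_sum//=; first last.
  - by move=> i t _; rewrite lee_fin mulr_ge0// indicE.
  - move=> i; apply/measurable_EFinP; apply: measurable_funM => //.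
    by apply: measurable_indic; exact: mA.
  rewrite -sumEFin; apply: eq_bigr => i _.
  under eq_integral do rewrite EFinM.
  rewrite ge0_integralZl//=; first last.
  - by rewrite lee_fin.
  - by apply/measurable_EFinP; apply: measurable_indic; exact: mA.
  have -> : (\int[lebesgue_measure]_(t in D) (\1_(A i) t)%:E = dl%:E)%E.
    rewrite integral_indic; [|by []|exact: mA].
    by rewrite -(muA i); congr (lebesgue_measure _); apply/setIidl/AD.
  by rewrite -EFinM mulrC.
have mh : measurable_fun D h.
  by apply: nonincreasing_measurable => // a b; exact: hd.
have at1 (c : nat -> R) t i : (i < I)%N -> A i t ->
    \sum_(j < I) c j * \1_(A j) t = c i.
  move=> iI Ait; rewrite (bigD1 (Ordinal iI))//= indicE mem_set// mulr1 big1 ?addr0//.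
  move=> j ji; rewrite indicE memNset ?mulr0//.
  move=> Ajt; move: ji; apply/negP; rewrite negbK; apply/eqP/val_inj => /=.
  move: Ait Ajt; rewrite /A/= !in_itv/= => /andP[a1 a2] /andP[b1 b2].
  have := le_lt_trans a1 b2; have := le_lt_trans b1 a2.
  rewrite !ltr_pM2l// !ltr_nat => c1 c2.
  by apply/eqP; rewrite eqn_leq -ltnS c1 -ltnS c2.
have at0 (c : nat -> R) t : tau <= t -> \sum_(j < I) c j * \1_(A j) t = 0.
  move=> tt; rewrite big1// => j _; rewrite indicE memNset ?mulr0//.
  rewrite /A/= in_itv/= => /andP[_]; apply/negP; rewrite -leNgt (le_trans _ tt)//.
  by rewrite dlE mulrAC ler_pdivrMr// ler_pM2l// ler_nat.
have loc t : D t -> t < tau -> exists2 i, (i < I)%N & A i t.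
  move=> t0 tt; have td0 : 0 <= t / dl by rewrite divr_ge0// ltW.
  have /andP[a1 a2] := truncn_itv td0.
  exists (Num.truncn (t / dl)).
    rewrite -(ltr_nat R); apply: le_lt_trans a1 _; rewrite ltr_pdivrMr//.
    by rewrite dlE mulrC divfK// gt_eqF.
  rewrite /A/= in_itv/=; apply/andP; split.
    by rewrite mulrC -ler_pdivlMr.
  by rewrite mulrC -ltr_pdivrMr.
have mS (c : nat -> R) : measurable_fun D (fun t => \sum_(i < I) c i * \1_(A i) t).
  apply: measurable_sum => i.
  apply: (@measurable_funM _ _ _ D (fun=> c i) (\1_(A i))).
    exact: measurable_cst.
  exact: (measurable_indic (mA i)).
have low : ((\sum_(i < I) dl * h (dl * i.+1%:R))%:E <=
    \int[lebesgue_measure]_(t in D) (h t)%:E)%E.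
  rewrite -(step (fun i => h (dl * i.+1%:R)))//.
  apply: ge0_le_integral => //.
  - by move=> t _; rewrite lee_fin; apply: sumr_ge0 => i _; rewrite mulr_ge0// indicE.
  - apply/measurable_EFinP; exact: (mS (fun i => h (dl * i.+1%:R))).
  - exact/measurable_EFinP.
  move=> t Dt; rewrite lee_fin; have [Tt|tt] := leP tau t.
    by rewrite (at0 (fun i => h (dl * i.+1%:R))).
  have [i iI Ai] := loc t Dt tt; rewrite (at1 (fun i => h (dl * i.+1%:R)) t i)//.
  by apply: hd; move: Ai; rewrite /A/= in_itv/= => /andP[_ /ltW].
have upp : (\int[lebesgue_measure]_(t in D) (h t)%:E <=
    (\sum_(i < I) dl * h (dl * i%:R))%:E)%E.
  rewrite -(step (fun i => h (dl * i%:R)))//.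
  apply: ge0_le_integral => //.
  - by move=> t _; rewrite lee_fin.
  - exact/measurable_EFinP.
  - apply/measurable_EFinP; exact: (mS (fun i => h (dl * i%:R))).
  move=> t Dt; rewrite lee_fin; have [Tt|tt] := leP tau t.
    by rewrite (at0 (fun i => h (dl * i%:R)))// ht.
  have [i iI Ai] := loc t Dt tt; rewrite (at1 (fun i => h (dl * i%:R)) t i)//.
  by apply: hd; move: Ai; rewrite /A/= in_itv/= => /andP[].
(* The upper step function has a finite integral, so [fine] loses nothing in the definition of
   [m]. *)
have fin : (\int[lebesgue_measure]_(t in D) (h t)%:E)%E \is a fin_num.
  rewrite ge0_fin_numE; first exact: le_lt_trans upp (ltry _).
  by apply: integral_ge0 => t _; rewrite lee_fin.
by rewrite mE -!lee_fin fineK// low upp.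
Qed.

End Riemann.

(** * Laws of large numbers for visits, transitions, occupation times and jump times *)

Section RenewalLaws.
Context {R : realType} {d : measure_display} {Omega : measurableType d}
        {X : finType}.
Variables (P : probability Omega R) (x : nat -> Omega -> X) (T : nat -> Omega -> R)
          (Q : X -> X -> R -> R) (rho : X -> R) (tau : R).
Hypothesis mr : markov_renewal x T P Q.
Hypothesis rho1 : \sum_(z : X) rho z = 1.
Hypothesis rho_ge0 : forall z, 0 <= rho z.
Hypothesis Pn_cvg : forall z y, Pn Q n z y @[n --> \oo] --> rho y.
Hypothesis tau0 : 0 < tau.
Hypothesis Qtau : forall z y, Pmat Q z y - Q z y tau = 0.

Let mx n a : measurable (x n @^-1` [set a]).
Proof. by case: mr. Qed.

Let mT n : measurable_fun setT (T n).
Proof. by case: mr. Qed.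

Let Tlt n w : T n w < T n.+1 w.
Proof. by case: mr. Qed.

Lemma fine_prob_step n z y t :
  fine (P (step_ev x T n z y t)) = Q z y t * fine (P (x n @^-1` [set z])).
Proof.
have := prob_step mr z y t (n := n) (A := setT).
rewrite !setTI => -> //; last exact: (@measurableT _ (g_sigma_algebraType _)).
by rewrite fineM ?fin_num_measure.
Qed.

Let sojle n (t : R) := [set w | T n.+1 w - T n w <= t].
Let msoj n t : measurable (sojle n t).
Proof.
rewrite (_ : sojle n t = setT `&` (fun w => T n.+1 w - T n w) @^-1` `]-oo, t]).
  by apply: measurable_funB => //; exact: measurable_itv.
by apply/seteqP; split => w /=; rewrite in_itv/= ?setTI//; case.
Qed.

Let step_mono n z y (t t' : R) : t <= t' -> step_ev x T n z y t `<=` step_ev x T n z y t'.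
Proof. by move=> tt w [xz [xy tw]]; split => //; split => //; exact: le_trans tt. Qed.

Let mstep n z y t : measurable (step_ev x T n z y t).
Proof. exact: step_ev_measurable mr _ _ _ _. Qed.

Let fP_le (A B : set Omega) : measurable A -> measurable B -> A `<=` B ->
  fine (P A) <= fine (P B).
Proof.
by move=> mA mB AB; apply: fine_le; rewrite ?fin_num_measure// le_measure ?inE.
Qed.

(** By [Qtau], [Q z y] takes at [tau] its limiting value [Pmat Q z y]. By continuity from below that
    limit is the conditional probability of a transition to [y] with any duration, so durations
    beyond [tau] have no mass left. *)
Lemma soj_null n z y : P ((x n @^-1` [set z] `&` x n.+1 @^-1` [set y]) `\`
   step_ev x T n z y tau) = 0%E.
Proof.
set E := _ `&` _; set p := fine (P (x n @^-1` [set z])).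
have mE : measurable E by exact: measurableI.
have sE t : step_ev x T n z y t `<=` E by move=> w [xz [xy _]].
have UE : \bigcup_k step_ev x T n z y k%:R = E.
  apply/seteqP; split => [w [k _] /sE//|w [/= xz xy]].
  exists (Num.truncn (T n.+1 w - T n w)).+1 => //; split => //; split => //.
  exact/ltW/truncnS_gt.
have cE : (P \o (fun k => step_ev x T n z y k%:R)) k @[k --> \oo] --> P E.
  rewrite -UE; apply: nondecreasing_cvg_mu => //.
    by rewrite UE.
  by move=> i j ij; apply/subsetPset/step_mono; rewrite ler_nat.
have key : fine (P E) <= fine (P (step_ev x T n z y tau)).
  (* If [z] has probability 0 at time [n], the law of the process does not determine [Q z y], but
     all events in question are null. *)
  have [p0|p0] := eqVneq p 0.
    rewrite (@le_trans _ _ p)//; first by apply: fP_le => //; exact: subIsetl.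
    by rewrite p0 fine_ge0.
  have pgt0 : 0 < p by rewrite lt_def p0 fine_ge0.
  have Qc : Q z y t @[t --> +oo] --> fine (P E) / p.
    have QE t : Q z y t = fine (P (step_ev x T n z y t)) / p.
      by rewrite fine_prob_step -/p mulfK.
    apply/cvgrPdist_le => e e0.
    have ep : 0 < e * p by rewrite mulr_gt0.
    have cE' : (P \o (fun k => step_ev x T n z y k%:R)) k @[k --> \oo] --> (fine (P E))%:E.
      by rewrite fineK ?fin_num_measure.
    have [_ /cvgrPdist_le/(_ _ ep)[N _ HN]] := (fine_cvgP _ _).1 cE'.
    exists N%:R; split; first exact: num_real.
    move=> t Nt; rewrite QE -mulrBl normrM ger0_norm; last first.
      by rewrite subr_ge0 fP_le.
    rewrite ger0_norm ?invr_ge0 ?(ltW pgt0)// ler_pdivrMr//.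
    have /= := HN N (leqnn N); apply: le_trans.
    rewrite ger0_norm; last by rewrite subr_ge0; apply: fP_le.
    by rewrite lerD2l lerN2; apply: fP_le => //; apply: step_mono; exact: ltW.
  have : Pmat Q z y = fine (P E) / p by exact/cvg_lim.
  have /subr0_eq -> := Qtau z y.
  by rewrite fine_prob_step -/p => ->; rewrite divfK.
rewrite measureD//; last by rewrite ltey_eq fin_num_measure.
rewrite (setIidr (@sE tau)) -[X in (X - _)%E]fineK ?fin_num_measure//.
rewrite -[X in (_ - X)%E]fineK ?fin_num_measure// -EFinB.
congr EFin; apply/eqP; rewrite subr_eq0 eq_le key/=.
exact: fP_le.
Qed.

Definition bad_soj : set Omega := [set w | exists k, tau < T k.+1 w - T k w].

Lemma bad_soj_null : measurable bad_soj /\ P bad_soj = 0%E.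
Proof.
have E : bad_soj = \bigcup_k ~` sojle k tau.
  apply/seteqP; split => [w [k]|w [k _]] => [H|/negP]; first exists k => //=.
    by apply/negP; rewrite -ltNge.
  by rewrite -ltNge; exists k.
(* The pairs of states are enumerated by [nat] through [unpickle], so that countable subadditivity
   applies as it stands. *)
have E2 k : ~` sojle k tau `<=` \bigcup_(i in [set: nat])
    (if unpickle i is Some (z, y) then
      (x k @^-1` [set z] `&` x k.+1 @^-1` [set y]) `\` step_ev x T k z y tau else set0).
  move=> w kw; exists (pickle (x k w, x k.+1 w)) => //; rewrite pickleK /=.
  by split => //= -[_ []].
have mB : measurable bad_soj.
  by rewrite E; apply: bigcup_measurable => k _; exact: measurableC.
split => //.
have z0 k : P (~` sojle k tau) = 0%E.
  pose B k i := if unpickle i is Some (z, y) then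
      (x k @^-1` [set z] `&` x k.+1 @^-1` [set y]) `\` step_ev x T k z y tau else set0.
  have mBi i : measurable (B k i).
    rewrite /B; case: unpickle => [[z y]|//]; apply: measurableD => //.
    exact: measurableI.
  apply: prob_sub0 (@E2 k) _; first exact: measurableC.
    by apply: bigcup_measurable => i _; exact: mBi.
  apply: prob_bigcup0 => i; first exact: mBi.
  by case: unpickle => [[z y]|]; [exact: soj_null|exact: measure0].
by rewrite E; apply: prob_bigcup0 => // k; exact: measurableC.
Qed.

Let gd w : ~ bad_soj w -> forall k, T k.+1 w - T k w <= tau.
Proof. by move=> nb k; rewrite leNgt; apply/negP => H; apply: nb; exists k. Qed.

Lemma visits_sum n w : \sum_z visits x n z w = n%:R :> R.
Proof.
rewrite /visits exchange_big /=.
under eq_bigr => k _.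
  rewrite (bigD1 (x k w))//= indicE mem_set// big1 ?addr0; last first.
    by move=> z zx; rewrite indicE memNset//= => xz; rewrite xz eqxx in zx.
  over.
by rewrite sumr_const card_ord.
Qed.

Let step_sum k t w : \sum_y \1_(step_ev x T k (x k w) y t) w =
   (T k.+1 w - T k w <= t)%R%:R :> R.
Proof.
rewrite (bigD1 (x k.+1 w))//= big1 ?addr0; last first.
  by move=> y yx; rewrite indicE memNset//= => -[_ [xy _]]; rewrite xy eqxx in yx.
rewrite indicE; congr (_%:R); case: leP => H; first by rewrite mem_set.
by rewrite memNset// => -[_ [_]]; apply/negP; rewrite -ltNge.
Qed.

(** Off [bad_soj], every arrival in [y] is a step of duration at most [tau] from some state, so the
    visits to [y] and the steps into [y] differ by at most 1. The steps follow the visits through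
    [Q _ y tau], which is the transition matrix. The empirical frequencies are thus almost
    invariant, hence close to [rho]. *)
Lemma visits_law z : wlaw P (fun n w => visits x n z w) (rho z).
Proof.
move=> ka ka0.
have [dl dl0 Hdl] := almost_invariant Pn_cvg ka0.
(* Each source state gets the share [dl / 2 / c], so that the sum over all of [X] stays below
   [dl / 2]. *)
pose c : R := #|X|%:R + 1.
have c0 : 0 < c by rewrite ltr_wpDl.
have dc : 0 < dl / 2 / c by rewrite !divr_gt0.
have [mB PB] := bad_soj_null.
have H1 : inprob P \oo [set p | forall q : X * X,
   `|step_count x T p.1 q.1 q.2 tau p.2 - Q q.1 q.2 tau * visits x p.1 q.1 p.2|
     <= dl / 2 / c * p.1%:R].
  by apply: inprob_fin => -[u y] /=; exact: (weak_law_step mr u y tau dc).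
have H2 : inprob P \oo [set p | ~ bad_soj p.2] by exact: (inprob_as mB PB).
(* For such [n] the boundary discrepancy 1 is at most [dl / 2 * n]. *)
have H3 : inprob P \oo [set p | 2 / dl < p.1%:R].
  apply: inprob_det; exists (Num.truncn (2 / dl)).+1 => // n /= Hn _.
  by apply: (lt_le_trans (truncnS_gt _)); rewrite ler_nat.
apply: inprobS3 H1 H2 H3 => -[n w] /= H1 H2 H3.
have n0 : 0 < n%:R :> R by apply: lt_trans H3; rewrite divr_gt0.
have := Hdl (fun z => visits x n z w / n%:R).
have v0 u : 0 <= visits x n u w :> R by apply: sumr_ge0 => k _; rewrite indicE.
move=> /(_ (fun u => divr_ge0 (v0 u) (ltW n0))).
rewrite -mulr_suml visits_sum divff ?gt_eqF// => /(_ erefl) H.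
suff /H/(_ z) : forall y, `|visits x n y w / n%:R -
    \sum_z0 visits x n z0 w / n%:R * Pmat Q z0 y| <= dl.
  move=> K; rewrite -[X in X - _](@divfK _ n%:R) ?gt_eqF//.
  by rewrite -mulrBl normrM (gtr0_norm n0) ler_wpM2r// ltW.
move=> y.
rewrite (_ : _ - _ = (visits x n y w - \sum_z0 Q z0 y tau * visits x n z0 w) / n%:R); last first.
  rewrite mulrBl [X in _ = _ - X]mulr_suml; congr (_ - _); apply: eq_bigr => u _.
  by have /subr0_eq -> := Qtau u y; ring.
rewrite normf_div (gtr0_norm n0) ler_pdivrMr//.
have A : `|visits x n y w - \sum_z0 step_count x T n z0 y tau w| <= 1.
  have -> : \sum_z0 step_count x T n z0 y tau w = \sum_(k < n) \1_(x k.+1 @^-1` [set y]) w :> R.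
    rewrite /step_count exchange_big /=; apply: eq_bigr => k _.
    rewrite (bigD1 (x k w))//= big1 ?addr0; last first.
      by move=> u ux; rewrite indicE memNset//= => -[xu _]; rewrite xu eqxx in ux.
    rewrite !indicE; congr (_%:R); congr nat_of_bool; apply/idP/idP; rewrite !inE.
      by move=> [_ []].
    by move=> xy; split => //; split => //; exact: gd.
  rewrite /visits.
  rewrite (sum_shift (fun k => \1_(x k @^-1` [set y]) w)).
  have i01 k : (0 : R) <= (\1_(x k @^-1` [set y]) w : R) <= 1.
    by rewrite indicE; case: (_ \in _); rewrite /= lexx ler01.
  have := i01 0%N; have := i01 n => /andP[a1 a2] /andP[b1 b2].
  by rewrite ler_norml; apply/andP; split; lra.
have B : `|\sum_z0 step_count x T n z0 y tau w - \sum_z0 Q z0 y tau * visits x n z0 w|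
    <= dl / 2 * n%:R.
  rewrite -sumrB; apply: le_trans (ler_norm_sum _ _ _) _.
  apply: (@le_trans _ _ (\sum_(u : X) dl / 2 / c * n%:R)).
    by apply: ler_sum => u _; exact: (H1 (u, y)).
  rewrite [leLHS](_ : _ = dl / 2 * n%:R * (#|X|%:R / c)); last first.
    by rewrite sumr_const -[LHS]mulr_natr; ring.
  rewrite ger_pMr; last by rewrite mulr_gt0// divr_gt0.
  by rewrite ler_pdivrMr// mul1r /c lerDl ler01.
have C : 1 <= dl / 2 * n%:R.
  move: H3; rewrite ltr_pdivrMr// => H3; lra.
rewrite (_ : _ - _ = (visits x n y w - \sum_z0 step_count x T n z0 y tau w) +
  (\sum_z0 step_count x T n z0 y tau w - \sum_z0 Q z0 y tau * visits x n z0 w)); last by ring.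
by apply: le_trans (ler_normD _ _) _; lra.
Qed.

Lemma step_law z y t :
  wlaw P (fun n w => step_count x T n z y t w) (rho z * Q z y t).
Proof.
have H0 : wlaw P (fun n w => step_count x T n z y t w - Q z y t * visits x n z w) 0.
  move=> dl dl0; apply: inprobS (weak_law_step mr z y t dl0) => p /=.
  by rewrite mul0r subr0.
have := wlawD H0 (wlawZ (Q z y t) (visits_law z)).
rewrite add0r (mulrC (rho z)); congr wlaw.
by apply/funext => n; apply/funext => w; rewrite subrK.
Qed.

(** Otherwise almost surely no visit to [z] ever occurs, against [visits_law]. Positive probability
    of a visit is what allows facts about [Q z] to be read off from the process. *)
Lemma rho_visited z : rho z != 0 -> exists n, 0 < fine (P (x n @^-1` [set z])).
Proof.
move=> r0; apply: contrapT => nex.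
have z0 n : P (x n @^-1` [set z]) = 0%E.
  apply/eqP; rewrite -[X in X == _]fineK ?fin_num_measure//; apply/eqP; congr EFin.
  apply: le_anti; rewrite fine_ge0 ?andbT// leNgt; apply/negP => H.
  by apply: nex; exists n.
have rgt : 0 < rho z by rewrite lt_def r0 rho_ge0.
have r2 : 0 < rho z / 2 by rewrite divr_gt0.
have H1 := @visits_law z _ r2.
have mN : measurable (\bigcup_n (x n @^-1` [set z])) by exact: bigcup_measurable.
have PN : P (\bigcup_n (x n @^-1` [set z])) = 0%E.
  exact: prob_bigcup0.
have H2 : inprob P \oo [set p | visits x p.1 z p.2 = 0 :> R].
  apply: (inprob_as mN PN) => n w nw /=; rewrite /visits big1// => k _.
  by rewrite indicE memNset//= => xz; apply: nw; exists k.
have H3 : inprob P \oo [set p | (0 < p.1)%N].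
  by apply: inprob_det; exists 1%N.
suff /inprob_ex[n [w []]] : inprob P \oo (fun=> False) by [].
apply: inprobS3 H1 H2 H3 => -[n w] /= h1 h2 n0.
move: h1; rewrite h2 sub0r normrN ger0_norm ?mulr_ge0//.
rewrite ler_pM2r ?ltr0n//; lra.
Qed.

(** * Sojourn tails of a state that is visited *)

Section Visited.
Variables (z : X) (n : nat).
Hypothesis vis : 0 < fine (P (x n @^-1` [set z])).
Let p := fine (P (x n @^-1` [set z])).
Let long (t : R) := x n @^-1` [set z] `\` sojle n t.

Let mlong t : measurable (long t).
Proof. exact: measurableD. Qed.

(** The tail of [Fsoj Q z] is a conditional probability given [x n = z]. Its monotonicity, its
    vanishing from [tau] on and its positivity near 0 are all derived from this representation. *)
Lemma tail_prob t : 1 - Fsoj Q z t = fine (P (long t)) / p.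
Proof.
have -> : Fsoj Q z t = fine (P (x n @^-1` [set z] `&` sojle n t)) / p.
  rewrite -Ex_indic; last exact: measurableI.
  rewrite (_ : \1_(_) = (fun w => \sum_y \1_(step_ev x T n z y t) w)); last first.
    apply/funext => w; rewrite indicI /=; have [xz|xz] := pselect (x n w = z).
      rewrite -[X in step_ev _ _ _ X]xz step_sum !indicE mem_set//= mul1r.
      by congr (_%:R); case: leP => H; [rewrite mem_set|rewrite memNset//=; apply/negP; rewrite -ltNge].
    by rewrite indicE memNset// mul0r big1// => y _; rewrite indicE memNset// => -[].
  rewrite Ex_bigsum; last by move=> y; exact/bdmeas_indic.
  rewrite mulr_suml; apply: eq_bigr => y _.
  by rewrite Ex_indic// fine_prob_step mulfK// gt_eqF.
have -> : fine (P (long t)) = p - fine (P (x n @^-1` [set z] `&` sojle n t)).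
  by rewrite /long measureD ?ltey_eq ?fin_num_measure// fineB ?fin_num_measure//;
    exact: measurableI.
by rewrite mulrBl divff// gt_eqF.
Qed.


Lemma tail_nonincreasing (t t' : R) : t <= t' -> 1 - Fsoj Q z t' <= 1 - Fsoj Q z t.
Proof.
move=> tt; rewrite !tail_prob ler_pM2r ?invr_gt0//; apply: fP_le => // w [xz nw].
by split => // /le_trans H; apply: nw; exact: H.
Qed.

Lemma tail_eq0 t : tau <= t -> 1 - Fsoj Q z t = 0.
Proof.
move=> tt; rewrite tail_prob (_ : P (long t) = 0%E) ?mul0r//.
have [mB PB] := bad_soj_null; apply: prob_sub0 PB => // w [_ nw].
by apply: contrapT => /gd/(_ n) H; apply: nw; rewrite /sojle/= (le_trans H).
Qed.

(** Sojourns are strictly positive, so the events [long k.+1%:R^-1] exhaust [x n = z]; they cannot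
    all be null. *)
Lemma tail_gt0 : exists2 t, 0 < t & 0 < 1 - Fsoj Q z t.
Proof.
apply: contrapT => nex.
have z0 k : fine (P (long k.+1%:R^-1)) = 0.
  apply/eqP/negP => /negP H; apply: nex; exists k.+1%:R^-1; first by rewrite invr_gt0.
  by rewrite tail_prob divr_gt0// lt_def H fine_ge0.
have : P (\bigcup_k long k.+1%:R^-1) = 0%E.
  apply: prob_bigcup0 => // k; rewrite -[LHS]fineK ?z0//.
  by rewrite fin_num_measure.
suff -> : \bigcup_k long k.+1%:R^-1 = x n @^-1` [set z].
  by move=> H; move: vis; rewrite H ltxx.
apply/seteqP; split => [w [k _ []]//|w xz].
have th0 : 0 < T n.+1 w - T n w by rewrite subr_gt0.
exists (Num.truncn (T n.+1 w - T n w)^-1) => //; split => //=.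
apply/negP; rewrite -ltNge invf_plt ?posrE//; first exact: truncnS_gt.
Qed.

End Visited.

Definition occ n z w : R :=
  \sum_(k < n) (T k.+1 w - T k w) * \1_(x k @^-1` [set z]) w.

(** Each sojourn lies between two layer sums of mesh [de]. Summed over the visits to [z], these
    become combinations of the counts [L] of sojourns longer than a multiple of [de], which obey a
    law. The limits are Darboux sums of the tail, which bracket [m1 Q z]. *)
Lemma occ_law z : wlaw P (fun n w => occ n z w) (rho z * m1 Q z).
Proof.
have [mB PB] := bad_soj_null.
(* If [rho z = 0], the limit is 0 whatever [m1 Q z] is, and off [bad_soj] the occupation time is at
   most [tau] times the number of visits. *)
have [rz|/rho_visited[n0 vis]] := eqVneq (rho z) 0.
  rewrite rz mul0r.
  have V0 := wlawZ tau (@visits_law z); rewrite rz mulr0 in V0.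
  apply: wlaw_squeeze => dl dl0.
  exists (fun _ _ => 0), (fun n w => tau * visits x n z w), 0, 0.
  split; [exact: wlaw_cst0|by []|lra|lra|].
  apply: (inprob_as mB PB) => n w nw /=; apply/andP; split.
    by apply: sumr_ge0 => k _; rewrite mulr_ge0 ?indicE// subr_ge0 ltW.
  rewrite /visits mulr_sumr; apply: ler_sum => k _; rewrite ler_wpM2r ?indicE//.
  exact: gd.
have hd := tail_nonincreasing vis; have ht := tail_eq0 vis.
pose h t := 1 - Fsoj Q z t.
pose L n w t : R := visits x n z w - \sum_y step_count x T n z y t w.
have LE n w t : L n w t = \sum_(k < n) (t < T k.+1 w - T k w)%R%:R * \1_(x k @^-1` [set z]) w.
  rewrite /L /visits /step_count exchange_big -sumrB /=; apply: eq_bigr => k _.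
  have [xz|xz] := pselect (x k w = z).
    rewrite -[X in step_ev _ _ _ X]xz step_sum indicE mem_set// mulr1.
    by rewrite ltNge; case: (_ <= _); rewrite ?subrr ?subr0.
  rewrite indicE memNset// mulr0 big1 ?subrr// => y _.
  by rewrite indicE memNset// => -[].
have Llaw t : wlaw P (fun n w => L n w t) (rho z * h t).
  have := wlawD (@visits_law z) (wlawZ (-1) (wlaw_sum (index_enum X) (fun y => step_law z y t))).
  rewrite -mulr_sumr mulN1r -[X in X - _]mulr1 -mulrBr; congr wlaw.
  by apply/funext => n; apply/funext => w; rewrite mulN1r.
apply: wlaw_squeeze => dl dl0.
have h00 : 0 <= h 0 by rewrite -[leLHS](ht tau (lexx _)); exact: hd (ltW tau0).
pose c := rho z * tau * h 0.
have c0 : 0 <= c by rewrite !mulr_ge0// ltW.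
(* So many layers that the gap [rho z * (de * h 0)] between the two limits is at most [dl]. *)
pose I := (Num.truncn (c / dl)).+1.
have I0 : 0 < I%:R :> R by rewrite ltr0n.
pose de := tau / I%:R.
have de0 : 0 < de by rewrite divr_gt0.
have /andP[r1 r2] := @riemann_bounds R h tau I tau0 (ltn0Sn _) hd ht de (m1 Q z) erefl erefl.
have cI : rho z * (de * h 0) <= dl.
  rewrite /de (_ : rho z * _ = c / I%:R); last by rewrite /c; ring.
  rewrite ler_pdivrMr// mulrC -ler_pdivrMr//.
  exact/ltW/truncnS_gt.
(* The two Darboux sums differ by a shift of the index; only the term at 0 remains, since [h]
   vanishes at [de * I = tau]. *)
have tel : \sum_(i < I) de * h (de * i%:R) =
    \sum_(i < I) de * h (de * i.+1%:R) + de * h 0.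
  have hI : h (de * I%:R) = 0 by apply: ht; rewrite /de divfK// gt_eqF.
  by rewrite (sum_shift (fun k => de * h (de * k%:R))) mulr0 hI mulr0 addr0 subrK.
exists (fun n w => \sum_(i <- index_enum 'I_I) de * L n w (de * i.+1%:R)).
exists (fun n w => \sum_(i <- index_enum 'I_I) de * L n w (de * i%:R)).
exists (\sum_(i <- index_enum 'I_I) de * (rho z * h (de * i.+1%:R))).
exists (\sum_(i <- index_enum 'I_I) de * (rho z * h (de * i%:R))).
have fac (g : 'I_I -> R) : \sum_i de * (rho z * g i) = rho z * \sum_i de * g i.
  by rewrite mulr_sumr; apply: eq_bigr => i _; rewrite mulrCA.
split.
- by apply: wlaw_sum => i; apply: wlawZ.
- by apply: wlaw_sum => i; apply: wlawZ.
- rewrite fac; have : rho z * m1 Q z <= rho z * (\sum_(i < I) de * h (de * i.+1%:R) + de * h 0).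
    by rewrite ler_wpM2l// -tel.
  by rewrite mulrDr; lra.
- rewrite fac tel mulrDr.
  have : rho z * (\sum_(i < I) de * h (de * i.+1%:R)) <= rho z * m1 Q z by rewrite ler_wpM2l.
  by lra.
apply: (inprob_as mB PB) => n w nw /=; apply/andP; split.
  under eq_bigr do rewrite LE mulr_sumr; rewrite exchange_big /=.
  apply: ler_sum => k _; under eq_bigr do rewrite mulrA; rewrite -mulr_suml.
  rewrite ler_wpM2r ?indicE//; apply: layer_le; last exact: ltW.
  by rewrite subr_ge0 ltW.
under eq_bigr do rewrite LE mulr_sumr; rewrite exchange_big /=.
apply: ler_sum => k _; under eq_bigr do rewrite mulrA; rewrite -mulr_suml.
rewrite ler_wpM2r ?indicE//; apply: layer_ge; first exact: ltW.
by rewrite /de divfK ?gt_eqF//; exact: gd.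
Qed.

Lemma occ_sum n w : \sum_z occ n z w = T n w.
Proof.
rewrite /occ exchange_big /=.
have T0 : T 0%N w = 0 by case: mr.
rewrite (_ : T n w = \sum_(k < n) (T k.+1 w - T k w)); last first.
  by rewrite -(big_mkord xpredT (fun k => T k.+1 w - T k w)) telescope_sumr// T0 subr0.
apply: eq_bigr => k _; rewrite -mulr_sumr (bigD1 (x k w))//= indicE mem_set//.
rewrite big1 ?addr0 ?mulr1// => z zx; rewrite indicE memNset//= => xz.
by rewrite xz eqxx in zx.
Qed.

Lemma time_law : wlaw P T (Mrho Q rho).
Proof.
have := wlaw_sum (index_enum X) (fun z => @occ_law z); congr wlaw.
by apply/funext => n; apply/funext => w; exact: occ_sum.
Qed.

(** Where [rho z] is nonzero, the lower Darboux sum of the tail has a positive first term once the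
    mesh is below a point [t] at which the tail is positive. *)
Lemma Mrho_gt0 : 0 < Mrho Q rho.
Proof.
have m1ge0 z : rho z != 0 -> 0 < m1 Q z.
  move=> /rho_visited[n vis].
  have hd := tail_nonincreasing vis; have ht := tail_eq0 vis.
  have [t t0 Ht] := tail_gt0 vis.
  pose I := (Num.truncn (tau / t)).+1.
  have I0 : 0 < I%:R :> R by rewrite ltr0n.
  pose de := tau / I%:R.
  have de0 : 0 < de by rewrite divr_gt0.
  have /andP[r1 _] := @riemann_bounds R (fun t => 1 - Fsoj Q z t) tau I tau0
    (ltn0Sn _) hd ht de (m1 Q z) erefl erefl.
  apply: lt_le_trans r1; rewrite big_ord_recl /= mulr1.
  have h0 u : 0 <= 1 - Fsoj Q z u.
    have [/ht ->//|ut] := leP tau u.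
    by rewrite -(ht tau)//; apply: hd; exact: ltW.
  apply: ltr_wpDr; first by apply: sumr_ge0 => i _; rewrite mulr_ge0// ltW.
  rewrite mulr_gt0//; apply: lt_le_trans Ht _; apply: hd.
  by rewrite ler_pdivrMr// mulrC -ler_pdivrMr//; exact/ltW/truncnS_gt.
have [z rz] : exists z, rho z != 0.
  apply: contrapT => nex; have := oner_neq0 R; rewrite -rho1 big1 ?eqxx// => z _.
  by apply/eqP/negP => /negP H; apply: nex; exists z.
have ge0 u : 0 <= rho u * m1 Q u.
  have [->|/m1ge0/ltW H] := eqVneq (rho u) 0; first by rewrite mul0r.
  by rewrite mulr_ge0.
rewrite /Mrho (bigD1 z)//= ltr_wpDr//; first exact: sumr_ge0.
by rewrite mulr_gt0 ?m1ge0// lt_def rz rho_ge0.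
Qed.

(** Off [bad_soj] every jump from [z] to [y] is a step of duration at most [tau], and [Pmat Q z y]
    equals [Q z y tau]. *)
Lemma jump_law z y :
  wlaw P (fun n w => \sum_(k < n) \1_(x k @^-1` [set z] `&` x k.+1 @^-1` [set y]) w)
    (rho z * Pmat Q z y).
Proof.
have [mB PB] := bad_soj_null.
have /subr0_eq -> := Qtau z y.
apply: (wlaw_as mB PB) (step_law z y tau) => n w nw.
apply: eq_bigr => k _; rewrite !indicE; congr (_%:R); congr nat_of_bool.
apply/idP/idP; rewrite !inE; first by move=> [xz xy]; split => //; split => //; exact: gd.
by move=> [xz [xy _]].
Qed.

Definition explosion : set Omega := [set w | exists b : R, forall n, T n w <= b].

(** By [time_law] the jump times grow like [n * Mrho Q rho] with a positive rate, so for any bound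
    [k] the event [T n w <= k] has small probability for large [n]. *)
Lemma explosion_null : measurable explosion /\ P explosion = 0%E.
Proof.
have mb (b : R) n : measurable [set w | T n w <= b].
  rewrite (_ : [set _ | _] = setT `&` T n @^-1` `]-oo, b]).
    by apply: mT => //; exact: measurable_itv.
  by apply/seteqP; split => w /=; rewrite in_itv/= ?setTI//; case.
pose B (k : nat) := \bigcap_n [set w | T n w <= k%:R].
have mBk k : measurable (B k) by exact: bigcap_measurableType.
have EB : explosion = \bigcup_k B k.
  apply/seteqP; split => [w [b Hb]|w [k _ Hk]]; last by exists k%:R => n; exact: Hk.
  exists (Num.truncn b).+1 => // n _ /=; apply: le_trans (Hb n) _.
  exact/ltW/truncnS_gt.
split; first by rewrite EB; exact: bigcup_measurable.
rewrite EB; apply: prob_bigcup0 => // k.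
apply/eqP; rewrite eq_le measure_ge0 andbT.
apply/lee_addgt0Pr => e e0; rewrite add0e.
have M2 : 0 < Mrho Q rho / 2 by rewrite divr_gt0// Mrho_gt0.
have [N _ HN] := @time_law _ M2 e e0.
pose n := maxn N (Num.truncn (k%:R / (Mrho Q rho / 2))).+1.
have [C [mC PC] HC] := HN n (leq_maxl _ _).
apply: le_trans PC; apply: le_measure; rewrite ?inE// => w Bw.
apply: contrapT => /HC /=; have := Bw n I => /= Tk.
rewrite ler_norml => /andP[+ _].
have : k%:R < Mrho Q rho / 2 * n%:R.
  rewrite mulrC -ltr_pdivrMr//; apply: lt_le_trans (truncnS_gt _) _.
  by rewrite ler_nat leq_maxr.
lra.
Qed.

End RenewalLaws.

(** * Laws at the jump count of the accelerated clock *)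

Section TimeChange.
Context {R : realType} {d : measure_display} {Omega : measurableType d}.
Variables (P : probability Omega R) (T : nat -> Omega -> R) (M : R).
Hypothesis T0 : forall w, T 0%N w = 0.
Hypothesis Tlt : forall n w, T n w < T n.+1 w.

Lemma T_mono w m n : (m <= n)%N -> T m w <= T n w.
Proof.
move=> mn; rewrite -(subnKC mn); elim: (n - m)%N => [|k IH]; first by rewrite addn0.
by rewrite addnS (le_trans IH)// ltW.
Qed.

(** Off [explosion] the indices of the jumps up to [t] are bounded and include 0, so their maximum
    exists and [xget] returns it instead of its default. *)
Lemma NtP w (t : R) : ~ explosion T w -> 0 <= t ->
  T (Nt T t w) w <= t /\ t < T (Nt T t w).+1 w.
Proof.
move=> nexp t0.
have [k0 tk0] : exists n, t < T n w.
  apply: contrapT => nex; apply: nexp; exists t => n.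
  by rewrite leNgt; apply/negP => H; apply: nex; exists n.
pose A := [set m | T m w <= t /\ forall n, T n w <= t -> (n <= m)%N].
have [m Am] : exists m, A m.
  have exP : exists n, T n w <= t by exists 0%N; rewrite T0.
  have bnd n : T n w <= t -> (n <= k0)%N.
    move=> Tn; rewrite leqNgt; apply/negP => /ltnW kn.
    by have := le_lt_trans (le_trans (T_mono w kn) Tn) tk0; rewrite ltxx.
  have [m Pm Hm] := ex_maxnP exP bnd.
  by exists m; split.
have [A1 A2] : A (Nt T t w) by apply: (@xgetPex _ 0%N A); exists m.
split => //; rewrite ltNge; apply/negP => /A2; by rewrite ltnn.
Qed.

Lemma Nt_eq w (t : R) n : T n w <= t -> t < T n.+1 w -> Nt T t w = n.
Proof.
move=> h1 h2.
pose A := [set m | T m w <= t /\ forall n, T n w <= t -> (n <= m)%N].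
have An : A n.
  split => // m Tm; rewrite leqNgt; apply/negP => nm.
  by have := lt_le_trans h2 (le_trans (T_mono w nm) Tm); rewrite ltxx.
have [A1 A2] : A (Nt T t w) by apply: (@xgetPex _ 0%N A); exists n.
by apply/eqP; rewrite eqn_leq A2// andbT; exact: (An.2).
Qed.

Lemma leq_Nt w (t : R) n : ~ explosion T w -> 0 <= t -> T n w <= t -> (n <= Nt T t w)%N.
Proof.
move=> ne t0 Tn; have [_ h] := NtP ne t0; rewrite -ltnS ltnNge; apply/negP => H.
by have := lt_le_trans h (le_trans (T_mono w H) Tn); rewrite ltxx.
Qed.

Lemma Nt_leq w (t : R) n : ~ explosion T w -> 0 <= t -> t < T n w -> (Nt T t w < n)%N.
Proof.
move=> ne t0 Tn; have [h _] := NtP ne t0; rewrite ltnNge; apply/negP => H.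
by have := lt_le_trans Tn (le_trans (T_mono w H) h); rewrite ltxx.
Qed.

Lemma Nt_mono w (t t' : R) : ~ explosion T w -> 0 <= t -> t <= t' ->
  (Nt T t w <= Nt T t' w)%N.
Proof.
move=> ne t0 tt; have [h _] := NtP ne t0; apply: leq_Nt => //; lra.
Qed.

Hypothesis expl : measurable (explosion T) /\ P (explosion T) = 0%E.
Hypothesis Tlaw : wlaw P T M.
Hypothesis M0 : 0 < M.

Lemma near0_lt (r : R) : 0 < r -> \forall eps \near (0 : R)^'+, 0 < eps < r.
Proof.
move=> r0; near=> eps; apply/andP; split; first by near: eps; exact: nbhs_right_gt.
by near: eps; exact: nbhs_right_lt.
Unshelve. all: by end_near. Qed.

Lemma truncn_div_cvg (v : R) : 0 < v -> Num.truncn (v / eps) @[eps --> (0 : R)^'+] --> \oo.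
Proof.
move=> v0; apply/cvgnyPge => n.
have n0 : 0 < n.+1%:R :> R by rewrite ltr0n.
apply: filterS (near0_lt (divr_gt0 v0 n0)) => eps /andP[e0 ev].
have : n.+1%:R <= v / eps by rewrite ler_pdivlMr// mulrC -ler_pdivlMr// ltW.
move=> H; rewrite truncn_ge_nat; last by rewrite divr_ge0// ltW.
by apply: le_trans H; rewrite ler_nat.
Qed.

(** The law is read along [n = truncn (v / eps)], for which [eps * n] lies within [eps] of [v]. *)
Lemma wlaw_scaled S c (v dl : R) : wlaw P S c -> (forall w, S 0%N w = 0) ->
  (* The case [v = 0] in the proof below is separate, because the index then stays at 0 instead of
     tending to infinity; there [S 0 w = 0] settles the claim. *)
  0 <= v -> 0 < dl ->
  inprob P (0 : R)^'+ [set p | `|p.1 * S (Num.truncn (v / p.1)) p.2 - c * v| <= dl].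
Proof.
move=> HS S0 v0 dl0; have [->|vn0] := eqVneq v 0.
  apply: inprob_det; apply: nearW => eps w /=.
  by rewrite mul0r truncn0 S0 !mulr0 subrr normr0 ltW.
have vgt : 0 < v by rewrite lt_def vn0.
have e1 : 0 < dl / (2 * v) by rewrite divr_gt0// mulr_gt0.
have e2 : 0 < dl / (2 * (`|c| + 1)) by rewrite divr_gt0// mulr_gt0// ltr_pwDr.
have H1 : inprob P (0 : R)^'+ [set p | `|S (Num.truncn (v / p.1)) p.2 -
    c * (Num.truncn (v / p.1))%:R| <= dl / (2 * v) * (Num.truncn (v / p.1))%:R].
  exact: (inprob_comp (truncn_div_cvg vgt) (HS _ e1)).
have H2 : inprob P (0 : R)^'+ [set p | 0 < p.1 < dl / (2 * (`|c| + 1))].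
  by apply: inprob_det; apply: filterS (near0_lt e2).
apply: inprobS2 H1 H2 => -[eps w] /= H /andP[eps0 epsle].
have vq : 0 <= v / eps by rewrite divr_ge0// ltW.
set n := Num.truncn _ in H *.
have /andP[n1 n2] := truncn_itv vq; rewrite -/n in n1 n2.
have n1' : eps * n%:R <= v by rewrite mulrC -ler_pdivlMr.
have n2' : v - eps <= eps * n%:R.
  by move: n2; rewrite ltr_pdivrMr// -natr1 mulrDl mul1r mulrC; lra.
rewrite (_ : _ - _ = eps * (S n w - c * n%:R) + c * (eps * n%:R - v)); last by ring.
apply: le_trans (ler_normD _ _) _; rewrite !normrM (gtr0_norm eps0).
have A : eps * `|S n w - c * n%:R| <= dl / 2.
  apply: le_trans (ler_wpM2l (ltW eps0) H) _.
  rewrite mulrCA; apply: le_trans (ler_wpM2l (ltW e1) n1') _.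
  by rewrite (_ : _ / _ * v = dl / 2)//; field.
have B : `|c| * `|eps * n%:R - v| <= dl / 2.
  apply: (@le_trans _ _ ((`|c| + 1) * (dl / (2 * (`|c| + 1))))).
    apply: ler_pM => //; first by rewrite lerDl.
    by rewrite ler_norml; apply/andP; split; lra.
  have cn : `|c| + 1 != 0 by rewrite gt_eqF// ltr_pwDr.
  by rewrite (_ : _ * (dl / _) = dl / 2)//; field.
lra.
Qed.

Variables (s : R).
Hypothesis s0 : 0 <= s.

Definition fast (eps a : R) : R := s + eps^-1 * (a - s).

(** Inversion of the law for [T]: at the index [v / eps] the accelerated time is about [M * v], and
    a jump index is at most [Nt] exactly when its jump time has been reached. *)
Lemma Nt_sandwich (a eta : R) : s <= a -> 0 < eta ->
  inprob P (0 : R)^'+ [set p |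
    (Num.truncn (Num.max ((a - s) / M - eta) 0 / p.1)%R <= Nt T (fast p.1 a) p.2)%N /\
    (Nt T (fast p.1 a) p.2 <= Num.truncn (((a - s) / M + eta) / p.1)%R)%N].
Proof.
move=> sa eta0; set u := (a - s) / M.
have u0 : 0 <= u by rewrite divr_ge0 ?subr_ge0//; exact: ltW.
have uM : a - s = M * u by rewrite /u mulrC divfK// gt_eqF.
have [mE PE] := expl.
have dl0 : 0 < M * eta / 2 by rewrite divr_gt0// mulr_gt0.
have vm0 : 0 <= Num.max (u - eta) 0 by rewrite le_max lexx orbT.
have H1 := wlaw_scaled Tlaw T0 vm0 dl0.
have H2 := wlaw_scaled Tlaw T0 (addr_ge0 u0 (ltW eta0)) dl0.
(* In accelerated units the original clock starts with the offset [eps * s]; this range of [eps]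
   keeps it below [M * eta / 2]. *)
have q0 : 0 < M * eta / (2 * (s + 1)) by rewrite divr_gt0 ?mulr_gt0 ?ltr_wpDl.
have H3 : inprob P (0 : R)^'+ [set p | 0 < p.1 < M * eta / (2 * (s + 1))].
  by apply: inprob_det; apply: filterS (near0_lt q0).
have H4 : inprob P (0 : R)^'+ [set p | ~ explosion T p.2] by exact: (inprob_as mE PE).
have H34 : inprob P (0 : R)^'+ [set p | 0 < p.1 < M * eta / (2 * (s + 1)) /\ ~ explosion T p.2].
  by apply: inprobS2 H3 H4.
apply: inprobS3 H1 H2 H34 => -[eps w] /= H1 H2 [/andP[eps0 epsle] ne].
have fE : eps * fast eps a = eps * s + M * u.
  by rewrite /fast mulrDr mulrA mulfV ?gt_eqF// mul1r uM.
have f0 : 0 <= fast eps a.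
  by rewrite addr_ge0// mulr_ge0 ?invr_ge0 ?subr_ge0// ltW.
have es : eps * s < M * eta / 2.
  apply: (@le_lt_trans _ _ (eps * (s + 1))); first by rewrite ler_wpM2l ?ltW//; lra.
  move: epsle; rewrite ltr_pdivlMr; last by rewrite mulr_gt0// ltr_wpDl.
  by lra.
have Mu : M * (u + eta) = M * u + M * eta by rewrite mulrDr.
split.
  have [uv|uv] := leP (u - eta) 0; first by rewrite mul0r truncn0.
  rewrite (max_l (ltW uv)) in H1; move: H1; set n := Num.truncn _ => H1.
  apply: leq_Nt => //; rewrite -(ler_pM2l eps0) fE.
  move: H1; rewrite ler_norml => /andP[_ H1].
  have es0 : 0 <= eps * s by rewrite mulr_ge0// ltW.
  rewrite mulrBr in H1; lra.
apply/ltnW/Nt_leq => //; rewrite -(ltr_pM2l eps0) fE.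
by move: H2; rewrite ler_norml => /andP[H2 _]; lra.
Qed.

(** Monotonicity of [S] in [n] permits the random index: [Nt] lies between two deterministic
    indices, at both of which [wlaw_scaled] applies. *)
Lemma wlaw_time S c (a dl : R) : wlaw P S c -> (forall w, S 0%N w = 0) ->
  (forall n w, S n w <= S n.+1 w) -> s <= a -> 0 < dl ->
  inprob P (0 : R)^'+ [set p | `|p.1 * S (Nt T (fast p.1 a) p.2) p.2 - c * ((a - s) / M)| <= dl].
Proof.
move=> HS S0 Sm sa dl0; set u := (a - s) / M.
have u0 : 0 <= u by rewrite divr_ge0 ?subr_ge0//; exact: ltW.
have c1 : 0 < `|c| + 1 by rewrite ltr_pwDr.
pose eta := dl / (2 * (`|c| + 1)).
have eta0 : 0 < eta by rewrite divr_gt0// mulr_gt0.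
have ceta : `|c| * eta <= dl / 2.
  have cn : `|c| + 1 != 0 by rewrite gt_eqF.
  apply: (@le_trans _ _ ((`|c| + 1) * eta)); first by rewrite ler_wpM2r ?lerDl// ltW.
  by rewrite (_ : _ * eta = dl / 2)// /eta; field.
have d2 : 0 < dl / 2 by rewrite divr_gt0.
have vm0 : 0 <= Num.max (u - eta) 0 by rewrite le_max lexx orbT.
have H1 := wlaw_scaled HS S0 vm0 d2.
have H2 := wlaw_scaled HS S0 (addr_ge0 u0 (ltW eta0)) d2.
have H3 : inprob P (0 : R)^'+ [set p | 0 < p.1 < 1].
  by apply: inprob_det; apply: filterS (near0_lt ltr01).
have H4 := Nt_sandwich sa eta0.
have SmS w m n : (m <= n)%N -> S m w <= S n w.
  move=> mn; rewrite -(subnKC mn); elim: (n - m)%N => [|k IH]; first by rewrite addn0.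
  by rewrite addnS (le_trans IH).
apply: inprobS3 H1 H2 (inprobI H3 H4) => -[eps w] /= + + [/andP[eps0 _] [h1 h2]].
rewrite !ler_norml => /andP[H1 _] /andP[_ H2].
have {}h1 := ler_wpM2l (ltW eps0) (SmS w _ _ h1).
have {}h2 := ler_wpM2l (ltW eps0) (SmS w _ _ h2).
have cm : c * u - dl / 2 <= c * Num.max (u - eta) 0.
  have : `|c * (u - Num.max (u - eta) 0)| <= dl / 2.
    rewrite normrM; apply: le_trans ceta; rewrite ler_wpM2l//.
    have m1 : u - eta <= Num.max (u - eta) 0 by rewrite le_max lexx.
    have m2 : Num.max (u - eta) 0 <= u by rewrite ge_max u0 andbT gerBl ltW.
    by rewrite ger0_norm ?subr_ge0//; lra.
  by rewrite ler_norml mulrBr => /andP[_]; lra.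
have cp : c * (u + eta) <= c * u + dl / 2.
  have := ler_norm c; have : c * eta <= `|c| * eta by rewrite ler_wpM2r ?ler_norm// ltW.
  by rewrite mulrDr; lra.
by apply/andP; split; lra.
Qed.

End TimeChange.

(** * Evolutions along a fixed path *)

(* Decides equalities in commutative groups, up to the distribution of [-] over
   [+]: the terms of [lhs - rhs] are cancelled one by one, from the right. *)
Ltac pull_term u s :=
  match s with
  | ?a + ?b => let _ := match goal with _ => unify b u end in constr:(erefl (a + b))
  | ?a + ?b => let p := pull_term u a in
               constr:(etrans (congr1 (fun z => z + b) p) (addrAC _ _ b))
  | _ => let _ := match goal with _ => unify s u end in constr:(esym (add0r s))
  end.
Ltac pull_opp u s :=
  match s with
  | ?a - ?b => let _ := match goal with _ => unify b u end in constr:(erefl (a - b))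
  | ?a + ?b => let p := pull_opp u a in
               constr:(etrans (congr1 (fun z => z + b) p) (addrAC _ _ b))
  | - ?b => let _ := match goal with _ => unify b u end in constr:(esym (add0r (- b)))
  end.
Ltac cancel_terms :=
  match goal with
  | |- 0 = 0 => reflexivity
  | |- ?s - ?v = 0 => let p := pull_term v s in
      refine (etrans (congr1 (fun z => z - v) p) _); rewrite addrK; cancel_terms
  | |- ?s + ?v = 0 => let p := pull_opp v s in
      refine (etrans (congr1 (fun z => z + v) p) _); rewrite subrK; cancel_terms
  end.
Ltac zmodule := apply/eqP; rewrite -subr_eq0; apply/eqP;
  rewrite ?(scalerN, opprD, opprK, addrA, oppr0, addr0, add0r); cancel_terms.

Section PathOperator.
Context {R : realType} {Y Y1 : normedModType R} {X : finType}.
Variables (iota : {linear Y1 -> Y}) (J : set R) (G : X -> R -> R -> Y -> Y)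
          (Dop : R -> X -> X -> Y -> Y).
Hypothesis Jconv : forall a b c, J a -> J c -> a <= b -> b <= c -> J b.
Hypothesis sgG : forall z, inhom_semigroup J (G z).
Hypothesis opD : forall e z y, 0 < e <= 1 -> is_bounded_op (Dop e z y).
Hypothesis conG : forall z, contractionB J (G z).
Hypothesis conD : forall e z y v, 0 < e <= 1 -> `|Dop e z y v| <= `|v|.

Lemma bounded_opB (L : Y -> Y) : is_bounded_op L -> forall u v, L (u - v) = L u - L v.
Proof. by move=> [lin _] u v; rewrite -scaleN1r addrC lin scaleN1r addrC. Qed.

Lemma G_B z a b u v : J a -> J b -> a <= b -> G z a b (u - v) = G z a b u - G z a b v.
Proof. by move=> *; apply: bounded_opB; case: (sgG z) => H _ _; exact: H. Qed.

Section Path.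
Variables (x : nat -> X) (tm : nat -> R) (eps : R).
Hypothesis tm_mono : forall n, tm n <= tm n.+1.
Hypothesis eps01 : 0 < eps <= 1.

(* The evolution from [a] to [b] along the path with states [x] and jump times
   [tm], when the state at time [a] is [x n] and [l] jumps occur before [b]. *)
Fixpoint evol (l n : nat) (a b : R) (g : Y) : Y :=
  if l is l'.+1 then
    G (x n) a (tm n.+1) (Dop eps (x n) (x n.+1) (evol l' n.+1 (tm n.+1) b g))
  else G (x n) a b g.

Definition evol_ok (l n : nat) (a b : R) :=
  [/\ J a, J b, a <= tm n.+1, a <= b & tm (n + l)%N <= b].

Lemma tm_le m n : (m <= n)%N -> tm m <= tm n.
Proof.
move=> mn; rewrite -(subnKC mn); elim: (n - m)%N => [|k IH]; first by rewrite addn0.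
by rewrite addnS (le_trans IH).
Qed.

Lemma evol_okS l n a b : evol_ok l.+1 n a b ->
  [/\ evol_ok l n.+1 (tm n.+1) b, J (tm n.+1) & tm n.+1 <= b].
Proof.
move=> [Ja Jb at1 ab tb].
have t1b : tm n.+1 <= b by apply: le_trans tb; apply: tm_le; rewrite addnS ltnS leq_addr.
have Jt : J (tm n.+1) by exact: Jconv at1 t1b.
by split => //; split => //; rewrite addSnnS.
Qed.

Lemma evol_B l n a b u v : evol_ok l n a b ->
  evol l n a b (u - v) = evol l n a b u - evol l n a b v.
Proof.
elim: l n a => [|l IH] n a ok /=; first by case: ok => *; exact: G_B.
have [ok' Jt tb] := evol_okS ok; case: ok => Ja Jb at1 ab _.
rewrite IH// (bounded_opB (opD _ _ eps01)); exact: G_B.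
Qed.

Lemma evol_contraction l n a b u : evol_ok l n a b -> `|evol l n a b u| <= `|u|.
Proof.
elim: l n a => [|l IH] n a ok /=; first by case: ok => *; exact: conG.
have [ok' Jt tb] := evol_okS ok; case: ok => Ja Jb at1 ab _.
apply: le_trans (conG _ _ _) _ => //; apply: le_trans (conD _ _ _ eps01) _.
exact: IH.
Qed.

(** Only the factor that straddles [b] is cut, and the semigroup property of [G (x (n + l))] joins
    its two pieces. *)
Lemma evol_cat l l' n a b c g : J a -> J c -> a <= tm n.+1 -> a <= b ->
  tm (n + l)%N <= b -> b <= tm (n + l).+1 -> b <= c -> tm (n + l + l')%N <= c ->
  evol (l + l') n a c g = evol l n a b (evol l' (n + l) b c g).
Proof.
elim: l n a => [|l IH] n a Ja Jc at1 ab tb bt bc tc.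
  rewrite add0n /=; rewrite addn0 in bt tc *.
  have Jb : J b by exact: (Jconv Ja Jc ab bc).
  case: l' tc => [|l'] tc /=; last first.
    case: (sgG (x n)) => _ _ -> //; apply: (Jconv Ja Jc at1).
    by apply: le_trans tc; apply: tm_le; rewrite addnS ltnS leq_addr.
  by case: (sgG (x n)) => _ _ ->.
have t1b : tm n.+1 <= b.
  by apply: le_trans tb; apply: tm_le; rewrite addnS ltnS leq_addr.
rewrite addSn /= (IH n.+1) ?addSnnS//.
by apply: (Jconv Ja Jc at1); exact: le_trans bc.
Qed.

Variable C : R.
Hypothesis C0 : 0 <= C.
Hypothesis lipG : forall z a b g, J a -> J b -> a <= b ->
  `|G z a b (iota g) - iota g| <= C * (b - a) * `|g|.
Hypothesis lipD : forall z y g, `|Dop eps z y (iota g) - iota g| <= C * eps * `|g|.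

Let eps0 : 0 < eps.
Proof. by case/andP: eps01. Qed.

Lemma step_lip z y a b g : J a -> J b -> a <= b ->
  `|G z a b (Dop eps z y (iota g)) - iota g| <= C * (b - a + eps) * `|g|.
Proof.
move=> Ja Jb ab.
rewrite (_ : _ - _ = G z a b (Dop eps z y (iota g) - iota g) + (G z a b (iota g) - iota g)).
  apply: le_trans (ler_normD _ _) _; rewrite mulrDr mulrDl addrC lerD//; first exact: lipG.
  by apply: le_trans (conG _ _ _) _.
by rewrite G_B// addrA subrK.
Qed.

(** Telescoping over the factors: each moves [iota g] by [C * |g|] times its duration, or times
    [eps] for a jump, and the factors to its left, being contractions, do not amplify this. *)
Lemma evol_lip l n a b g : evol_ok l n a b ->
  `|evol l n a b (iota g) - iota g| <= C * (b - a + l%:R * eps) * `|g|.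
Proof.
elim: l n a => [|l IH] n a ok /=.
  by case: ok => *; rewrite mul0r addr0; exact: lipG.
have [ok' Jt tb] := evol_okS ok; case: ok => Ja Jb at1 ab _.
set h := evol l _ _ _ _.
rewrite (_ : _ - _ = G (x n) a (tm n.+1) (Dop eps (x n) (x n.+1) (h - iota g)) +
  (G (x n) a (tm n.+1) (Dop eps (x n) (x n.+1) (iota g)) - iota g)); last first.
  by rewrite (bounded_opB (opD _ _ eps01)) G_B// addrA subrK.
apply: le_trans (ler_normD _ _) _.
have H1 : `|G (x n) a (tm n.+1) (Dop eps (x n) (x n.+1) (h - iota g))| <=
    C * (b - tm n.+1 + l%:R * eps) * `|g|.
  apply: le_trans (conG _ _ _) _ => //; apply: le_trans (conD _ _ _ eps01) _.
  exact: IH.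
have H2 := step_lip (x n) (x n.+1) g Ja Jt at1.
rewrite (_ : _ * `|g| = C * (b - tm n.+1 + l%:R * eps) * `|g| +
  C * (tm n.+1 - a + eps) * `|g|); last by rewrite -natr1; ring.
exact: lerD.
Qed.

Variables (al : X -> Y1) (be : X -> X -> Y1).

(** The first-order part of [evol], with the generators frozen to the vectors [al]. It takes values
    in [Y1] because the factors further left displace it in turn, and this is estimated by Lipschitz
    bounds in the norm of [Y1]. *)
Fixpoint drift (l n : nat) (a b : R) : Y1 :=
  if l is l'.+1 then
    (tm n.+1 - a) *: al (x n) + eps *: be (x n) (x n.+1) + drift l' n.+1 (tm n.+1) b
  else (b - a) *: al (x n).

Variables (K ze : R) (g : Y1).
Hypothesis alK : forall z, `|al z| <= K.
Hypothesis beK : forall z y, `|be z y| <= K.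
Hypothesis derD : forall z y,
  `|Dop eps z y (iota g) - iota g - eps *: iota (be z y)| <= ze * eps.

Lemma drift_bound l n a b : evol_ok l n a b ->
  `|drift l n a b| <= K * (b - a + l%:R * eps).
Proof.
elim: l n a => [|l IH] n a ok /=.
  case: ok => _ _ _ ab _; rewrite mul0r addr0 normrZ ger0_norm ?subr_ge0//.
  by rewrite mulrC ler_wpM2r ?subr_ge0.
have [ok' Jt tb] := evol_okS ok; case: ok => Ja Jb at1 ab _.
rewrite (_ : K * _ = K * (tm n.+1 - a) + K * eps + K * (b - tm n.+1 + l%:R * eps)); last first.
  by rewrite -natr1; ring.
apply: le_trans (ler_normD _ _) _; apply: lerD; last exact: IH.
apply: le_trans (ler_normD _ _) _; rewrite !normrZ (gtr0_norm eps0) ger0_norm ?subr_ge0//.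
by apply: lerD; rewrite mulrC ler_wpM2r ?subr_ge0// ltW.
Qed.

(** The leftmost factor is peeled off. It contributes its own first-order error, with rate [ze], and
    displaces the drift of the rest; that drift has size at most [K * B], whence the second-order
    rate [C * K * B]. *)
Lemma evol_expand l n a b B : evol_ok l n a b ->
  (forall z a' b', a <= a' -> a' <= b' -> b' <= b ->
     `|G z a' b' (iota g) - iota g - (b' - a') *: iota (al z)| <= ze * (b' - a')) ->
  b - a + l%:R * eps <= B ->
  `|evol l n a b (iota g) - iota g - iota (drift l n a b)| <=
    (b - a + l%:R * eps) * (C * K * B + ze).
Proof.
have K0 : 0 <= K by apply: le_trans (alK (x 0%N)); exact: normr_ge0.
elim: l n a => [|l IH] n a ok derG hB /=.
  case: ok => Ja Jb at1 ab _; rewrite mul0r addr0 in hB *.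
  rewrite linearZ /=; apply: le_trans (derG _ _ _ _ _ _) _ => //.
  rewrite mulrC ler_wpM2l ?subr_ge0// lerDr !mulr_ge0//.
  by apply: le_trans hB; rewrite subr_ge0.
have [ok' Jt tb] := evol_okS ok; case: ok => Ja Jb at1 ab _.
set t1 := tm n.+1 in at1 tb Jt ok' *; set z := x n; set y := x n.+1.
set h := evol l _ _ _ _; set r := drift l _ _ _.
have opDz := opD z y eps01.
have L0 : 0 <= b - t1 + l%:R * eps by rewrite addr_ge0 ?subr_ge0// mulr_ge0// ltW.
have Bge : b - t1 + l%:R * eps + eps <= B.
  by move: hB; rewrite -natr1 mulrDl mul1r; lra.
have IHn : `|h - iota g - iota r| <= (b - t1 + l%:R * eps) * (C * K * B + ze).
  apply: IH => //; last by apply: le_trans Bge; rewrite lerDl ltW.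
  by move=> z' a' b' t1a; apply: derG; exact: le_trans t1a.
(* In this order: the remainder of the rest of the path, the displacement of its drift, the error of
   the jump, the displacement of the jump drift, the error of the semigroup. *)
rewrite (_ : _ - _ - _ = G z a t1 (Dop eps z y (h - iota g - iota r)) +
   (G z a t1 (Dop eps z y (iota r)) - iota r) +
   G z a t1 (Dop eps z y (iota g) - iota g - eps *: iota (be z y)) +
   (G z a t1 (iota (eps *: be z y)) - iota (eps *: be z y)) +
   (G z a t1 (iota g) - iota g - (t1 - a) *: iota (al z))); last first.
  rewrite !(bounded_opB opDz) !G_B// !linearD !linearZ /=.
  set u1 := G _ _ _ _; set u2 := G _ _ _ (Dop _ _ _ (iota g)).
  set u3 := G _ _ _ (Dop _ _ _ (iota r)).
  set u4 := G _ _ _ (_ *: _); set u5 := G _ _ _ (iota g).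
  by zmodule.
have N1 : `|G z a t1 (Dop eps z y (h - iota g - iota r))| <=
   (b - t1 + l%:R * eps) * (C * K * B + ze).
  by apply: le_trans (conG _ _ _) _ => //; apply: le_trans (conD _ _ _ eps01) _.
have rK := drift_bound ok'; rewrite -/r in rK.
have N2 : `|G z a t1 (Dop eps z y (iota r)) - iota r| <=
   C * (t1 - a + eps) * (K * (b - t1 + l%:R * eps)).
  apply: le_trans (step_lip _ _ _ _ _ _) _ => //; rewrite ler_wpM2l//.
  by rewrite mulr_ge0// addr_ge0 ?subr_ge0// ltW.
have N3 : `|G z a t1 (Dop eps z y (iota g) - iota g - eps *: iota (be z y))| <= ze * eps.
  by apply: le_trans (conG _ _ _) _.
have N4 : `|G z a t1 (iota (eps *: be z y)) - iota (eps *: be z y)| <=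
   C * (t1 - a) * (eps * K).
  apply: le_trans (lipG _ _ _ _ _) _ => //; rewrite ler_wpM2l//.
    by rewrite mulr_ge0// subr_ge0.
  by rewrite normrZ (gtr0_norm eps0) ler_wpM2l// ltW.
have N5 : `|G z a t1 (iota g) - iota g - (t1 - a) *: iota (al z)| <= ze * (t1 - a).
  exact: derG.
apply: le_trans (ler_normD _ _) _; apply: le_trans (lerD (ler_normD _ _) (lexx _)) _.
apply: le_trans (lerD (lerD (ler_normD _ _) (lexx _)) (lexx _)) _.
apply: le_trans (lerD (lerD (lerD (ler_normD _ _) (lexx _)) (lexx _)) (lexx _)) _.
(* The two displacement terms together are absorbed by lengthening the rest by one [eps], which
   [Bge] still allows. *)
have e1 : C * (t1 - a + eps) * (K * (b - t1 + l%:R * eps)) + C * (t1 - a) * (eps * K) <=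
    (t1 - a + eps) * (C * K * B).
  apply: (@le_trans _ _ ((t1 - a + eps) * (C * K * (b - t1 + l%:R * eps + eps)))).
    have : 0 <= C * K * (eps * eps) by rewrite !mulr_ge0// ltW.
    by lra.
  apply: ler_wpM2l; first by rewrite addr_ge0 ?subr_ge0// ltW.
  by apply: ler_wpM2l => //; rewrite mulr_ge0.
rewrite -natr1 (_ : _ * (C * K * B + ze) = (b - t1 + l%:R * eps) * (C * K * B + ze) +
  ((t1 - a + eps) * (C * K * B)) + ze * eps + ze * (t1 - a)); last by ring.
lra.
Qed.

(** The path meets the first and the last sojourn only in part. Up to these two corrections the
    drift is a difference of sums from index 0, to which laws of large numbers apply. *)
Lemma drift_sum (th : nat -> R) l n a b (S := fun m => \sum_(k < m) (th k *: al (x k) + be (x k) (x k.+1))) :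
  (forall k, tm k.+1 - tm k = eps * th k) ->
  drift l n a b = eps *: (S (n + l)%N - S n) - (a - tm n) *: al (x n) +
    (b - tm (n + l)%N) *: al (x (n + l)%N).
Proof.
move=> tmth; elim: l n a => [|l IH] n a /=.
  by rewrite addn0 subrr scaler0 add0r -scaleNr -scalerDl; congr (_ *: _); ring.
rewrite IH addSnnS subrr scale0r subr0 addrA; congr (_ + _).
have -> : S n.+1 = S n + (th n *: al (x n) + be (x n) (x n.+1)) by rewrite /S big_ord_recr.
rewrite !scalerBr !scalerDr scalerA -tmth.
rewrite (_ : tm n.+1 - a = (tm n.+1 - tm n) - (a - tm n)); last by ring.
rewrite scalerBl.
set A1 := (tm n.+1 - tm n) *: _; set A2 := (a - tm n) *: _; set A3 := eps *: be _ _.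
set A4 := eps *: S _; set A5 := eps *: S n.
by zmodule.
Qed.

End Path.
End PathOperator.

(** * Generators and uniform bounds *)

Section Generators.
Context {R : realType} {Y : normedModType R}.
Variables (J : set R) (S : R -> R -> Y -> Y).
Hypothesis Jconv : forall a b c, J a -> J c -> a <= b -> b <= c -> J b.
Hypothesis sgS : inhom_semigroup J S.

Lemma bounded_opZ (L : Y -> Y) : is_bounded_op L -> forall (a : R) u, L (a *: u) = a *: L u.
Proof.
move=> [lin _] a u; have L0 : L 0 = 0.
  have := lin 1 0 0; rewrite scaler0 addr0 scale1r => /eqP.
  by rewrite -subr_eq0 opprD addNKr oppr_eq0 => /eqP.
by have := lin a u 0; rewrite addr0 L0 addr0.
Qed.

Hypothesis conS : contractionB J S.
Hypothesis contS : forall s f, J s -> {within Jfrom J s, continuous (fun u => S s u f)}.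

(** The orbit [v |-> S a v f] has the right derivative [S a v g] at [v], where [g] is the right
    generator applied to [f]; the mean value estimate is applied to the orbit minus [v *: c]. *)
Lemma generator_mean_value (f c : Y) (a b M : R) : J a -> J b -> a <= b ->
  (forall v, a <= v -> v <= b ->
     exists2 g, gen_right J S v f g & `|S a v g - c| <= M) ->
  `|S a b f - f - (b - a) *: c| <= M * (b - a).
Proof.
move=> Ja Jb ab H; case: (sgS) => opS S1 S2.
have Jv v : a <= v -> v <= b -> J v by move=> av vb; exact: Jconv av vb.
have := @right_mean_value R Y (fun v => S a v f - v *: c) a b M ab.
rewrite /= S1// (_ : _ - _ - _ = S a b f - f - (b - a) *: c); last first.
  by rewrite scalerBl; zmodule.
apply.
- move=> v av vb e e0.
  have e2 : 0 < e / 2 by rewrite divr_gt0.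
  have [d d0 Hd] := within_continuousP (@contS a f Ja) (conj (Jv _ av vb) av) e2.
  have c1 : 0 < `|c| + 1 by rewrite ltr_pwDr.
  have q0 : 0 < e / 2 / (`|c| + 1) by rewrite divr_gt0.
  exists (Num.min d (e / 2 / (`|c| + 1))); first by rewrite lt_min d0 q0.
  move=> y ay yb; rewrite lt_min => /andP[y1 y2].
  have {}Hd := Hd y (conj (Jv _ ay yb) ay) y1.
  rewrite (_ : _ - _ = (S a y f - S a v f) - (y - v) *: c); last first.
    by rewrite scalerBl; zmodule.
  apply: le_lt_trans (ler_normB _ _) _; rewrite normrZ.
  have : `|y - v| * `|c| <= e / 2 / (`|c| + 1) * (`|c| + 1).
    by apply: ler_pM => //; [exact: ltW|rewrite lerDl].
  by rewrite divfK ?gt_eqF//; lra.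
- move=> v av vb e e0; have [g Hg Hc] := H v av (ltW vb).
  have [d [d0 Hd]] := Hg e e0.
  exists d => // h h0 hd vhb.
  have Jvv : J v by exact: Jv av (ltW vb).
  have Jvh : J (v + h) by apply: Jv => //; lra.
  have {}Hd := Hd h h0 hd Jvh.
  have opav := opS a v (And3 Ja Jvv av).
  rewrite (_ : _ - _ = S a v (S v (v + h) f - f - h *: g) + h *: (S a v g - c)); last first.
    rewrite !(bounded_opB opav) (bounded_opZ opav) S2//; last by lra.
    by rewrite scalerDl scalerBr; zmodule.
  apply: le_trans (ler_normD _ _) _; rewrite mulrDl addrC lerD//.
    by rewrite normrZ gtr0_norm// mulrC ler_wpM2r// ltW.
  apply: le_trans (conS _ _) _ => //.
  rewrite (_ : _ - _ - _ = h *: (h^-1 *: (S v (v + h) f - f) - g)); last first.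
    by rewrite scalerBr scalerA mulfV ?gt_eqF// scale1r.
  by rewrite normrZ gtr0_norm// mulrC ler_wpM2r// ltW.
Qed.

End Generators.

(** * Lipschitz estimates in the norm of [Y1], uniform in time, state and [eps] *)

Section UniformBounds.
Context {R : realType} {Y : normedModType R} {Y1 : completeNormedModType R} {X : finType}.
Variables (iota : {linear Y1 -> Y}) (J : set R) (G : X -> R -> R -> Y -> Y)
          (Dop : R -> X -> X -> Y -> Y).
Hypothesis Jconv : forall a b c, J a -> J c -> a <= b -> b <= c -> J b.
Hypothesis iota_cont : continuous iota.
Hypothesis sgG : forall z, inhom_semigroup J (G z).
Hypothesis opD : forall e z y, 0 < e <= 1 -> is_bounded_op (Dop e z y).
Hypothesis conG : forall z, contractionB J (G z).
Hypothesis conD : forall e z y v, 0 < e <= 1 -> `|Dop e z y v| <= `|v|.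
Hypothesis regG : forall z, regular J iota (G z).
Hypothesis D1Y1 : forall f : Y1, inD1 Dop (iota f).
Hypothesis bdA : forall z, exists C : R, forall u (f : Y1), J u ->
  `|genop J (G z) u (iota f)| <= C * `|f|.

Lemma iota_bounded : exists2 C : R, 0 < C & forall f, `|iota f| <= C * `|f|.
Proof.
have /cvgrPdist_le/(_ 1 ltr01) := @iota_cont 0.
rewrite raddf0 => /nbhs_normP[r /= r0 Hr].
exists (2 / r); first by rewrite divr_gt0.
move=> f; have [->|f0] := eqVneq f 0; first by rewrite raddf0 !normr0 mulr0.
have nf0 : 0 < `|f| by rewrite normr_gt0.
pose k := r / 2 / `|f|.
have k0 : 0 < k by rewrite !divr_gt0.
have nk : `|k *: f| = r / 2 by rewrite normrZ (gtr0_norm k0) /k divfK ?gt_eqF.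
have : `|iota (k *: f)| <= 1.
  by have := Hr (k *: f); rewrite sub0r normrN; apply; rewrite /ball_ /= sub0r normrN nk; lra.
rewrite linearZ normrZ (gtr0_norm k0) mulrC -ler_pdivlMr// => /le_trans; apply.
by rewrite /k !invfM !invrK mul1r mulrC mulrA (mulrC _ r^-1) mulrAC (mulrC 2).
Qed.

Lemma genopP z t (f : Y1) : J t -> gen_right J (G z) t (iota f) (genop J (G z) t (iota f)) /\
  gen_left J (G z) t (iota f) (genop J (G z) t (iota f)).
Proof.
move=> Jt; case: (regG z) => /(_ t f Jt) [g Hg] _ _ _ _.
by apply: (@xgetPex _ 0 [set g | gen_right J (G z) t (iota f) g /\
  gen_left J (G z) t (iota f) g]); exists g.
Qed.

(** [generator_mean_value] with [c = 0] and the bound on [genop] as an operator from [Y1] to [Y]; a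
    sum over the finite state space makes the constant uniform. *)
Lemma semigroups_lipschitz : exists2 C : R, 0 <= C & forall z a b g, J a -> J b -> a <= b ->
  `|G z a b (iota g) - iota g| <= C * (b - a) * `|g|.
Proof.
have [Cz HC] := choice bdA.
exists (\sum_z `|Cz z|); first exact: sumr_ge0.
move=> z a b g Ja Jb ab.
have regz := regG z.
have := @generator_mean_value R Y J (G z) Jconv (sgG z) (@conG z) _ (iota g) 0 a b
  (\sum_z `|Cz z| * `|g|) Ja Jb ab.
rewrite scaler0 subr0 -mulr_suml mulrAC; apply; first by case: regz.
move=> v av vb; have Jv : J v by exact: Jconv av vb.
exists (genop J (G z) v (iota g)); first by case: (genopP z g Jv).
rewrite subr0; apply: le_trans (@conG z a v _ (And3 Ja Jv av)) _.
apply: le_trans (HC z v g Jv) _; rewrite ler_wpM2r//.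
apply: le_trans (ler_norm _) _; rewrite (bigD1 z)//= lerDl.
exact: sumr_ge0.
Qed.

Lemma D1P z y (f : Y1) : dlim01 (fun e => Dfull Dop e z y (iota f)) 0 (D1 Dop 0 z y (iota f)).
Proof.
apply: (@xgetPex _ 0 [set g | dlim01 (fun e => Dfull Dop e z y (iota f)) 0 g]).
by apply: D1Y1; rewrite lexx ler01.
Qed.

Lemma D1_approx z y (f : Y1) (ze : R) : 0 < ze -> exists2 de, 0 < de &
  forall e, 0 < e -> e < de -> e <= 1 ->
  `|Dop e z y (iota f) - iota f - e *: D1 Dop 0 z y (iota f)| <= ze * e.
Proof.
move=> ze0; have [de [de0 H]] := D1P z y f ze0; exists de => // e e0 ede e1.
have := H e; rewrite add0r gt_eqF// gtr0_norm// (ltW e0) e1 /Dfull eqxx gt_eqF//.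
move=> /(_ isT ede isT)/ltW K.
rewrite (_ : _ - _ - _ = e *: (e^-1 *: (Dop e z y (iota f) - iota f) - D1 Dop 0 z y (iota f))).
  by rewrite normrZ gtr0_norm// mulrC ler_wpM2r// ltW.
by rewrite scalerBr scalerA mulfV ?gt_eqF// scale1r.
Qed.

(* Banach-Steinhaus applied to the difference quotients of [e |-> D^e] at [0]. *)
Lemma jumps_lipschitz : exists2 C : R, 0 <= C & forall e z y g, 0 < e <= 1 ->
  `|Dop e z y (iota g) - iota g| <= C * e * `|g|.
Proof.
have [Ci Ci0 HCi] := iota_bounded.
pose F (p : X * X) := [set q : Y1 -> Y | exists2 e : R, 0 < e <= 1 &
   q = fun g => e^-1 *: (Dop e p.1 p.2 (iota g) - iota g)].
have UB p : exists C : R, forall e g, 0 < e <= 1 ->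
    `|Dop e p.1 p.2 (iota g) - iota g| <= C * e * `|g|.
  have : uniform_bounded (F p).
    apply: Banach_Steinhauss.
    - move=> q [e e01 ->]; have [e0 e1] := andP e01; split.
        move=> r; exists (e^-1 * (2 * (Ci * r))) => g gr.
        rewrite normrZ gtr0_norm ?invr_gt0// ler_wpM2l ?invr_ge0 ?(ltW e0)//.
        apply: le_trans (ler_normB _ _) _; rewrite mulrDl mul1r.
        have ig : `|iota g| <= Ci * r.
          by apply: le_trans (HCi g) _; rewrite ler_wpM2l// ltW.
        by rewrite lerD//; apply: le_trans (conD _ _ _ e01) _.
      move=> c u v /=; case: (opD p.1 p.2 e01) => lin _.
      rewrite linearP lin scalerA (mulrC c) -scalerA -scalerDr; congr (_ *: _).
      by rewrite scalerBr; zmodule.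
    - move=> g; have [de de0 H] := D1_approx p.1 p.2 g ltr01.
      (* For [e < de] the quotient is within 1 of its limit [D1], which gives [A]; for [e >= de]
         contractivity and [e^-1 <= de^-1] give [B]. *)
      pose A := `|D1 Dop 0 p.1 p.2 (iota g)| + 1.
      pose B := de^-1 * (2 * `|iota g|).
      exists (A + B) => q [e e01 ->]; have [e0 e1] := andP e01.
      have A0 : 0 <= A by rewrite addr_ge0.
      have B0 : 0 <= B by rewrite mulr_ge0 ?mulr_ge0// invr_ge0 ltW.
      rewrite normrZ gtr0_norm ?invr_gt0//.
      have [ede|dee] := ltP e de.
        have {}H := H e e0 ede e1.
        apply: (@le_trans _ _ A); last by rewrite lerDl.
        rewrite mulrC ler_pdivrMr// /A.
        have := ler_normD (Dop e p.1 p.2 (iota g) - iota g - e *: D1 Dop 0 p.1 p.2 (iota g))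
          (e *: D1 Dop 0 p.1 p.2 (iota g)).
        by rewrite subrK normrZ (gtr0_norm e0); lra.
      apply: (@le_trans _ _ B); last by rewrite lerDr.
      rewrite /B; apply: ler_pM => //; first by rewrite invr_ge0 ltW.
        by rewrite lef_pV2.
      apply: le_trans (ler_normB _ _) _; rewrite mulrDl mul1r lerD//.
      exact: conD.
  move=> /(_ 1)[C HC]; exists C => e g e01; have [e0 e1] := andP e01.
  have [->|g0] := eqVneq g 0.
    by rewrite raddf0 -(scale0r 0) (bounded_opZ (opD _ _ e01)) !scale0r subrr !normr0 mulr0.
  have ng0 : 0 < `|g| by rewrite normr_gt0.
  have := HC _ (ex_intro2 _ _ e e01 erefl) (`|g|^-1 *: g).
  rewrite normrZ normfV normr_id mulVf ?gt_eqF// => /(_ (lexx _)).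
  rewrite linearZ /= (bounded_opZ (opD _ _ e01)) -scalerBr scalerA normrZ.
  rewrite normrM gtr0_norm ?invr_gt0// normfV normr_id -invfM mulrC ler_pdivrMr ?mulr_gt0//.
  by rewrite mulrA.
have [C HC] := choice UB.
exists (\sum_p `|C p|); first exact: sumr_ge0.
move=> e z y g e01; have [e0 e1] := andP e01.
apply: le_trans (HC (z, y) e g e01) _; rewrite ler_wpM2r// ler_wpM2r ?(ltW e0)//.
apply: le_trans (ler_norm _) _; rewrite (bigD1 (z, y))//= lerDl.
exact: sumr_ge0.
Qed.

(** The Lipschitz bound passes to the limit of difference quotients. Left quotients are taken
    because they stay in [J] even if [u] is its right end point; hence the condition [0 < u]. *)
Lemma genop_lipschitz (C : R) z (u : R) (f g : Y1) :
  (forall a b h, J a -> J b -> a <= b ->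
    `|G z a b (iota h) - iota h| <= C * (b - a) * `|h|) ->
  J u -> J 0 -> 0 < u ->
  `|genop J (G z) u (iota f) - genop J (G z) u (iota g)| <= C * `|f - g|.
Proof.
move=> lip Ju J0 u0; apply/ler_addgt0Pr => e e0.
have e2 : 0 < e / 2 by rewrite divr_gt0.
have [_ /(_ _ e2)[d1 [d10 H1]]] := genopP z f Ju.
have [_ /(_ _ e2)[d2 [d20 H2]]] := genopP z g Ju.
pose h : R := Num.min u (Num.min d1 d2) / 2.
have m0 : 0 < Num.min u (Num.min d1 d2) by rewrite !lt_min u0 d10 d20.
have h0 : 0 < h by rewrite divr_gt0.
have hlt : h < Num.min u (Num.min d1 d2) by rewrite /h; lra.
move: hlt; rewrite !lt_min => /and3P[hu h1 h2].
have Juh : J (u - h) by apply: (Jconv J0 Ju); lra.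
have {}H1 := H1 h h0 h1 Juh; have {}H2 := H2 h h0 h2 Juh.
have L : `|h^-1 *: (G z (u - h) u (iota f) - iota f) -
          h^-1 *: (G z (u - h) u (iota g) - iota g)| <= C * `|f - g|.
  have op : is_bounded_op (G z (u - h) u).
    by case: (sgG z) => H _ _; apply: H; split => //; lra.
  rewrite -scalerBr (_ : _ - _ - _ = G z (u - h) u (iota (f - g)) - iota (f - g)); last first.
    have -> : iota (f - g) = iota f - iota g by rewrite raddfB.
    by rewrite (bounded_opB op); zmodule.
  rewrite normrZ gtr0_norm ?invr_gt0// mulrC ler_pdivrMr//.
  apply: le_trans (lip _ _ _ Juh Ju _) _; first by lra.
  by rewrite opprB addrC subrK mulrAC.
move: H1 H2 L.
set a := genop _ _ _ _; set b := genop _ _ _ _; set p := _ *: _; set q := _ *: _.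
move=> H1 H2 L.
rewrite (_ : a - b = - (p - a) + (p - q) + (q - b)); last by zmodule.
apply: le_trans (ler_normD _ _) _; apply: le_trans (lerD (ler_normD _ _) (lexx _)) _.
by rewrite normrN; lra.
Qed.

Lemma D1_lipschitz (C : R) z y (f g : Y1) :
  (forall e h, 0 < e <= 1 -> `|Dop e z y (iota h) - iota h| <= C * e * `|h|) ->
  `|D1 Dop 0 z y (iota f) - D1 Dop 0 z y (iota g)| <= C * `|f - g|.
Proof.
move=> lip; apply/ler_addgt0Pr => e e0.
have e2 : 0 < e / 2 by rewrite divr_gt0.
have [d1 d10 H1] := D1_approx z y f e2.
have [d2 d20 H2] := D1_approx z y g e2.
pose h : R := Num.min 1 (Num.min d1 d2) / 2.
have m0 : 0 < Num.min 1 (Num.min d1 d2) by rewrite !lt_min ltr01 d10 d20.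
have h0 : 0 < h by rewrite divr_gt0.
have hlt : h < Num.min 1 (Num.min d1 d2) by rewrite /h; lra.
move: hlt; rewrite !lt_min => /and3P[/ltW hu h1 h2].
have {}H1 := H1 h h0 h1 hu; have {}H2 := H2 h h0 h2 hu.
have h01 : 0 < h <= 1 by rewrite h0.
have L : `|(Dop h z y (iota f) - iota f) - (Dop h z y (iota g) - iota g)| <= C * h * `|f - g|.
  rewrite (_ : _ - _ - _ = Dop h z y (iota (f - g)) - iota (f - g)); first exact: lip.
  have -> : iota (f - g) = iota f - iota g by rewrite raddfB.
  by rewrite (bounded_opB (opD _ _ h01)); zmodule.
move: H1 H2 L.
set a := D1 _ _ _ _ _; set b := D1 _ _ _ _ _; set p := _ - iota f; set q := _ - iota g.
move=> H1 H2 L; rewrite -(ler_pM2l h0).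
rewrite -[X in X * _](gtr0_norm h0) -normrZ.
rewrite (_ : h *: _ = - (p - h *: a) + (p - q) + (q - h *: b)); last first.
  by rewrite scalerBr; zmodule.
apply: le_trans (ler_normD _ _) _; apply: le_trans (lerD (ler_normD _ _) (lexx _)) _.
by rewrite normrN; lra.
Qed.

End UniformBounds.

(** * Skorohod space and lower integrals *)

Section Rhoinf.
Context {R : realType} {Y : normedModType R}.

Let term (a b : nat -> Y) (k : nat) : R := (2 ^+ k)^-1 * Num.min 1 `|a k - b k|.

Let term_ge0 a b k : 0 <= term a b k.
Proof. by rewrite mulr_ge0 ?invr_ge0 ?exprn_ge0// le_min ler01 normr_ge0. Qed.

(** The weights sum to 2, and those from index [K] on to [2 / 2 ^+ K], where the truncation at 1
    bounds the terms. *)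
Lemma rhoinf_le (a b : nat -> Y) (K : nat) (dl : R) : 0 <= dl ->
  (forall k, (k < K)%N -> `|a k - b k| <= dl) ->
  rhoinf a b <= 2 * dl + 2 / 2 ^+ K.
Proof.
move=> dl0 H.
have p2 n : 0 < (2 : R) ^+ n by rewrite exprn_gt0.
have bnd n : \sum_(k < n) term a b k <= (2 - 2 / 2 ^+ n) * dl + (2 / 2 ^+ K - 2 / 2 ^+ (maxn n K)).
  elim: n => [|n IH].
    by rewrite big_ord0 max0n expr0 divr1 !subrr mul0r addr0.
  rewrite big_ord_recr /=; apply: le_trans (lerD IH (lexx _)) _.
  have e2 : 2 / 2 ^+ n.+1 = (2 ^+ n)^-1 :> R by rewrite exprS invfM mulrA divff ?mul1r.
  have [nK|Kn] := ltnP n K.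
    have : term a b n <= (2 ^+ n)^-1 * dl.
      by rewrite ler_wpM2l ?invr_ge0 ?(ltW (p2 n))// ge_min H ?orbT.
    by rewrite e2 (maxn_idPr nK); lra.
  have : term a b n <= (2 ^+ n)^-1.
    by rewrite ger_pMr ?invr_gt0// ge_min lexx.
  have : 0 <= (2 ^+ n)^-1 * dl by rewrite mulr_ge0// invr_ge0 ltW.
  by rewrite (maxn_idPl (leqW Kn)) e2; lra.
have nd : nondecreasing_seq (fun n => \sum_(k < n) term a b k).
  by apply/nondecreasing_seqP => n; rewrite big_ord_recr /= lerDl.
apply: limr_le.
  apply: nondecreasing_is_cvgn => //; exists (2 * dl + 2 / 2 ^+ K) => _ [n _ <-].
  apply: le_trans (bnd n) _; rewrite lerD//.
    by rewrite ler_wpM2r// gerBl divr_ge0// ltW.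
  by rewrite gerBl divr_ge0// ltW.
apply: nearW => n; apply: le_trans (bnd n) _; rewrite lerD//.
  by rewrite ler_wpM2r// gerBl divr_ge0// ltW.
by rewrite gerBl divr_ge0// ltW.
Qed.

Lemma rhoinf_lt (e : R) : 0 < e -> exists K (dl : R), 0 < dl /\ forall a b : nat -> Y,
  (forall k, (k < K)%N -> `|a k - b k| <= dl) -> rhoinf a b < e.
Proof.
(* With this [K], [K < 2 ^+ K] yields [2 / 2 ^+ K <= e / 4]; with [dl = e / 8] the total is at most
   [e / 2]. *)
move=> e0; pose K := (Num.truncn (8 / e)).+1.
exists K, (e / 8); split; first by rewrite divr_gt0.
move=> a b H; apply: le_lt_trans (rhoinf_le _ H) _; first by rewrite divr_ge0// ltW.
have K0 : 0 < K%:R :> R by rewrite ltr0n.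
have : 2 / 2 ^+ K <= e / 4.
  rewrite ler_pdivrMr ?exprn_gt0//.
  have h1 : 8 / e < K%:R by exact: truncnS_gt.
  have h2 : K%:R <= (2 : R) ^+ K by rewrite -natrX ler_nat ltnW// ltn_expl.
  have h3 : 8 / e <= 2 ^+ K by apply: le_trans h2; exact: ltW.
  move: h3; rewrite ler_pdivrMr//; lra.
by lra.
Qed.

End Rhoinf.

(** * RCLL paths and continuity for Skorohod convergence *)

Section SkorohodContinuity.
Context {R : realType} {Y : normedModType R}.
Variables (J : set R) (s : R).

(** By [rhoinf_lt] only finitely many coordinates matter at a given precision, so a common radius
    can be chosen for them. *)
Lemma rcll_coordinatewise (z : R -> nat -> Y) :
  (forall t k, Jfrom J s t ->
    (forall e, 0 < e -> exists2 dl, 0 < dl &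
      forall u, Jfrom J s u -> t <= u -> u < t + dl -> `|z u k - z t k| <= e)) ->
  (forall t k, Jfrom J s t -> s < t -> exists l : Y,
    (forall e, 0 < e -> exists2 dl, 0 < dl &
      forall u, Jfrom J s u -> t - dl < u -> u < t -> `|z u k - l| <= e)) ->
  rcll J s z.
Proof.
have fin (Phi : nat -> R -> Prop) : (forall k, exists2 d, 0 < d & Phi k d) ->
    (forall k d d', 0 < d' -> d' <= d -> Phi k d -> Phi k d') ->
    forall K, exists2 d, 0 < d & forall k, (k < K)%N -> Phi k d.
  move=> ex anti; elim=> [|K [d d0 Hd]]; first by exists 1.
  have [d' d'0 Hd'] := ex K.
  have m0 : 0 < Num.min d d' by rewrite lt_min d0.
  exists (Num.min d d') => // k; rewrite ltnS leq_eqVlt => /predU1P[->|/Hd H].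
    by apply: anti Hd' => //; rewrite ge_min lexx orbT.
  by apply: anti H => //; rewrite ge_min lexx.
move=> Hr Hl t Jt; split.
  move=> e e0; have [K [dl [dl0 Hdl]]] := @rhoinf_lt R Y e e0.
  have [d d0 Hd] := fin (fun k d => forall u, Jfrom J s u -> t <= u -> u < t + d ->
    `|z u k - z t k| <= dl) (fun k => Hr t k Jt dl dl0)
    (fun k d d' _ dd H u Ju tu ud => H u Ju tu (lt_le_trans ud (lerD (lexx t) dd))) K.
  by exists d; split => // u Ju tu ud; apply: Hdl => k kK; exact: Hd.
move=> st; have [l Hl'] := choice (fun k => Hl t k Jt st).
exists l => e e0; have [K [dl [dl0 Hdl]]] := @rhoinf_lt R Y e e0.
have [d d0 Hd] := fin (fun k d => forall u, Jfrom J s u -> t - d < u -> u < t ->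
    `|z u k - l k| <= dl) (fun k => Hl' k dl dl0)
    (fun k d d' _ dd H u Ju ud tu => H u Ju (le_lt_trans (lerB (lexx t) dd) ud) tu) K.
by exists d; split => // u Ju tu ud; apply: Hdl => k kK; exact: Hd.
Qed.

Variable tmax : nat -> R.
Hypothesis tmax_cofinal : forall Tm, Jfrom J s Tm -> \forall n \near \oo, Tm <= tmax n.

(* Locally uniform convergence is Skorohod convergence with the identity as
   time changes. *)
Lemma skorohod_locally_uniform (F : (R -> nat -> Y) -> R) (z : R -> nat -> Y) :
  rcll J s z ->
  (forall wn w, (forall n, rcll J s (wn n)) -> rcll J s w -> skorohod_cvg J s wn w ->
     F (wn n) @[n --> \oo] --> F w) ->
  forall e, 0 < e -> exists n : nat, forall w, rcll J s w ->
    (forall t k, s <= t -> t <= tmax n -> (k < n)%N -> `|w t k - z t k| <= n.+1%:R^-1) ->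
    `|F w - F z| < e.
Proof.
move=> rz HF e e0; apply: contrapT => nex.
(* If no [n] works, the counterexamples agree with [z] to within [n.+1%:R^-1] on [n] coordinates up
   to [tmax n]. They converge to [z], so continuity of [F] at [z] is contradicted. *)
have H n : exists w, [/\ rcll J s w, (forall t k, s <= t -> t <= tmax n -> (k < n)%N ->
    `|w t k - z t k| <= n.+1%:R^-1) & ~ `|F w - F z| < e].
  apply: contrapT => nw; apply: nex; exists n => w rw Hw.
  by apply: contrapT => K; apply: nw; exists w.
have [wn Hwn] := choice H.
have cv : skorohod_cvg J s wn z.
  exists (fun _ => id); split.
    move=> n; split => //; first by move=> u Ju; exists u.
    exact: (@continuous_subspaceT _ _ _ id (fun x => cvg_id)).
  split.
    by move=> e' e'0; apply: nearW => n t _; rewrite subrr normr0.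
  move=> Tm JTm e' e'0; have [K [dl [dl0 Hdl]]] := @rhoinf_lt R Y e' e'0.
  near=> n => t st tT; apply: Hdl => k kK.
  have [_ Hn _] := Hwn n.
  apply: (@le_trans _ _ n.+1%:R^-1).
    apply: Hn => //.
      by apply: le_trans tT _; near: n; exact: tmax_cofinal.
    by apply: leq_trans kK _; near: n; exact: nbhs_infty_ge.
  have : dl^-1 <= n.+1%:R.
    apply: ltW; apply: lt_le_trans (truncnS_gt _) _; rewrite ler_nat ltnS.
    by near: n; exact: nbhs_infty_ge.
  by move=> h; rewrite -[leRHS]invrK lef_pV2 ?posrE ?invr_gt0.
have rwn n : rcll J s (wn n) by case: (Hwn n).
have /cvgrPdist_lt/(_ e e0)[N _ HN] := HF wn z rwn rz cv.
have [_ _] := Hwn N; apply; rewrite distrC.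
exact: HN (leqnn N).
Unshelve. all: by end_near. Qed.

End SkorohodContinuity.

(* The integrands below need not be measurable: the integral of a nonnegative
   function is then the supremum of the integrals of the simple functions below
   it, which is still monotone. *)
Section LowerIntegral.
Local Open Scope ereal_scope.
Context {R : realType} {d : measure_display} {Omega : measurableType d}.
Variable P : probability Omega R.

Import HBNNSimple.

(** [f] need not be measurable, but each simple function below [f] is below [g] off the null set,
    and for these two measurable functions the almost everywhere comparison is available. *)
Lemma lower_integral_le (N : set Omega) (f g : Omega -> \bar R) :
  measurable N -> P N = 0 -> (forall w, 0 <= f w) -> (forall w, 0 <= g w) ->
  measurable_fun setT g -> (forall w, ~ N w -> f w <= g w) ->
  \int[P]_w f w <= \int[P]_w g w.
Proof.
move=> mN PN f0 g0 mg fg; rewrite ge0_integralTE//.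
apply: ge_ereal_sup => _ [h /= hf <-].
rewrite -integralT_nnsfun; apply: ae_ge0_le_integral => //.
- by move=> w _; rewrite lee_fin.
- exact/measurable_EFinP.
exists N; split => // w /= nw; apply: contrapT => Nw; apply: nw => _.
exact: le_trans (hf w) (fg w Nw).
Qed.

(** Setting [g] to 0 on [N] preserves its integral and places it below [f] everywhere, after which
    the two suprema compare directly. *)
Lemma lower_integral_ge (N : set Omega) (f g : Omega -> \bar R) :
  measurable N -> P N = 0 -> (forall w, 0 <= f w) -> (forall w, 0 <= g w) ->
  measurable_fun setT g -> (forall w, ~ N w -> g w <= f w) ->
  \int[P]_w g w <= \int[P]_w f w.
Proof.
move=> mN PN f0 g0 mg fg.
have mNC : measurable (~` N) by exact: measurableC.
have -> : \int[P]_w g w = \int[P]_w (g \_ (~` N)) w.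
  apply: ge0_ae_eq_integral => //.
  - exact/(measurable_restrictT _ mNC).1/measurable_funTS.
  - by move=> w _; exact: erestrict_ge0.
  exists N; split => // w /= nw; apply: contrapT => Nw; apply: nw => _.
  by rewrite patchE mem_set.
rewrite !ge0_integralTE//; last by move=> w; exact: erestrict_ge0.
apply: le_ereal_sup => _ [h /= hf <-]; exists h => // w.
apply: le_trans (hf w) _; rewrite patchE; case: ifPn => //.
by rewrite inE => /fg.
Qed.

(** The integral of a possibly nonmeasurable [f] is the difference of the lower integrals of its
    positive and negative parts. Each part is enclosed between measurable functions that are
    constant on [B] and off [B]; the two parts account for the factor 2. *)
Lemma integral_near_const (N B : set Omega) (f : Omega -> R) (c eta K Dl : R) :
  measurable N -> P N = 0 -> measurable B -> P B <= Dl%:E ->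
  (0 <= eta)%R -> (0 <= K)%R ->
  (forall w, ~ N w -> (`|f w| <= K)%R) -> (`|c| <= K)%R ->
  (forall w, ~ N w -> ~ B w -> (`|f w - c| <= eta)%R) ->
  `| \int[P]_w (f w)%:E - c%:E | <= (2 * (eta + 2 * K * Dl))%:E.
Proof.
move=> mN PN mB PB eta0 K0 fK cK fc.
have main (u : Omega -> R) (b : R) : (forall w, 0 <= u w)%R -> (0 <= b)%R ->
    (b <= K)%R ->
    (forall w, ~ N w -> (u w <= K)%R) ->
    (forall w, ~ N w -> ~ B w -> (`|u w - b| <= eta)%R) ->
    (b - eta - 2 * K * Dl)%:E <= \int[P]_w (u w)%:E <= (b + eta + 2 * K * Dl)%:E.
  move=> u0 b0 bK uK ub.
  have PBf : P B = (fine (P B))%:E by rewrite fineK// fin_num_measure.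
  have PBD : (fine (P B) <= Dl)%R by rewrite -lee_fin -PBf.
  have PB0 : (0 <= fine (P B))%R by exact: fine_ge0.
  have KD : (K * fine (P B) <= K * Dl)%R by rewrite ler_wpM2l.
  have KD0 : (0 <= K * fine (P B))%R by rewrite mulr_ge0.
  have bd : bdmeas (\1_B : Omega -> R) by exact: bdmeas_indic.
  have ExE (a r : R) : \int[P]_w (a + r * \1_B w)%:E = (a + r * fine (P B))%:E.
    have bm : bdmeas (fun w : Omega => r * \1_B w)%R.
      by apply: bdmeasM => //; exact: bdmeas_cst.
    have bs : bdmeas (fun w : Omega => a + r * \1_B w)%R.
      by apply: bdmeasD => //; exact: bdmeas_cst.
    rewrite -[LHS]fineK; last exact: integrable_fin_num (bdmeas_integrable P bs).
    congr EFin; rewrite -[LHS]/(Ex P (fun w => a + r * \1_B w)%R).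
    rewrite ExD//; last exact: bdmeas_cst.
    by rewrite Ex_cst ExZ// Ex_indic.
  have mm (a r : R) : measurable_fun setT (fun w : Omega => (a + r * \1_B w)%:E).
    apply/measurable_EFinP; apply: measurable_funD => //.
    by apply: measurable_funM => //; exact: measurable_indic.
  have i01 w : ((\1_B w : R) = 1 /\ B w \/ (\1_B w : R) = 0 /\ ~ B w)%R.
    by rewrite indicE; case: (pselect (B w)) => Bw; [left; rewrite mem_set|right; rewrite memNset].
  apply/andP; split; last first.
    apply: (@le_trans _ _ (\int[P]_w ((b + eta) + K * \1_B w)%:E)).
      apply: (lower_integral_le mN PN) => //.
      - by move=> w; rewrite lee_fin addr_ge0 ?addr_ge0 ?mulr_ge0// indicE.
      move=> w Nw; rewrite lee_fin; have [[-> Bw]|[-> Bw]] := i01 w.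
        by have := uK w Nw; lra.
      by have := ub w Nw Bw; rewrite ler_norml => /andP[]; lra.
    by rewrite ExE lee_fin; lra.
  (* The lower comparison function, [b - eta] off [B] and 0 on [B], has to be nonnegative; for
     [b < eta] the bound is trivial. *)
  have [bKD|] := leP 0%R (b - eta)%R; last first.
    move=> neg; apply: (@le_trans _ _ 0); last by apply: integral_ge0 => w _; rewrite lee_fin.
    by rewrite lee_fin; lra.
  apply: (@le_trans _ _ (\int[P]_w ((b - eta) + - (b - eta) * \1_B w)%:E)).
    have : ((b - eta) * fine (P B) <= K * fine (P B))%R by rewrite ler_wpM2r//; lra.
    by rewrite ExE lee_fin; lra.
  apply: (lower_integral_ge mN PN) => //.
  - by move=> w; rewrite lee_fin; have [[-> _]|[-> _]] := i01 w; lra.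
  move=> w Nw; rewrite lee_fin; have [[-> Bw]|[-> Bw]] := i01 w.
    by have := u0 w; lra.
  by have := ub w Nw Bw; rewrite ler_norml => /andP[]; lra.
have pos := main (fun w => Num.max (f w) 0)%R (Num.max c 0)%R.
have neg := main (fun w => Num.max (- f w) 0)%R (Num.max (- c) 0)%R.
have mxK (r : R) : (`|r| <= K -> Num.max r 0 <= K)%R.
  by rewrite ler_norml => /andP[_ rK]; rewrite ge_max rK K0.
have mx (r q : R) : (`|Num.max r 0 - Num.max q 0| <= `|r - q|)%R.
  rewrite ler_norml; have := ler_norm (r - q)%R; have := ler_norm (- (r - q))%R.
  rewrite normrN; have [h1|h1] := leP r 0%R; have [h2|h2] := leP q 0%R;
    move=> n1 n2; have := normr_ge0 (r - q)%R => n3; apply/andP; split; lra.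
have {pos} /andP[p1 p2] : (Num.max c 0 - eta - 2 * K * Dl)%:E <=
    \int[P]_w (Num.max (f w) 0)%:E <= (Num.max c 0 + eta + 2 * K * Dl)%:E.
  apply: pos.
  - by move=> w; rewrite le_max lexx orbT.
  - by rewrite le_max lexx orbT.
  - exact: mxK.
  - by move=> w Nw; exact/mxK/fK.
  - by move=> w Nw Bw; apply: le_trans (mx _ _) _; exact: fc.
have {neg} /andP[n1 n2] : (Num.max (- c) 0 - eta - 2 * K * Dl)%:E <=
    \int[P]_w (Num.max (- f w) 0)%:E <= (Num.max (- c) 0 + eta + 2 * K * Dl)%:E.
  apply: neg.
  - by move=> w; rewrite le_max lexx orbT.
  - by rewrite le_max lexx orbT.
  - by apply: mxK; rewrite normrN.
  - by move=> w Nw; apply: mxK; rewrite normrN; exact: fK.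
  - move=> w Nw Bw; apply: le_trans (mx _ _) _; rewrite -opprD normrN; exact: fc.
rewrite integralE.
have -> : \int[P]_w (fun w => (f w)%:E)^\+ w = \int[P]_w (Num.max (f w) 0)%:E.
  by apply: eq_integral => w _; rewrite funeposE EFin_max.
have -> : \int[P]_w (fun w => (f w)%:E)^\- w = \int[P]_w (Num.max (- f w) 0)%:E.
  by apply: eq_integral => w _; rewrite funenegE EFin_max EFinN.
move: p1 p2 n1 n2; case: (\int[P]_w (Num.max (f w) 0)%:E) => [p| |] //.
case: (\int[P]_w (Num.max (- f w) 0)%:E) => [n| |] //.
rewrite !lee_fin => p1 p2 n1 n2.
rewrite ler_norml.
have cE : (c = Num.max c 0 - Num.max (- c) 0)%R.
  by have [h1|h1] := leP c 0%R; have [h2|h2] := leP (- c)%R 0%R; lra.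
by rewrite [in (_ - c)%R]cE; apply/andP; split; lra.
Qed.

End LowerIntegral.

(** * The averaging principle *)

Section Flow.
Context {R : realType} {Y Y1 : completeNormedModType R} {d : measure_display}
        {Omega : measurableType d} {X : finType}.
Variables (iota : {linear Y1 -> Y}) (J : set R) (P : probability Omega R)
  (x : nat -> Omega -> X) (T : nat -> Omega -> R) (Q : X -> X -> R -> R) (rho : X -> R)
  (G : X -> R -> R -> Y -> Y) (Dop : R -> X -> X -> Y -> Y) (tau : R).
Hypothesis J0 : J 0.
Hypothesis Jge0 : forall a, J a -> 0 <= a.
Hypothesis Jconv : forall a b c, J a -> J c -> a <= b -> b <= c -> J b.
Hypothesis iota_cont : continuous iota.
Hypothesis mr : markov_renewal x T P Q.
Hypothesis rho_ge0 : forall z, 0 <= rho z.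
Hypothesis rho1 : \sum_(z : X) rho z = 1.
Hypothesis Pn_cvg : forall z y, Pn Q n z y @[n --> \oo] --> rho y.
Hypothesis tau0 : 0 < tau.
Hypothesis Qtau : forall z y, Pmat Q z y - Q z y tau = 0.
Hypothesis sgG : forall z, inhom_semigroup J (G z).
Hypothesis opD : forall e z y, 0 < e <= 1 -> is_bounded_op (Dop e z y).
Hypothesis D1Y1 : forall f : Y1, inD1 Dop (iota f).
Hypothesis regG : forall z, regular J iota (G z).
Hypothesis cntA : forall z (f : Y1),
  {within J, continuous (fun t => genop J (G z) t (iota f))}.
Hypothesis conG : forall z, contractionB J (G z).
Hypothesis conD : forall e z y v, 0 < e <= 1 -> `|Dop e z y v| <= `|v|.
Hypothesis bdA : forall z, exists C : R, forall u (f : Y1), J u ->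
  `|genop J (G z) u (iota f)| <= C * `|f|.
Hypothesis bdAY1 : forall f : Y1, (forall z, inDA' J iota (G z) f) ->
  exists C : R, forall z u a, J u -> iota a = genop J (G z) u (iota f) -> `|a| <= C.
Variable s : R.
Hypothesis Js : J s.

Let T0 w : T 0%N w = 0.
Proof. by case: mr. Qed.

Let Tlt n w : T n w < T n.+1 w.
Proof. by case: mr. Qed.

Let M := Mrho Q rho.

Let M0 : 0 < M.
Proof. eapply Mrho_gt0; eassumption. Qed.

Let expl : measurable (explosion T) /\ P (explosion T) = 0%E.
Proof. exact: (explosion_null mr rho1 rho_ge0 Pn_cvg tau0 Qtau). Qed.

Let Tlaw : wlaw P T M.
Proof. exact: (time_law mr rho_ge0 Pn_cvg tau0 Qtau). Qed.

Let s0 : 0 <= s.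
Proof. exact: Jge0. Qed.

(** Jumps keep the absolute index of the renewal process and the acceleration keeps its origin [s],
    so that evolutions between arbitrary times after [s] can be concatenated. *)
Definition jtime (eps : R) (w : Omega) (k : nat) : R := s + eps * (T k w - s).
Definition jcnt (eps a : R) (w : Omega) : nat := Nt T (fast s eps a) w.
Definition flow (eps a b : R) (w : Omega) (g : Y) : Y :=
  evol G Dop (x^~ w) (jtime eps w) eps (jcnt eps b w - jcnt eps a w)
    (jcnt eps a w) a b g.

Lemma jtime_mono (eps : R) w k : 0 < eps -> jtime eps w k <= jtime eps w k.+1.
Proof. by move=> e0; rewrite lerD2l ler_pM2l// lerD2r ltW. Qed.

Lemma jtime_step (eps : R) w k : jtime eps w k.+1 - jtime eps w k = eps * (T k.+1 w - T k w).
Proof. by rewrite /jtime; ring. Qed.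

Let jtime_le (eps : R) w k a : 0 < eps -> (jtime eps w k <= a) = (T k w <= fast s eps a).
Proof.
move=> e0; rewrite /jtime /fast -lerBrDl -[RHS]lerBlDl.
by rewrite -(ler_pM2l e0 (T k w - s)) mulrA mulfV ?gt_eqF// mul1r.
Qed.

Let fast_ge0 (eps a : R) : 0 < eps -> s <= a -> 0 <= fast s eps a.
Proof. by move=> e0 sa; rewrite addr_ge0// mulr_ge0 ?invr_ge0 ?subr_ge0// ltW. Qed.

Lemma jcntP (eps a : R) w : 0 < eps -> ~ explosion T w -> s <= a ->
  jtime eps w (jcnt eps a w) <= a /\ a < jtime eps w (jcnt eps a w).+1.
Proof.
move=> e0 ne sa; rewrite ltNge !jtime_le// -ltNge.
exact: NtP (fast_ge0 e0 sa).
Qed.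

Lemma jcnt_eq (eps a : R) w n : 0 < eps -> jtime eps w n <= a ->
  a < jtime eps w n.+1 -> jcnt eps a w = n.
Proof. by move=> e0; rewrite ltNge !jtime_le// -ltNge; exact: Nt_eq. Qed.

Lemma jcnt_mono (eps a b : R) w : 0 < eps -> ~ explosion T w -> s <= a -> a <= b ->
  (jcnt eps a w <= jcnt eps b w)%N.
Proof.
move=> e0 ne sa ab; apply: Nt_mono => //; first exact: fast_ge0.
by rewrite lerD2l ler_pM2l ?invr_gt0// lerD2r.
Qed.

Definition okpath (eps : R) (w : Omega) := 0 < eps <= 1 /\ ~ explosion T w.

Lemma flow_ok (eps a b : R) w : okpath eps w -> J a -> J b -> s <= a -> a <= b ->
  evol_ok J (jtime eps w) (jcnt eps b w - jcnt eps a w) (jcnt eps a w) a b.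
Proof.
move=> [/andP[e0 e1] ne] Ja Jb sa ab.
have [h1 h2] := jcntP e0 ne sa; have [h3 h4] := jcntP e0 ne (le_trans sa ab).
split => //; first exact: ltW.
by rewrite subnKC//; exact: jcnt_mono.
Qed.

Lemma flow_cat (eps a b c : R) w g : okpath eps w -> J a -> J c -> s <= a -> a <= b -> b <= c ->
  flow eps a c w g = flow eps a b w (flow eps b c w g).
Proof.
move=> ok Ja Jc sa ab bc; have [/andP[e0 e1] ne] := ok.
have sb := le_trans sa ab.
have mab := jcnt_mono e0 ne sa ab; have mbc := jcnt_mono e0 ne sb bc.
have [h1 h2] := jcntP e0 ne sa; have [h3 h4] := jcntP e0 ne sb.
have [h5 h6] := jcntP e0 ne (le_trans sb bc).
rewrite /flow (_ : (jcnt eps c w - jcnt eps a w = (jcnt eps b w - jcnt eps a w) +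
   (jcnt eps c w - jcnt eps b w))%N); last by rewrite addnC addnBA// subnK.
have jm n : jtime eps w n <= jtime eps w n.+1 by exact: jtime_mono.
rewrite (@evol_cat _ _ _ _ _ Dop Jconv sgG _ _ eps jm _ _ _ _ b)//.
all: rewrite ?(subnKC mab)// ?(subnKC mbc)//; exact: ltW.
Qed.

Lemma flow_B (eps a b : R) w u v : okpath eps w -> J a -> J b -> s <= a -> a <= b ->
  flow eps a b w (u - v) = flow eps a b w u - flow eps a b w v.
Proof.
move=> ok Ja Jb sa ab; have [e01 _] := ok; have [e0 _] := andP e01.
have jm n : jtime eps w n <= jtime eps w n.+1 by exact: jtime_mono.
exact: (evol_B Jconv sgG opD _ jm e01 _ _ (flow_ok ok Ja Jb sa ab)).
Qed.

Lemma flow_contraction (eps a b : R) w u : okpath eps w -> J a -> J b -> s <= a -> a <= b ->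
  `|flow eps a b w u| <= `|u|.
Proof.
move=> ok Ja Jb sa ab; have [e01 _] := ok; have [e0 _] := andP e01.
have jm n : jtime eps w n <= jtime eps w n.+1 by exact: jtime_mono.
exact: (evol_contraction Jconv conG conD _ jm e01 _ (flow_ok ok Ja Jb sa ab)).
Qed.

Lemma flow_id (eps : R) w u : flow eps s s w u = u.
Proof. by rewrite /flow subnn /=; case: (sgG (x (jcnt eps s w) w)) => _ H _; exact: H. Qed.

(** [Vop] numbers the jumps from [s] on, [flow] from time 0: the k-th jump after [s] has absolute
    index [Nt T s w + k]. Only the starting time [Teps T eps s 0 w = s] is not a value of
    [jtime]. *)
Lemma Vop_flow (eps t : R) w f : okpath eps w -> s <= t ->
  Vop x T G Dop eps s t w f = flow eps s t w f.
Proof.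
move=> [/andP[e0 e1] ne] st.
have fs : fast s eps s = s by rewrite /fast subrr mulr0 addr0.
have xsE k : xs x T s k w = x (Nt T s w + k)%N w.
  rewrite /xs /xt /Ts; case: k => [|k] /=; first by rewrite addn0.
  by rewrite (@Nt_eq _ _ _ _ _ _ _ (Nt T s w + k.+1)%N)//; exact: T_mono.
have TeE k : Teps T eps s k.+1 w = jtime eps w (Nt T s w + k.+1) by [].
have Te0 : Teps T eps s 0 w = s by rewrite /Teps /Ts /= subrr mulr0 addr0.
rewrite /Vop -/(fast s eps t) /Nst /flow /jcnt fs /xt.
have mono : (Nt T s w <= Nt T (fast s eps t) w)%N.
  by have := jcnt_mono e0 ne (lexx s) st; rewrite /jcnt fs.
set N := Nt T s w in xsE TeE mono *; set N' := Nt T (fast s eps t) w in mono *.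
(* Generalized to the product from the factor [m.+1] on, with [l] factors left, so that the
   induction can peel from the left. *)
have gen l m : N' = (N + (m + l))%N ->
   foldr (fun k g => G (xs x T s k.-1 w) (Teps T eps s k.-1 w) (Teps T eps s k w)
                      (Dop eps (xs x T s k.-1 w) (xs x T s k w) g))
        (G (x N' w) (Teps T eps s (m + l) w) t f) (seq.iota m.+1 l) =
   evol G Dop (x^~ w) (jtime eps w) eps l (N + m) (Teps T eps s m w) t f.
  elim: l m => [|l IH] m E /=; first by rewrite E addn0.
  rewrite /= !xsE TeE !addnS; congr (G _ _ _ (Dop _ _ _ _)).
  have := IH m.+1; rewrite addSnnS => /(_ E).
  by rewrite TeE !addnS.
have := gen (N' - N)%N 0%N; rewrite add0n subnKC// => /(_ erefl) ->.
by rewrite addn0 Te0.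
Qed.

Lemma okpath_inprob : inprob P (0 : R)^'+ [set p | okpath p.1 p.2].
Proof.
have [mE PE] := expl.
have H1 : inprob P (0 : R)^'+ [set p | 0 < p.1 < 1].
  by apply: inprob_det; apply: filterS (near0_lt ltr01).
have H2 : inprob P (0 : R)^'+ [set p | ~ explosion T p.2] by exact: (inprob_as mE PE).
by apply: inprobS2 H1 H2 => -[eps w] /= /andP[e0 e1] ne; split => //; rewrite e0 ltW.
Qed.

(** * Laws of large numbers along the accelerated path *)

Lemma jcnt_law (a dl : R) : s <= a -> 0 < dl ->
  inprob P (0 : R)^'+ [set p | `|p.1 * (jcnt p.1 a p.2)%:R - (a - s) / M| <= dl].
Proof.
move=> sa dl0; have W : wlaw P (fun n _ => n%:R) 1.
  move=> e e0; apply: inprob_det; apply: nearW => n w /=.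
  by rewrite mul1r subrr normr0 mulr_ge0// ltW.
have := wlaw_time T0 Tlt expl Tlaw M0 s0 W (fun=> erefl) _ sa dl0; rewrite mul1r; apply.
by move=> n w; rewrite ler_nat.
Qed.

Lemma jumps_between (a b eta : R) : s <= a -> a <= b -> 0 < eta ->
  inprob P (0 : R)^'+ [set p |
    (jcnt p.1 b p.2 - jcnt p.1 a p.2)%:R * p.1 <= (b - a) / M + eta].
Proof.
move=> sa ab eta0; have e2 : 0 < eta / 2 by rewrite divr_gt0.
apply: inprobS3 okpath_inprob (jcnt_law sa e2) (jcnt_law (le_trans sa ab) e2).
move=> -[eps w] /= [/andP[e0 _] ne]; rewrite !ler_norml => /andP[h1 _] /andP[_ h2].
rewrite natrB; last exact: jcnt_mono.
rewrite (_ : (b - a) / M = (b - s) / M - (a - s) / M); last by ring.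
by rewrite mulrBl !(mulrC _ eps); lra.
Qed.

Let path_sum (al : X -> Y1) (be : X -> X -> Y1) (m : nat) (w : Omega) : Y1 :=
  \sum_(k < m) ((T k.+1 w - T k w) *: al (x k w) + be (x k w) (x k.+1 w)).

(** The original path spends in [z] the fraction [rho z * m1 Q z / M] of the time and jumps from [z]
    to [y] at the rate [rho z * Pmat Q z y / M]. For the right [al] and [be] the image in [Y] is the
    averaged generator. *)
Definition mean_drift (al : X -> Y1) (be : X -> X -> Y1) : Y1 :=
  \sum_z ((rho z * m1 Q z / M) *: al z + \sum_y (rho z * Pmat Q z y / M) *: be z y).

Let jumps z y (m : nat) (w : Omega) : R :=
  \sum_(k < m) \1_(x k @^-1` [set z] `&` x k.+1 @^-1` [set y]) w.

Let path_sum_regroup al be m w : path_sum al be m w =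
  \sum_z (occ x T m z w *: al z + \sum_y jumps z y m w *: be z y).
Proof.
elim: m => [|m IH].
  rewrite /path_sum big_ord0 big1// => z _; rewrite /occ big_ord0 scale0r add0r big1// => y _.
  by rewrite /jumps big_ord0 scale0r.
rewrite /path_sum big_ord_recr /= -/(path_sum al be m w) IH.
transitivity (\sum_z ((occ x T m z w *: al z + \sum_y jumps z y m w *: be z y) +
   (((T m.+1 w - T m w) * \1_(x m @^-1` [set z]) w) *: al z +
    \sum_y \1_(x m @^-1` [set z] `&` x m.+1 @^-1` [set y]) w *: be z y))).
  rewrite [RHS]big_split /=; congr (_ + _).
  rewrite [RHS](bigD1 (x m w))//= [X in _ = _ + X]big1 ?addr0; last first.
    move=> z zx; rewrite indicE memNset; last by move=> /= xz; rewrite xz eqxx in zx.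
    rewrite mulr0 scale0r add0r big1// => y _; rewrite indicE memNset ?scale0r//.
    by move=> [/= xz _]; rewrite xz eqxx in zx.
  rewrite indicE mem_set// mulr1; congr (_ + _).
  rewrite (bigD1 (x m.+1 w))//= indicE mem_set// scale1r big1 ?addr0// => y yx.
  by rewrite indicE memNset ?scale0r// => -[/= _ xy]; rewrite xy eqxx in yx.
apply: eq_bigr => z _; rewrite /occ big_ord_recr /= scalerDl -!addrA; congr (_ + _).
rewrite addrCA; congr (_ + _); rewrite -big_split /=; apply: eq_bigr => y _.
by rewrite /jumps big_ord_recr /= scalerDl.
Qed.

(** After regrouping by states, the path sum is a combination of finitely many fixed vectors; the
    scalar coefficients are occupation times and jump counts, nondecreasing in the index, so
    [wlaw_time] applies to each. *)
Lemma path_sum_law al be (a dl : R) : s <= a -> 0 < dl ->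
  inprob P (0 : R)^'+ [set p |
    `|p.1 *: path_sum al be (jcnt p.1 a p.2) p.2 - (a - s) *: mean_drift al be| <= dl].
Proof.
move=> sa dl0.
pose K : R := \sum_z (`|al z| + \sum_y `|be z y|).
have K0 : 0 <= K by apply: sumr_ge0 => z _; rewrite addr_ge0// sumr_ge0.
have K1 : 0 < K + 1 by rewrite ltr_wpDl.
pose eta := dl / (K + 1).
have eta0 : 0 < eta by rewrite divr_gt0.
have H1 : inprob P (0 : R)^'+ [set p | forall z,
   `|p.1 * occ x T (jcnt p.1 a p.2) z p.2 - rho z * m1 Q z * ((a - s) / M)| <= eta].
  apply: inprob_fin => z.
  apply: (wlaw_time T0 Tlt expl Tlaw M0 s0 (occ_law mr rho_ge0 Pn_cvg tau0 Qtau z)) => //.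
    by move=> w; rewrite /occ big_ord0.
  move=> n w; rewrite /occ big_ord_recr /= lerDl mulr_ge0 ?indicE// subr_ge0.
  exact: ltW.
have H2 : inprob P (0 : R)^'+ [set p | forall q : X * X,
   `|p.1 * jumps q.1 q.2 (jcnt p.1 a p.2) p.2 - rho q.1 * Pmat Q q.1 q.2 * ((a - s) / M)| <= eta].
  apply: inprob_fin => -[z y] /=.
  apply: (wlaw_time T0 Tlt expl Tlaw M0 s0 (jump_law mr Pn_cvg Qtau z y)) => //.
    by move=> w; rewrite big_ord0.
  by move=> n w; rewrite big_ord_recr /= lerDl indicE.
apply: inprobS2 H1 H2 => -[eps w] /= H1 H2.
rewrite path_sum_regroup /mean_drift !scaler_sumr -sumrB.
apply: (@le_trans _ _ (eta * K)); last first.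
  rewrite /eta -mulrA ger_pMr// mulrC ler_pdivrMr// mul1r lerDl//.
apply: le_trans (ler_norm_sum _ _ _) _; rewrite mulr_sumr; apply: ler_sum => z _.
rewrite !scalerDr !scalerA opprD addrACA -scalerBl.
apply: le_trans (ler_normD _ _) _; rewrite mulrDr; apply: lerD.
  rewrite normrZ ler_wpM2r// (_ : (a - s) * _ = rho z * m1 Q z * ((a - s) / M)); last by ring.
  exact: H1.
rewrite !scaler_sumr -sumrB; apply: le_trans (ler_norm_sum _ _ _) _.
rewrite mulr_sumr; apply: ler_sum => y _; rewrite !scalerA -scalerBl normrZ ler_wpM2r//.
rewrite (_ : (a - s) * _ = rho z * Pmat Q z y * ((a - s) / M)); last by ring.
exact: (H2 (z, y)).
Qed.

Lemma drift_law al be (a b dl : R) : s <= a -> a <= b -> 0 < dl ->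
  inprob P (0 : R)^'+ [set p |
    `|drift (x^~ p.2) (jtime p.1 p.2) p.1 al be (jcnt p.1 b p.2 - jcnt p.1 a p.2)
       (jcnt p.1 a p.2) a b - (b - a) *: mean_drift al be| <= dl].
Proof.
move=> sa ab dl0; have sb := le_trans sa ab.
pose K : R := \sum_z `|al z|.
have K0 : 0 <= K by exact: sumr_ge0.
have alK z : `|al z| <= K by rewrite /K (bigD1 z)//= lerDl sumr_ge0.
have K1 : 0 < K + 1 by rewrite ltr_wpDl.
(* Four errors of [dl / 4]: the path sums at [a] and at [b], and the unfinished sojourns at [a] and
   at [b], each at most [eps * tau] long. *)
have d4 : 0 < dl / 4 by rewrite divr_gt0.
have q0 : 0 < dl / 4 / (tau * (K + 1)) by rewrite !divr_gt0// mulr_gt0.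
have [mB PB] := bad_soj_null mr Qtau.
have H1 : inprob P (0 : R)^'+ [set p | 0 < p.1 < dl / 4 / (tau * (K + 1))].
  by apply: inprob_det; apply: filterS (near0_lt q0).
have H2 : inprob P (0 : R)^'+ [set p | ~ bad_soj T tau p.2] by exact: (inprob_as mB PB).
apply: inprobS3 (inprobI okpath_inprob (inprobI H1 H2)) (path_sum_law al be sa d4)
  (path_sum_law al be sb d4).
move=> -[eps w] /= [ok [/andP[e0 esm] nb]] h1 h2.
have [e01 ne] := ok.
have soj k : T k.+1 w - T k w <= tau.
  by rewrite leNgt; apply/negP => h; apply: nb; exists k.
have bnd c : s <= c -> `|(c - jtime eps w (jcnt eps c w)) *: al (x (jcnt eps c w) w)| <= dl / 4.
  move=> sc; have [j1 j2] := jcntP e0 ne sc.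
  rewrite normrZ ger0_norm ?subr_ge0//.
  have j3 : c - jtime eps w (jcnt eps c w) <= eps * tau.
    have := jtime_step eps w (jcnt eps c w).
    have : eps * (T (jcnt eps c w).+1 w - T (jcnt eps c w) w) <= eps * tau by rewrite ler_pM2l.
    by lra.
  apply: (@le_trans _ _ (eps * tau * (K + 1))).
    apply: ler_pM => //; first by rewrite subr_ge0.
    by apply: le_trans (alK _) _; rewrite lerDl.
  by move: esm; rewrite ltr_pdivlMr ?mulr_gt0// mulrA => /ltW.
have mab := jcnt_mono e0 ne sa ab.
rewrite (@drift_sum _ _ _ (x^~ w) _ _ al be (fun k => T k.+1 w - T k w)); last first.
  by move=> k; exact: jtime_step.
rewrite (subnKC mab) -/(path_sum al be (jcnt eps b w) w) -/(path_sum al be (jcnt eps a w) w).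
have ba := bnd a sa; have bb := bnd b sb.
move: h1 h2 ba bb.
set Sa := path_sum _ _ _ _; set Sb := path_sum _ _ _ _; set v := mean_drift _ _.
set Ba := _ *: al _; set Bb := _ *: al _ => h1 h2 ba bb.
rewrite (_ : _ + _ - _ = ((eps *: Sb - (b - s) *: v) - (eps *: Sa - (a - s) *: v)) + (Bb - Ba)).
  apply: le_trans (ler_normD _ _) _.
  have := ler_normB (eps *: Sb - (b - s) *: v) (eps *: Sa - (a - s) *: v).
  have := ler_normB Bb Ba.
  by lra.
rewrite (_ : b - a = (b - s) - (a - s)); last by ring.
by rewrite !scalerBr !scalerBl; zmodule.
Qed.

(** * First-order expansion of the evolution over a short interval *)

Lemma lipschitz_const : exists C : R, [/\ 0 <= C,
  (forall z a b g, J a -> J b -> a <= b ->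
     `|G z a b (iota g) - iota g| <= C * (b - a) * `|g|) &
  (forall e z y g, 0 < e <= 1 -> `|Dop e z y (iota g) - iota g| <= C * e * `|g|)].
Proof.
have [C1 C10 H1] := semigroups_lipschitz Jconv sgG conG regG bdA.
have [C2 C20 H2] := jumps_lipschitz iota_cont opD conD D1Y1.
exists (C1 + C2); split; first exact: addr_ge0.
  move=> z a b g Ja Jb ab; apply: le_trans (H1 z a b g Ja Jb ab) _.
  by rewrite ler_wpM2r// ler_wpM2r ?subr_ge0// lerDl.
move=> e z y g e01; apply: le_trans (H2 e z y g e01) _.
by rewrite ler_wpM2r// ler_wpM2r ?lerDr// ltW//; case/andP: e01.
Qed.

Lemma flow_lip C (eps a b : R) w g :
  (forall z a b g, J a -> J b -> a <= b ->
     `|G z a b (iota g) - iota g| <= C * (b - a) * `|g|) ->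
  (forall e z y g, 0 < e <= 1 -> `|Dop e z y (iota g) - iota g| <= C * e * `|g|) ->
  okpath eps w -> J a -> J b -> s <= a -> a <= b ->
  `|flow eps a b w (iota g) - iota g| <=
    C * (b - a + (jcnt eps b w - jcnt eps a w)%:R * eps) * `|g|.
Proof.
move=> lipG lipD ok Ja Jb sa ab; have [e01 _] := ok; have [e0 _] := andP e01.
have jm n : jtime eps w n <= jtime eps w n.+1 by exact: jtime_mono.
apply: (evol_lip Jconv sgG opD conG conD _ jm e01 lipG _ _ (flow_ok ok Ja Jb sa ab)).
by move=> z y h; exact: lipD.
Qed.

(** Here [D] is the elapsed time and [L] adds to it [eps] times the number of jumps. The quadratic
    error splits into [D] times a factor that is small with [D] and [ze], and a multiple of [eta],
    the fluctuation of the number of jumps. *)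
Let quad_bound (D eta L A ze ka : R) : 0 <= D <= 1 -> 0 <= eta <= 1 -> 0 <= L ->
  L <= ka * D + eta -> 0 <= A -> 0 <= ze -> 1 <= ka ->
  L * (A * L + ze) <= D * (ka * (A * ka * D + ze)) + eta * (A * (2 * ka + 1) + ze).
Proof.
move=> /andP[D0 D1] /andP[eta0 eta1] L0 LD A0 ze0 ka1.
have ka0 : 0 <= ka by apply: le_trans ka1.
have kD : ka * D <= ka by rewrite ger_pMr//; lra.
apply: (@le_trans _ _ ((ka * D + eta) * (A * (ka * D + eta) + ze))).
  apply: ler_pM => //; first by rewrite addr_ge0// mulr_ge0.
  by rewrite lerD2r ler_wpM2l.
rewrite (_ : (ka * D + eta) * _ = D * (ka * (A * ka * D + ze)) +
  eta * (A * (2 * (ka * D) + eta) + ze)); last by ring.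
rewrite lerD2l ler_wpM2l// lerD2r ler_wpM2l//; lra.
Qed.

Let half_div (q e : R) : q != 0 -> q * (e / (2 * q)) = e / 2.
Proof. by move=> q0; field. Qed.

Lemma mean_drift_Ahat u g al be :
  (forall z, iota (al z) = genop J (G z) u (iota g)) ->
  (forall z y, iota (be z y) = D1 Dop 0 z y (iota g)) ->
  iota (mean_drift al be) = Ahat Q rho J G Dop u (iota g).
Proof.
move=> alE beE; rewrite /mean_drift /Ahat raddf_sum; apply: eq_bigr => z _.
rewrite raddfD /= linearZ alE /a_op -/M scalerA scalerDr scalerA; congr (_ *: _ + _).
  by ring.
rewrite raddf_sum scaler_sumr; apply: eq_bigr => y _.
transitivity ((rho z * Pmat Q z y / M) *: iota (be z y)); first exact: linearZ.
by rewrite beE scalerA; congr (_ *: _); ring.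
Qed.

(** In [G z a v (A v g)], with [A v] short for [genop J (G z) v], the vector [A v g] comes from [Y1]
    with a norm bounded in [v], so the Lipschitz estimate removes [G z a v]; continuity of the
    generator then replaces [v] by [u]. *)
Lemma generator_local g : (forall z, inDA' J iota (G z) g) -> forall u ze, J u -> 0 < ze ->
  exists2 de, 0 < de & forall z a b, J a -> u - de < a -> a <= b -> b <= u ->
  `|G z a b (iota g) - iota g - (b - a) *: genop J (G z) u (iota g)| <= ze * (b - a).
Proof.
move=> DAg u ze Ju ze0.
have [C [C0 lipG _]] := lipschitz_const.
have [K0 HK0] := bdAY1 DAg; pose K := `|K0|.
have ze2 : 0 < ze / 2 by rewrite divr_gt0.
have contz z : exists2 de, 0 < de & forall v, J v -> `|v - u| < de ->
   `|genop J (G z) v (iota g) - genop J (G z) u (iota g)| < ze / 2.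
  exact: (within_continuousP (@cntA z g) Ju).
have [de1 de10 Hde1] : exists2 de, 0 < de & forall z v, J v -> `|v - u| < de ->
   `|genop J (G z) v (iota g) - genop J (G z) u (iota g)| < ze / 2.
  suff [de de0 H] : exists2 de, 0 < de & forall z, z \in enum X -> forall v, J v ->
      `|v - u| < de -> `|genop J (G z) v (iota g) - genop J (G z) u (iota g)| < ze / 2.
    by exists de => // z; apply: H; rewrite mem_enum.
  elim: (enum X) => [|z l [de de0 IH]]; first by exists 1.
  have [de' de'0 H'] := contz z.
  exists (Num.min de de'); first by rewrite lt_min de0.
  move=> y; rewrite in_cons => /predU1P[->|/IH H] v Jv; rewrite lt_min => /andP[h1 h2].
    exact: H'.
  exact: H.
pose de2 := ze / 2 / (C * K + 1).
have CK0 : 0 <= C * K by rewrite mulr_ge0// normr_ge0.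
have de20 : 0 < de2 by rewrite divr_gt0// ltr_wpDl.
exists (Num.min de1 de2); first by rewrite lt_min de10.
move=> z a b Ja ua ab bu.
have /andP[ua1 ua2] : (u - de1 < a) && (u - de2 < a).
  have m1 : Num.min de1 de2 <= de1 by rewrite ge_min lexx.
  have m2 : Num.min de1 de2 <= de2 by rewrite ge_min lexx orbT.
  by apply/andP; split; lra.
have Jb : J b by apply: (Jconv Ja Ju ab bu).
apply: (generator_mean_value Jconv (sgG z) (@conG z)) => //.
  by case: (regG z).
move=> v av vb; have Jv : J v by exact: (Jconv Ja Jb av vb).
exists (genop J (G z) v (iota g)); first by case: (genopP regG z g Jv).
have [_ [av' [Hav _]]] := DAg z.
have aK : `|av' v| <= K by apply: le_trans (HK0 z v _ Jv (Hav v Jv)) (ler_norm _).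
have h1 := lipG z a v (av' v) Ja Jv av; rewrite (Hav v Jv) in h1.
have h2 := Hde1 z v Jv; rewrite distrC ger0_norm ?subr_ge0 ?(le_trans vb)// in h2.
have {}h2 := h2 ltac:(lra).
have h3 : C * (v - a) * `|av' v| <= ze / 2.
  apply: (@le_trans _ _ (C * K * de2)).
    rewrite mulrAC; apply: ler_pM => //; rewrite ?mulr_ge0 ?subr_ge0//.
      by rewrite ler_wpM2l.
    by lra.
  by rewrite /de2 mulrCA ger_pMr// ler_pdivrMr ?ltr_wpDl// mul1r lerDl.
have := ler_normD (G z a v (genop J (G z) v (iota g)) - genop J (G z) v (iota g))
  (genop J (G z) v (iota g) - genop J (G z) u (iota g)).
by rewrite addrA subrK; lra.
Qed.

(** The order of quantifiers matters: [de] depends on [e] and not on [dl], so random fluctuations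
    are made small after the interval has been fixed and do not restrict its length. *)
Lemma consistency_Dhat g u e : Dhat J iota G Dop g -> J u -> s < u -> 0 < e ->
  exists2 de, 0 < de & forall a, s <= a -> u - de < a -> a <= u -> forall dl, 0 < dl ->
  inprob P (0 : R)^'+ [set p |
    `|flow p.1 a u p.2 (iota g) - iota g - (u - a) *: Ahat Q rho J G Dop u (iota g)| <=
      e * (u - a) + dl].
Proof.
move=> [DAg _ [_ DY]] Ju su e0.
have [C [C0 lipG lipD]] := lipschitz_const.
have [Ci Ci0 HCi] := iota_bounded iota_cont.
have /choice[al alE] : forall z, exists a : Y1, iota a = genop J (G z) u (iota g).
  by move=> z; have [_ [av [Hav _]]] := DAg z; exists (av u); exact: Hav.
have [be beE] : exists be : X -> X -> Y1, forall z y, iota (be z y) = D1 Dop 0 z y (iota g).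
  have /choice[be Hbe] : forall q : X * X, exists b : Y1, iota b = D1 Dop 0 q.1 q.2 (iota g).
    by move=> [z y]; exact: DY.
  by exists (fun z y => be (z, y)) => z y; rewrite Hbe.
pose K : R := \sum_z `|al z| + \sum_(q : X * X) `|be q.1 q.2|.
have alK z : `|al z| <= K.
  rewrite /K (bigD1 z)//= -addrA lerDl addr_ge0// ?sumr_ge0//.
have beK z y : `|be z y| <= K.
  rewrite /K addrC (bigD1 (z, y))//= -addrA lerDl addr_ge0// ?sumr_ge0//.
have K0 : 0 <= K by rewrite addr_ge0 ?sumr_ge0.
pose ka : R := 1 + M^-1.
have ka1 : 1 <= ka by rewrite lerDl invr_ge0 ltW.
have ka0 : 0 < ka by apply: lt_le_trans ka1.
(* [ze] makes [ka * ze = e / 2]; [de2] below makes the quadratic part [ka * (A * ka * (u - a))] at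
   most [e / 2]. *)
pose ze : R := e / (2 * ka).
have ze0 : 0 < ze by rewrite divr_gt0// mulr_gt0.
have [de1 de10 Hde1] := generator_local DAg Ju ze0.
pose A : R := C * K.
have A0 : 0 <= A by rewrite mulr_ge0.
pose de2 : R := e / (2 * (A * ka * ka + 1)).
have q0 : 0 < A * ka * ka + 1 by rewrite ltr_wpDl// !mulr_ge0// ltW.
have de20 : 0 < de2 by rewrite divr_gt0// mulr_gt0.
exists (Num.min (Num.min de1 de2) 1); first by rewrite !lt_min de10 de20 ltr01.
move=> a sa ua au dl dl0.
have /and3P[ua1 ua2 ua3] : [&& u - de1 < a, u - de2 < a & u - 1 < a].
  have m1 : Num.min (Num.min de1 de2) 1 <= de1 by rewrite !ge_min lexx.
  have m2 : Num.min (Num.min de1 de2) 1 <= de2 by rewrite !ge_min lexx !orbT.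
  have m3 : Num.min (Num.min de1 de2) 1 <= 1 by rewrite !ge_min lexx !orbT.
  by apply/and3P; split; lra.
have Ja : J a by exact: (Jconv Js Ju sa au).
pose r := A * (2 * ka + 1) + ze.
have r0 : 0 < r by rewrite ltr_wpDl// mulr_ge0// addr_ge0// mulr_ge0// ltW.
pose eta : R := Num.min 1 (dl / 2 / r).
have eta0 : 0 < eta by rewrite lt_min ltr01 !divr_gt0.
have eta1 : eta <= 1 by rewrite ge_min lexx.
have etar : eta * r <= dl / 2 by rewrite -ler_pdivlMr// ge_min lexx orbT.
have dli : 0 < dl / 2 / Ci by rewrite !divr_gt0.
have Hd : inprob P (0 : R)^'+ [set p | forall q : X * X, p.1 <= 1 -> 0 < p.1 ->
    `|Dop p.1 q.1 q.2 (iota g) - iota g - p.1 *: iota (be q.1 q.2)| <= ze * p.1].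
  apply: inprob_fin => -[z y] /=; have [dd dd0 Hdd] := D1_approx D1Y1 z y g ze0.
  apply: inprob_det; apply: filterS (near0_lt dd0) => eps /andP[h1 h2] w /= h3 h4.
  by rewrite beE; exact: Hdd.
apply: inprobS3 (inprobI okpath_inprob Hd) (jumps_between sa au eta0)
  (drift_law al be sa au dli).
move=> -[eps w] /= [ok H1] H2 H3.
have [e01 ne] := ok; have [ep0 ep1] := andP e01.
have jm n : jtime eps w n <= jtime eps w n.+1 by exact: jtime_mono.
set l := (jcnt eps u w - jcnt eps a w)%N in H2 H3 *.
have L0 : 0 <= u - a + l%:R * eps by rewrite addr_ge0 ?subr_ge0// mulr_ge0// ltW.
have Lk : u - a + l%:R * eps <= ka * (u - a) + eta.
  by rewrite /ka mulrDl mul1r (mulrC M^-1); lra.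
have := evol_expand Jconv sgG opD conG conD (x^~ w) jm e01 C0 lipG
  (fun z y h => lipD eps z y h e01) alK beK (fun z y => H1 (z, y) ep1 ep0)
  (flow_ok ok Ja Ju sa au) _ (lexx _).
rewrite -/(flow eps a u w (iota g)) -/l => X1.
have {}X1 : `|flow eps a u w (iota g) - iota g -
   iota (drift (x^~ w) (jtime eps w) eps al be l (jcnt eps a w) a u)| <=
   (u - a + l%:R * eps) * (C * K * (u - a + l%:R * eps) + ze).
  apply: X1 => z a' b' aa ab bu; rewrite alE; apply: Hde1 => //; last by lra.
  by apply: (Jconv Ja Ju aa); lra.
have D01 : 0 <= u - a <= 1 by apply/andP; split; lra.
have X2 := quad_bound D01 (introT andP (conj (ltW eta0) eta1)) L0 Lk A0 (ltW ze0) ka1.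
have X3 : ka * (A * ka * (u - a) + ze) <= e.
  have y1 : ka * ze = e / 2 by rewrite /ze; field; rewrite gt_eqF.
  have y2 : ka * (A * ka * (u - a)) <= e / 2.
    rewrite (_ : ka * _ = A * ka * ka * (u - a)); last by ring.
    apply: (@le_trans _ _ ((A * ka * ka + 1) * de2)).
      apply: ler_pM; rewrite ?subr_ge0 ?lerDl//; first by rewrite !mulr_ge0// ltW.
      by lra.
    by rewrite /de2 half_div// gt_eqF.
  by rewrite mulrDr; lra.
have X4 : `|iota (drift (x^~ w) (jtime eps w) eps al be l (jcnt eps a w) a u) -
   (u - a) *: Ahat Q rho J G Dop u (iota g)| <= dl / 2.
  rewrite -(mean_drift_Ahat alE beE) -linearZ -linearB.
  apply: le_trans (HCi _) _; rewrite mulrC -ler_pdivlMr//.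
have X5 : (u - a) * (ka * (A * ka * (u - a) + ze)) <= e * (u - a).
  by rewrite mulrC ler_wpM2r// subr_ge0.
have := ler_normD (flow eps a u w (iota g) - iota g -
   iota (drift (x^~ w) (jtime eps w) eps al be l (jcnt eps a w) a u))
  (iota (drift (x^~ w) (jtime eps w) eps al be l (jcnt eps a w) a u) -
   (u - a) *: Ahat Q rho J G Dop u (iota g)).
rewrite addrA subrK -/A in X1 * => /le_trans; apply.
rewrite -/r in X2; lra.
Qed.

Lemma Ahat_lipschitz : exists2 C : R, 0 <= C & forall u f g, J u -> 0 < u ->
  `|Ahat Q rho J G Dop u (iota f) - Ahat Q rho J G Dop u (iota g)| <= C * `|f - g|.
Proof.
have [C [C0 lipG lipD]] := lipschitz_const.
pose D : R := \sum_z rho z * (M^-1 * (`|m1 Q z| * C + \sum_y `|Pmat Q z y| * C)).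
have Mi0 : 0 <= M^-1 by rewrite invr_ge0 ltW.
exists D.
  apply: sumr_ge0 => z _; rewrite mulr_ge0// mulr_ge0// addr_ge0 ?mulr_ge0//.
  by apply: sumr_ge0 => y _; rewrite mulr_ge0.
move=> u f g Ju u0; rewrite /Ahat -sumrB /D mulr_suml.
apply: le_trans (ler_norm_sum _ _ _) _; apply: ler_sum => z _.
rewrite -scalerBr normrZ ger0_norm// -mulrA ler_wpM2l//.
rewrite /a_op -scalerBr normrZ (ger0_norm Mi0) -mulrA ler_wpM2l//.
rewrite opprD addrACA -scalerBr -sumrB mulrDl.
apply: le_trans (ler_normD _ _) _; apply: lerD.
  rewrite normrZ -mulrA ler_wpM2l//.
  exact: (genop_lipschitz Jconv sgG regG f g (lipG z) Ju J0 u0).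
apply: le_trans (ler_norm_sum _ _ _) _; rewrite mulr_suml; apply: ler_sum => y _.
rewrite -scalerBr normrZ -mulrA ler_wpM2l//.
by apply: (D1_lipschitz opD D1Y1) => ep h ep01; exact: lipD.
Qed.

Variable Dense : set Y1.
Hypothesis DenseD : Dense `<=` Dhat J iota G Dop.
Hypothesis Dense_closure : closure Dense = setT.

(** Both the evolution and the averaged generator respond to the approximation error [f - g] by at
    most a multiple of [|f - g| * (u - a)], up to [dl]. The expansion therefore extends by density
    with an error still proportional to [u - a]. *)
Lemma consistency f u e : J u -> s < u -> 0 < e ->
  exists2 de, 0 < de & forall a, s <= a -> u - de < a -> a <= u -> forall dl, 0 < dl ->
  inprob P (0 : R)^'+ [set p |
    `|flow p.1 a u p.2 (iota f) - iota f - (u - a) *: Ahat Q rho J G Dop u (iota f)| <=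
      e * (u - a) + dl].
Proof.
move=> Ju su e0.
have [C [C0 lipG lipD]] := lipschitz_const.
have [CA CA0 HCA] := Ahat_lipschitz.
have u0 : 0 < u by apply: le_lt_trans su; exact: s0.
pose ka : R := 1 + M^-1.
have ka0 : 0 < ka by rewrite ltr_pwDl// invr_ge0 ltW.
pose r := C * ka + CA + 1.
have r0 : 0 < r by rewrite ltr_wpDl// addr_ge0// mulr_ge0// ltW.
have e2 : 0 < e / 2 by rewrite divr_gt0.
have [g Dg fg] : exists2 g, Dense g & `|f - g| <= e / 2 / r.
  have : closure Dense f by rewrite Dense_closure.
  move=> /(_ (ball f (e / 2 / r))); case.
    by apply: nbhsx_ballx; rewrite !divr_gt0.
  by move=> g [Dg]; rewrite -ball_normE /= => /ltW; exists g.
have [de de0 Hde] := consistency_Dhat (DenseD Dg) Ju su e2.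
exists de => // a sa ua au dl dl0.
have dl2 : 0 < dl / 2 by rewrite divr_gt0.
have q0 : 0 < C * `|f - g| + 1 by rewrite ltr_wpDl// mulr_ge0.
have eta0 : 0 < dl / 2 / (C * `|f - g| + 1) by rewrite divr_gt0.
have Ja : J a by exact: (Jconv Js Ju sa au).
apply: inprobS3 okpath_inprob (Hde a sa ua au _ dl2) (jumps_between sa au eta0).
move=> -[eps w] /= ok H1 H2.
have H3 := flow_lip (f - g) lipG lipD ok Ja Ju sa au.
have H4 := HCA u f g Ju u0.
rewrite raddfB (flow_B _ _ ok Ja Ju sa au) in H3.
set l := (jcnt eps u w - jcnt eps a w)%N in H2 H3 *.
have H5 : C * (u - a + l%:R * eps) * `|f - g| <= C * ka * `|f - g| * (u - a) + dl / 2.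
  have : u - a + l%:R * eps <= ka * (u - a) + dl / 2 / (C * `|f - g| + 1).
    by rewrite /ka mulrDl mul1r (mulrC M^-1); lra.
  move=> h; have : C * `|f - g| * (u - a + l%:R * eps) <=
      C * `|f - g| * (ka * (u - a) + dl / 2 / (C * `|f - g| + 1)).
    by rewrite ler_wpM2l// mulr_ge0.
  have : C * `|f - g| * (dl / 2 / (C * `|f - g| + 1)) <= dl / 2.
    by rewrite mulrCA ger_pMr// ler_pdivrMr// mul1r lerDl.
  lra.
have H6 : (u - a) * `|Ahat Q rho J G Dop u (iota f) - Ahat Q rho J G Dop u (iota g)| <=
    CA * `|f - g| * (u - a).
  by rewrite mulrC ler_wpM2r// subr_ge0.
have H7 : (C * ka + CA) * `|f - g| * (u - a) <= e / 2 * (u - a).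
  rewrite ler_wpM2r ?subr_ge0//; apply: (@le_trans _ _ (r * (e / 2 / r))).
    by apply: ler_pM => //; rewrite ?lerDl// addr_ge0// mulr_ge0// ltW.
  by rewrite mulrCA divff ?mulr1// gt_eqF.
move: H1 H3 H6.
set Ff := flow _ _ _ _ (iota f); set Fg := flow _ _ _ _ (iota g).
set Af := Ahat _ _ _ _ _ _ (iota f); set Ag := Ahat _ _ _ _ _ _ (iota g) => H1 H3 H6.
rewrite (_ : _ - _ - _ = (Ff - Fg - (iota f - iota g)) + (Fg - iota g - (u - a) *: Ag) -
   (u - a) *: (Af - Ag)); last by rewrite scalerBr; zmodule.
apply: le_trans (ler_normB _ _) _; apply: le_trans (lerD (ler_normD _ _) (lexx _)) _.
rewrite normrZ (ger0_norm (_ : 0 <= u - a)) ?subr_ge0//.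
lra.
Qed.

(** * Comparison with the limit semigroup *)

Variable Ghat : R -> R -> Y -> Y.
Hypothesis sgH : inhom_semigroup J Ghat.
Hypothesis regH : regular J iota Ghat.
Hypothesis genH : forall t (f : Y1), J t ->
  genop J Ghat t (iota f) = Ahat Q rho J G Dop t (iota f).

Let ka : R := 1 + M^-1.

Let ka1 : 1 <= ka.
Proof. by rewrite lerDl invr_ge0 ltW. Qed.

(** The jump count is nondecreasing in time, so the count at [b'] controls all [t] in the interval
    at once. The constant [A] does not depend on the interval. *)
Lemma flow_lip_inprob f (dl : R) : 0 < dl ->
  exists2 A : R, 0 <= A & (forall a' b', J b' -> s <= a' -> a' <= b' -> inprob P (0 : R)^'+
    [set p | forall t, a' <= t -> t <= b' ->
      `|flow p.1 a' t p.2 (iota f) - iota f| <= A * (b' - a') + dl]).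
Proof.
move=> dl0; have [C [C0 lipG lipD]] := lipschitz_const.
have Cf0 : 0 <= C * `|f| by rewrite mulr_ge0.
exists (C * `|f| * ka); first by rewrite mulr_ge0// (le_trans _ ka1).
move=> a' b' Jb' sa' ab'.
have Ja' : J a' by exact: (Jconv Js Jb' sa' ab').
have eta0 : 0 < dl / (C * `|f| + 1) by rewrite divr_gt0// ltr_wpDl.
apply: inprobS2 okpath_inprob (jumps_between sa' ab' eta0) => -[eps w] /= ok H t at' tb.
have [/andP[e0 _] ne] := ok.
have Jt : J t by exact: (Jconv Ja' Jb' at' tb).
apply: le_trans (flow_lip f lipG lipD ok Ja' Jt sa' at') _.
rewrite mulrAC; apply: (@le_trans _ _ (C * `|f| * (ka * (b' - a') + dl / (C * `|f| + 1)))).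
  rewrite ler_wpM2l//.
  have : (jcnt eps t w - jcnt eps a' w)%:R * eps <= (jcnt eps b' w - jcnt eps a' w)%:R * eps.
    rewrite ler_wpM2r ?(ltW e0)// ler_nat leq_sub2r// jcnt_mono//.
    exact: le_trans at'.
  by rewrite /ka mulrDl mul1r (mulrC M^-1); lra.
rewrite mulrDr mulrA lerD2l mulrCA ger_pMr// ler_pdivrMr ?ltr_wpDl//.
by rewrite mul1r lerDl.
Qed.

Lemma flow_converges f (t dl : R) : J t -> s <= t -> 0 < dl ->
  inprob P (0 : R)^'+ [set p | `|flow p.1 s t p.2 (iota f) - Ghat s t (iota f)| <= dl].
Proof.
move=> Jt st dl0; have [opH H1 H2] := sgH.
have [Ci Ci0 HCi] := iota_bounded iota_cont.
have [domH _ /(_ t f Jt)[Ff [HF cF]] _ _] := regH.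
pose phi u := Ghat u t (iota f).
pose e : R := dl / 2 / (t - s + 1).
have e0 : 0 < e by rewrite !divr_gt0// ltr_wpDl// subr_ge0.
have Ju u : s <= u -> u <= t -> J u by move=> su ut; exact: (Jconv Js Jt su ut).
have phiE u : s <= u -> u <= t -> phi u = iota (Ff u).
  by move=> su ut; rewrite HF//; split => //; exact: Ju.
(* The total error allowed at rate [e] is [e * (t - s) <= dl / 2]. Since [dl'] is quantified inside
   [S], each use of [S u] may start from a fraction of it. *)
pose S (a : R) := forall dl', 0 < dl' -> inprob P (0 : R)^'+ [set p |
  `|flow p.1 s t p.2 (iota f) - flow p.1 s a p.2 (phi a)| <= e * (t - a) + dl'].
suff Ss : S s.
  have d2 : 0 < dl / 2 by rewrite divr_gt0.
  apply: inprobS (Ss _ d2) => -[eps w] /=; rewrite flow_id => /le_trans; apply.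
  have : e * (t - s) <= dl / 2.
    by rewrite /e -mulrA ger_pMr// mulrC ler_pdivrMr ?mul1r ?lerDl// ltr_wpDl// subr_ge0.
  by lra.
apply: (@real_induction_down R s t S) => //.
- move=> dl' dl'0; apply: inprob_det; apply: nearW => eps w /=.
  by rewrite /phi H1// subrr normr0 subrr mulr0 add0r ltW.
(* To the left of [u], the change of the interpolation is [flow s a] applied to
   [flow a u (phi u) - phi a]. Both terms have the same expansion
   [phi u + (u - a) *: Ahat u (phi u)], which cancels, and [flow s a] is a contraction. *)
- move=> u su ut Su; have e2 : 0 < e / 2 by rewrite divr_gt0.
  have Juu := Ju u (ltW su) ut.
  have [de de0 Hde] := consistency (Ff u) Juu su e2.
  have [_ gl] : gen_right J Ghat u (phi u) (Ahat Q rho J G Dop u (phi u)) /\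
      gen_left J Ghat u (phi u) (Ahat Q rho J G Dop u (phi u)).
    rewrite (phiE u (ltW su) ut) -genH//.
    have [g Hg] := domH u (Ff u) Juu.
    by apply: (@xgetPex _ 0 [set g | gen_right J Ghat u (iota (Ff u)) g /\
      gen_left J Ghat u (iota (Ff u)) g]); exists g.
  have [d1 [d10 Hd1]] := gl _ e2.
  exists (Num.min de d1); first by rewrite lt_min de0.
  move=> a au ua sa dl' dl'0.
  have /andP[ua1 ua2] : (u - de < a) && (u - d1 < a).
    have m1 : Num.min de d1 <= de by rewrite ge_min lexx.
    have m2 : Num.min de d1 <= d1 by rewrite ge_min lexx orbT.
    by apply/andP; split; lra.
  have d2 : 0 < dl' / 2 by rewrite divr_gt0.
  have Ja := Ju a sa (le_trans (ltW au) ut).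
  apply: inprobS3 okpath_inprob (Su _ d2) (Hde a sa ua1 (ltW au) _ d2).
  move=> -[eps w] /= ok h1; rewrite -(phiE u (ltW su) ut) => h2.
  have h3 : `|phi a - phi u - (u - a) *: Ahat Q rho J G Dop u (phi u)| <= e / 2 * (u - a).
    have ua0 : 0 < u - a by lra.
    have := Hd1 (u - a) ua0; rewrite subKr => /(_ ltac:(lra) Ja).
    have phia : Ghat a u (phi u) = phi a := H2 a u t _ Ja Juu Jt (ltW au) ut.
    rewrite phia => h.
    rewrite (_ : _ - _ - _ = (u - a) *: ((u - a)^-1 *: (phi a - phi u) -
       Ahat Q rho J G Dop u (phi u))); last first.
      by rewrite scalerBr scalerA mulfV ?gt_eqF// scale1r.
    by rewrite normrZ gtr0_norm// mulrC ler_wpM2r// ltW.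
  rewrite (flow_cat (b := a) (phi u) ok Js Juu (lexx s) sa (ltW au)) in h1.
  have h4 := flow_contraction (flow eps a u w (phi u) - phi a) ok Js Ja (lexx s) sa.
  rewrite (flow_B _ _ ok Js Ja (lexx s) sa) in h4.
  have h5 : `|flow eps a u w (phi u) - phi a| <= e * (u - a) + dl' / 2.
    rewrite (_ : _ - _ = (flow eps a u w (phi u) - phi u -
       (u - a) *: Ahat Q rho J G Dop u (phi u)) -
       (phi a - phi u - (u - a) *: Ahat Q rho J G Dop u (phi u))); last by zmodule.
    by apply: le_trans (ler_normB _ _) _; lra.
  move: h1 h4; set v1 := flow _ _ t _ _; set v2 := flow _ _ _ _ (flow _ _ _ _ _).
  set v3 := flow _ _ _ _ (phi a) => h1 h4.
  have := ler_normD (v1 - v2) (v2 - v3); rewrite addrA subrK => /le_trans; apply.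
  by lra.
(* The limit from the right at [u] uses a single [y] slightly above [u]: [phi] is continuous, even
   in [Y1], and the evolution over [[u, y]] moves [phi u] little in probability. *)
- move=> u su ut Sy dl' dl'0.
  have Juu := Ju u su (ltW ut).
  have d4 : 0 < dl' / 4 by rewrite divr_gt0.
  have [A A0 HA] := flow_lip_inprob (Ff u) d4.
  have d4c : 0 < dl' / 4 / Ci by rewrite divr_gt0.
  have [d1 d10 Hd1] := within_continuousP cF (And3 Juu Jt (ltW ut)) d4c.
  have A1 : 0 < A + 1 by rewrite ltr_wpDl.
  pose q := Num.min d1 (dl' / 4 / (A + 1)).
  have q0 : 0 < q by rewrite lt_min d10 divr_gt0.
  pose y := Num.min t (u + q / 2).
  have uy : u < y by rewrite lt_min ut; lra.
  have yt : y <= t by rewrite ge_min lexx.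
  have yq : y <= u + q / 2 by rewrite ge_min lexx orbT.
  have qd : q <= d1 by rewrite ge_min lexx.
  have qA : q <= dl' / 4 / (A + 1) by rewrite ge_min lexx orbT.
  have sy := le_trans su (ltW uy).
  have Jy := Ju y sy yt.
  have hphi : `|phi y - phi u| <= dl' / 4.
    rewrite !phiE// ?(ltW ut)// -raddfB; apply: le_trans (HCi _) _.
    rewrite mulrC -ler_pdivlMr//; apply: ltW; apply: Hd1; first by split.
    by rewrite gtr0_norm ?subr_gt0//; lra.
  apply: inprobS3 okpath_inprob (Sy y yt uy _ d4) (HA u y Jy su (ltW uy)).
  move=> -[eps w] /= ok h1 /(_ y (ltW uy) (lexx y)) h2.
  rewrite -(phiE u su (ltW ut)) in h2.
  have h3 : A * (y - u) <= dl' / 4.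
    apply: (@le_trans _ _ ((A + 1) * (dl' / 4 / (A + 1)))).
      by apply: ler_pM => //; [rewrite subr_ge0 ltW|rewrite lerDl|lra].
    by rewrite mulrCA divff ?mulr1// gt_eqF.
  have h4 : e * (t - y) <= e * (t - u) by rewrite ler_pM2l//; lra.
  rewrite (flow_cat (b := u) (phi y) ok Js Jy (lexx s) su (ltW uy)) in h1.
  have h5 := flow_contraction (phi y - phi u) ok Juu Jy su (ltW uy).
  have h6 := flow_contraction (flow eps u y w (phi y) - phi u) ok Js Juu (lexx s) su.
  rewrite (flow_B _ _ ok Juu Jy su (ltW uy)) in h5.
  rewrite (flow_B _ _ ok Js Juu (lexx s) su) in h6.
  have h7 : `|flow eps u y w (phi y) - phi u| <= dl' / 4 + dl' / 2.
    rewrite (_ : _ - _ = (flow eps u y w (phi y) - flow eps u y w (phi u)) +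
      (flow eps u y w (phi u) - phi u)); last by rewrite addrA subrK.
    by apply: le_trans (ler_normD _ _) _; lra.
  move: h1 h6; set v1 := flow _ _ t _ _; set v2 := flow _ _ _ _ (flow _ _ _ _ _).
  set v3 := flow _ _ _ _ (phi u) => h1 h6.
  have := ler_normD (v1 - v2) (v2 - v3); rewrite addrA subrK => /le_trans; apply.
  by lra.
Qed.

(** On a short interval [[a, b]] convergence at [a] suffices, since evolution and limit both move
    little there; the short intervals are then joined by [cousin]. *)
Lemma flow_converges_uniformly f (Tm dl : R) : J Tm -> s <= Tm -> 0 < dl ->
  inprob P (0 : R)^'+ [set p | forall t, s <= t -> t <= Tm ->
    `|flow p.1 s t p.2 (iota f) - Ghat s t (iota f)| <= dl].
Proof.
move=> JT sT dl0; have [_ _ _ contH _] := regH.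
have d6 : 0 < dl / 6 by rewrite divr_gt0.
have [A A0 HA] := flow_lip_inprob f d6.
have A1 : 0 < A + 1 by rewrite ltr_wpDl.
apply: (@cousin R s Tm (fun a b => inprob P (0 : R)^'+ [set p | forall t, a <= t -> t <= b ->
    `|flow p.1 s t p.2 (iota f) - Ghat s t (iota f)| <= dl])) => //.
- move=> a b c _ _ _ _ H1 H2; apply: inprobS2 H1 H2 => -[eps w] /= h1 h2 t at' tc.
  have [tb|/ltW bt] := leP t b; first exact: h1.
  exact: h2.
move=> u su uT; have Ju : J u by exact: (Jconv Js JT su uT).
have [d1 d10 Hd1] := within_continuousP (contH s (iota f) Js) (conj Ju su) d6.
(* The last factor 1/2 is there because [a] and [b] lie on either side of [u], so that [b - a] is
   only below [2 * q]. *)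
pose q := Num.min d1 (dl / 6 / (A + 1) / 2).
have q0 : 0 < q by rewrite lt_min d10 !divr_gt0.
exists q => // a b sa au ub bT ua bu.
have qd : q <= d1 by rewrite ge_min lexx.
have qA : q <= dl / 6 / (A + 1) / 2 by rewrite ge_min lexx orbT.
have Jb : J b by exact: (Jconv Js JT (le_trans su ub) bT).
have Ja : J a by exact: (Jconv Js Ju sa au).
apply: inprobS3 okpath_inprob (flow_converges f Ja sa d6) (HA a b Jb sa (le_trans au ub)).
move=> -[eps w] /= ok h1 h2 t at' tb; have {}h2 := h2 t at' tb.
have st := le_trans sa at'.
have Jt : J t by exact: (Jconv Ja Jb at' tb).
have h3 : A * (b - a) <= dl / 6.
  apply: (@le_trans _ _ ((A + 1) * (dl / 6 / (A + 1)))).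
    by apply: ler_pM => //; [rewrite subr_ge0 (le_trans au)|rewrite lerDl|lra].
  by rewrite mulrCA divff ?mulr1// gt_eqF.
have h4 : `|Ghat s a (iota f) - Ghat s u (iota f)| < dl / 6.
  by apply: Hd1; [split|rewrite distrC ger0_norm ?subr_ge0//; lra].
have h5 : `|Ghat s t (iota f) - Ghat s u (iota f)| < dl / 6.
  by apply: Hd1; [split|rewrite ltr_norml; apply/andP; split; lra].
have h6 := flow_contraction (flow eps a t w (iota f) - iota f) ok Js Ja (lexx s) sa.
rewrite (flow_B _ _ ok Js Ja (lexx s) sa) -(flow_cat _ ok Js Jt (lexx s) sa at') in h6.
rewrite (_ : _ - _ = (flow eps s t w (iota f) - flow eps s a w (iota f)) +
  (flow eps s a w (iota f) - Ghat s a (iota f)) +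
  (Ghat s a (iota f) - Ghat s u (iota f)) -
  (Ghat s t (iota f) - Ghat s u (iota f))); last by zmodule.
apply: le_trans (ler_normB _ _) _; apply: le_trans (lerD (ler_normD _ _) (lexx _)) _.
apply: le_trans (lerD (lerD (ler_normD _ _) (lexx _)) (lexx _)) _.
by lra.
Qed.

(** * Contractivity, arbitrary initial vectors and weak convergence *)

Hypothesis Dense_iota : closure (iota @` Dense) = setT.

Let dense_approx (v : Y) (dl : R) : 0 < dl -> exists f, `|v - iota f| <= dl.
Proof.
move=> dl0; have : closure (iota @` Dense) v by rewrite Dense_iota.
move=> /(_ (ball v dl) (nbhsx_ballx _ _ dl0))[_ [[f _ <-]]].
by rewrite -ball_normE /= => /ltW; exists f.
Qed.

(** For [iota f], a single path on which the contraction [flow] is close to [Ghat] is enough.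
    Density then gives all [v], with the unspecified operator bound [Cb] serving only to control the
    approximation error. *)
Lemma limit_contraction (t : R) v : J t -> s <= t -> `|Ghat s t v| <= `|v|.
Proof.
move=> Jt st; have [opH _ _] := sgH.
have op : is_bounded_op (Ghat s t) by apply: opH.
have [_ [Cb HCb]] := op.
have key f : `|Ghat s t (iota f)| <= `|iota f|.
  apply/ler_addgt0Pr => e e0.
  have H : inprob P (0 : R)^'+ [set p | okpath p.1 p.2 /\
      `|flow p.1 s t p.2 (iota f) - Ghat s t (iota f)| <= e].
    exact: (inprobI okpath_inprob (flow_converges f Jt st e0)).
  have [eps [w [/= ok h]]] := inprob_ex H.
  have h1 := flow_contraction (iota f) ok Js Jt (lexx s) st.
  have := ler_normB (flow eps s t w (iota f)) (flow eps s t w (iota f) - Ghat s t (iota f)).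
  by rewrite opprB addrC subrK; lra.
apply/ler_addgt0Pr => e e0.
have q0 : 0 < `|Cb| + 1 by rewrite ltr_pwDr.
have r0 : 0 < `|Cb| + 2 by lra.
have [f hf] := dense_approx v (divr_gt0 e0 r0).
have h1 := HCb (v - iota f); rewrite (bounded_opB op) in h1.
have h2 : Cb * `|v - iota f| <= `|Cb| * `|v - iota f| by rewrite ler_wpM2r// ler_norm.
have h3 := ler_normD (Ghat s t v - Ghat s t (iota f)) (Ghat s t (iota f)).
rewrite subrK in h3.
have h4 := ler_normB v (v - iota f); rewrite opprB addrC subrK in h4.
have h5 := key f.
have h6 : (`|Cb| + 2) * `|v - iota f| <= e by rewrite mulrC -ler_pdivlMr.
have h7 : 0 <= `|v - iota f| by [].
lra.
Qed.

Lemma flow_converges_all v (Tm dl : R) : J Tm -> s <= Tm -> 0 < dl ->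
  inprob P (0 : R)^'+ [set p | forall t, s <= t -> t <= Tm ->
    `|flow p.1 s t p.2 v - Ghat s t v| <= dl].
Proof.
move=> JT sT dl0; have d3 : 0 < dl / 3 by rewrite divr_gt0.
have [f hf] := dense_approx v d3; have [opH _ _] := sgH.
apply: inprobS2 okpath_inprob (flow_converges_uniformly f JT sT d3).
move=> -[eps w] /= ok h t st tT; have {}h := h t st tT.
have Jt : J t by exact: (Jconv Js JT st tT).
have h1 := flow_contraction (v - iota f) ok Js Jt (lexx s) st.
have h2 := limit_contraction (v - iota f) Jt st.
rewrite (flow_B _ _ ok Js Jt (lexx s) st) in h1.
rewrite (bounded_opB (opH s t (And3 Js Jt st))) in h2.
rewrite (_ : _ - _ = (flow eps s t w v - flow eps s t w (iota f)) +
  (flow eps s t w (iota f) - Ghat s t (iota f)) -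
  (Ghat s t v - Ghat s t (iota f))); last by zmodule.
apply: le_trans (ler_normB _ _) _; apply: le_trans (lerD (ler_normD _ _) (lexx _)) _.
lra.
Qed.

(** Near [t], on either side, the jump count is constant, so the evolution varies only through one
    last factor [G], which is continuous in its end time, preceded by a fixed contraction. *)
Lemma Vop_rcll (fs : nat -> Y) (eps : R) w : okpath eps w ->
  rcll J s (fun t k => Vop x T G Dop eps s t w (fs k)).
Proof.
move=> ok; have [/andP[e0 e1] ne] := ok.
apply: rcll_coordinatewise.
- move=> t k [Jt st] e ep0.
  have [j1 j2] := jcntP e0 ne st.
  case: (regG (x (jcnt eps t w) w)) => _ _ _ /(_ t (fs k) Jt) cG _.
  have [d1 d10 Hd1] := within_continuousP cG (conj Jt (lexx t)) ep0.
  exists (Num.min d1 (jtime eps w (jcnt eps t w).+1 - t)).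
    by rewrite lt_min d10 subr_gt0.
  move=> u [Ju su] tu; rewrite -ltrBlDl lt_min => /andP[u1 u2].
  rewrite !Vop_flow// (flow_cat _ ok Js Ju (lexx s) st tu).
  have h1 := flow_contraction (flow eps t u w (fs k) - fs k) ok Js Jt (lexx s) st.
  rewrite (flow_B _ _ ok Js Jt (lexx s) st) in h1; apply: le_trans h1 _.
  have cu : jcnt eps u w = jcnt eps t w.
    by apply: jcnt_eq => //; [exact: le_trans tu|lra].
  rewrite /flow cu subnn /=.
  have := Hd1 u (conj Ju tu); rewrite ger0_norm ?subr_ge0// => /(_ u1)/ltW.
  by case: (sgG (x (jcnt eps t w) w)) => _ H _; rewrite (H t).
- move=> t k [Jt st] slt.
  have [m [a [sa at' Hm]]] : exists m a, [/\ s <= a, a < t &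
     forall u, a <= u -> u < t -> jcnt eps u w = m].
    (* If [t] is itself a jump time, the count just before [t] is one less than at [t]. Index 0
       cannot occur there, since [jtime eps w 0 = s - eps * s] is at most [s < t]. *)
    have [j1 j2] := jcntP e0 ne st; move: j1; rewrite le_eqVlt => /orP[/eqP j1|j1].
      case En : (jcnt eps t w) j1 => [|n] j1.
        move: j1; rewrite /jtime T0 => j1.
        have : 0 <= eps * s by rewrite mulr_ge0// ltW.
        by lra.
      have jn : jtime eps w n < t.
        by rewrite -j1 /jtime ltrD2l ltr_pM2l// ltrD2r.
      exists n, (Num.max s (jtime eps w n)); split.
      - by rewrite le_max lexx.
      - by rewrite gt_max slt jn.
      - move=> u; rewrite ge_max => /andP[su ju] ut.
        by apply: jcnt_eq => //; rewrite j1.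
    exists (jcnt eps t w), (Num.max s (jtime eps w (jcnt eps t w))); split.
    - by rewrite le_max lexx.
    - by rewrite gt_max slt j1.
    - move=> u; rewrite ge_max => /andP[su ju] ut.
      by apply: jcnt_eq => //; exact: lt_trans ut j2.
  have Ja : J a by exact: (Jconv Js Jt sa (ltW at')).
  exists (flow eps s a w (G (x m w) a t (fs k))) => e ep0.
  case: (regG (x m w)) => _ _ _ /(_ a (fs k) Ja) cG _.
  have [d1 d10 Hd1] := within_continuousP cG (conj Jt (ltW at')) ep0.
  exists (Num.min d1 (t - a)); first by rewrite lt_min d10 subr_gt0.
  move=> u [Ju su] ud ut.
  have /andP[u1 u2] : (t - d1 < u) && (a < u).
    have m1 : Num.min d1 (t - a) <= d1 by rewrite ge_min lexx.
    have m2 : Num.min d1 (t - a) <= t - a by rewrite ge_min lexx orbT.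
    by apply/andP; split; lra.
  rewrite Vop_flow// (flow_cat _ ok Js Ju (lexx s) sa (ltW u2)).
  have h1 := flow_contraction (flow eps a u w (fs k) - G (x m w) a t (fs k))
    ok Js Ja (lexx s) sa.
  rewrite (flow_B _ _ ok Js Ja (lexx s) sa) in h1; apply: le_trans h1 _.
  rewrite /flow (Hm u (ltW u2) ut) (Hm a (lexx a) at') subnn /=.
  apply: ltW; apply: Hd1; first by split => //; exact: ltW.
  by rewrite distrC gtr0_norm ?subr_gt0//; lra.
Qed.

Lemma limit_rcll (fs : nat -> Y) : rcll J s (fun t k => Ghat s t (fs k)).
Proof.
have [_ _ _ contH _] := regH.
apply: rcll_coordinatewise => t k Jt.
  move=> e e0; have [d1 d10 Hd1] := within_continuousP (contH s (fs k) Js) Jt e0.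
  exists d1 => // u Ju tu ud; apply/ltW/Hd1 => //.
  by rewrite ger0_norm ?subr_ge0//; lra.
move=> st; exists (Ghat s t (fs k)) => e e0.
have [d1 d10 Hd1] := within_continuousP (contH s (fs k) Js) Jt e0.
exists d1 => // u Ju tu ud; apply/ltW/Hd1 => //.
by rewrite distrC gtr0_norm ?subr_gt0//; lra.
Qed.

Variable tmax : nat -> R.
Hypothesis tmax_J : forall n, Jfrom J s (tmax n).
Hypothesis tmax_cofinal : forall Tm, Jfrom J s Tm -> \forall n \near \oo, Tm <= tmax n.

(** The limit is deterministic, so uniform convergence in probability of finitely many coordinates
    on [[s, tmax n]] makes [F] nearly constant off a small event; boundedness of [F] controls the
    rest. *)
Lemma Vop_cvg_dist (fs : nat -> Y) : cvg_dist_det J s P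
  (fun eps w t k => Vop x T G Dop eps s t w (fs k)) (fun t k => Ghat s t (fs k)).
Proof.
move=> F [K0 HK0] HF e e0; have [mE PE] := expl.
pose K := `|K0|.
have HK w : rcll J s w -> `|F w| <= K by move=> /HK0/le_trans; apply; exact: ler_norm.
have e8 : 0 < e / 8 by rewrite divr_gt0.
have rz := limit_rcll fs.
have [n Hn] := skorohod_locally_uniform tmax_cofinal rz HF e8.
have [Jn sn] := tmax_J n.
have n0 : 0 < n.+1%:R^-1 :> R by rewrite invr_gt0.
have H1 : inprob P (0 : R)^'+ [set p | forall k : 'I_n, forall t, s <= t -> t <= tmax n ->
    `|flow p.1 s t p.2 (fs k) - Ghat s t (fs k)| <= n.+1%:R^-1].
  by apply: inprob_fin => k; exact: flow_converges_all.
have K1 : 0 < K + 1 by rewrite ltr_wpDl// normr_ge0.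
(* This probability makes [2 * K * Dl <= e / 8], so the bound from [integral_near_const] is at most
   [2 * (e / 8 + e / 8) = e / 2]. *)
have Dl0 : 0 < e / 8 / (2 * (K + 1)) by rewrite divr_gt0// mulr_gt0.
have [r /= r0 Hr] := H1 _ Dl0.
exists r; split => // eps ep0 epr ep1.
have ebr : ball_ Num.norm 0 r eps by rewrite /ball_ /= sub0r normrN gtr0_norm.
have [B [mB PB] HB] := Hr eps ebr ep0.
have okw w : ~ explosion T w -> okpath eps w by move=> ne; split => //; rewrite ep0.
apply: le_lt_trans (@integral_near_const R d Omega P (explosion T) B _ _ (e / 8) K _
  mE PE mB PB _ _ _ _ _) _.
- exact: ltW.
- exact: normr_ge0.
- by move=> w ne; apply/HK/Vop_rcll/okw.
- exact: HK.
- move=> w ne nB; apply/ltW/Hn; first exact/Vop_rcll/okw.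
  move=> t k st tt kn; rewrite Vop_flow//; last exact: okw.
  exact: (HB w nB (Ordinal kn) t st tt).
rewrite lte_fin.
have : 2 * K * (e / 8 / (2 * (K + 1))) <= e / 8.
  apply: (@le_trans _ _ (2 * (K + 1) * (e / 8 / (2 * (K + 1))))).
    by rewrite ler_wpM2r ?(ltW Dl0)//; lra.
  by rewrite mulrCA divff ?mulr1// gt_eqF// mulr_gt0.
by lra.
Qed.

End Flow.

Lemma cofinal_times (R : realType) (J : set R) (s : R) : J s ->
  (J = [set t | 0 <= t] \/ exists Tinf : R, 0 < Tinf /\ J = [set t | 0 <= t <= Tinf]) ->
  exists tmax : nat -> R, (forall n, Jfrom J s (tmax n)) /\
    forall Tm, Jfrom J s Tm -> \forall n \near \oo, Tm <= tmax n.
Proof.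
move=> Js [JE|[Tinf [T0 JE]]]; rewrite JE in Js *.
  exists (fun n => s + n%:R); split.
    by move=> n; split; [rewrite /= addr_ge0|rewrite lerDl].
  move=> Tm _; exists (Num.truncn (Tm - s)).+1 => // n /= Hn.
  rewrite -lerBlDl; apply: ltW; apply: lt_le_trans (truncnS_gt _) _.
  by rewrite ler_nat.
move: Js => /= /andP[s0 sT]; exists (fun=> Tinf); split.
  by move=> n; split => //=; rewrite lexx ltW.
by move=> Tm [/= /andP[_ H] _]; apply: nearW.
Qed.

Unset Implicit Arguments.

Theorem theorem4p19 (R : realType) (Y Y1 : completeNormedModType R)
  (iota : {linear Y1 -> Y}) (J : set R)
  (d : measure_display) (Omega : measurableType d) (P : probability Omega R)
  (X : finType) (x : nat -> Omega -> X) (T : nat -> Omega -> R)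
  (Q : X -> X -> R -> R) (rho : X -> R)
  (G : X -> R -> R -> Y -> Y) (Dop : R -> X -> X -> Y -> Y)
  (Ghat : R -> R -> Y -> Y) :
  (* J = R^+ or J = [0, T_oo] *)
  (J = [set t | 0 <= t] \/ exists Tinf : R, 0 < Tinf /\ J = [set t | 0 <= t <= Tinf]) ->
  (* Banach spaces: separable, Y1 continuously embedded in Y *)
  separable Y -> separable Y1 -> injective iota -> continuous iota ->
  (* complete probability space *)
  measure_is_complete P ->
  (* ergodic Markov renewal process with semi-Markov kernel Q *)
  markov_renewal x T P Q ->
  (forall z, 0 <= rho z) -> \sum_(z : X) rho z = 1 ->
  (forall y, \sum_(z : X) rho z * Pmat Q z y = rho y) ->
  (forall z y, Pn Q n z y @[n --> \oo] --> rho y) ->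
  (* the semigroups Gamma_x and the operators D^eps(x,y) *)
  (forall z, inhom_semigroup J (G z)) ->
  (forall e z y, 0 < e <= 1 -> is_bounded_op (Dop e z y)) ->
  (* \hat D contains a countable family dense in Y1 and in Y *)
  (exists C : set Y1, [/\ countable C, C `<=` Dhat J iota G Dop,
                          closure C = setT & closure (iota @` C) = setT]) ->
  A0 J iota G Dop Q ->
  A1 J iota G Dop P x T ->
  A2 J iota G Dop Q P x T rho ->
  (* (A3): \hat A is the generator of the regular inhomogeneous semigroup \hat Gamma *)
  inhom_semigroup J Ghat -> regular J iota Ghat ->
  (forall t (f : Y1), J t -> genop J Ghat t (iota f) = Ahat Q rho J G Dop t (iota f)) ->
  [/\ contractionB J Ghat, inhom_semigroup J Ghat, regular J iota Ghat &
      forall (fs : nat -> Y) (s : R), J s ->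
        cvg_dist_det J s P
          (fun eps w t k => Vop x T G Dop eps s t w (fs k))
          (fun t k => Ghat s t (fs k))].
Proof.
move=> JE _ _ _ iota_cont _ mr rho_ge0 rho1 _ Pn_cvg sgG opD [Dense [_ DenseD cl1 cl2]].
move=> [D1Y1 [regG [cntA [[tau [tau0 Qtau]] [conG [conD [bdA [bdAg _]]]]]]]] _ _ sgH regH genH.
have J0 : J 0 by case: JE => [->|[Ti [T0 ->]]] /=; rewrite ?lexx// ltW.
have Jge0 a : J a -> 0 <= a by case: JE => [->//|[Ti [_ ->]] /andP[]].
have Jconv a b c : J a -> J c -> a <= b -> b <= c -> J b.
  case: JE => [->|[Ti [_ ->]]] /=; first by move=> a0 _ ab _; exact: le_trans ab.
  by move=> /andP[a0 _] /andP[_ cT] ab bc; rewrite (le_trans a0 ab) (le_trans bc cT).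
have bdAY1 f (DAf : forall z, inDA' J iota (G z) f) := (bdAg f DAf).2.
split => //.
- move=> s t v [Js Jt st].
  exact: (limit_contraction J0 Jge0 Jconv iota_cont mr rho_ge0 rho1 Pn_cvg tau0 Qtau
    sgG opD D1Y1 regG cntA conG conD bdA bdAY1 Js DenseD cl1 sgH regH genH cl2).
move=> fs s Js; have [tmax [tJ tc]] := cofinal_times Js JE.
exact: (Vop_cvg_dist J0 Jge0 Jconv iota_cont mr rho_ge0 rho1 Pn_cvg tau0 Qtau
  sgG opD D1Y1 regG cntA conG conD bdA bdAY1 Js DenseD cl1 sgH regH genH cl2 tJ tc).
Qed.
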